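(* Let $0\le r\le 4$ be an integer, let $s\in[1,\infty]$ and let $s^*=\frac{s}{s-1}\in[1,\infty]$ denote its conjugate exponent. Then for any $u\in\mathcal{DG}_r(\Omega)$, the discrete TV-seminorm $$|u|_{DTV(\Omega)}=\sum_T\int_T \mathcal I_T\{|\nabla u|_s\}\,dx+\sum_E\int_E\mathcal I_E\{|[\![u]\!]|\,|n_E|_s\}\,dS$$ satisfies $$|u|_{DTV(\Omega)}=\sup\Big\{\int_\Omega u\,\operatorname{div}p\,dx:\ p\in\mathcal{RT}^0_{r+1}(\Omega),\ |\sigma_{T,i}(p)|_{s^*}\le c_{T,i}\ \text{for all } T,\ i=1,\dots,\tfrac{r(r+1)}2,\ |\sigma_{E,j}(p)|\le |n_E|_s\,c_{E,j}\ \text{for all }E,\ j=1,\dots,r+1\Big\}.$$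
   Context: $\Omega\subset\mathbb R^2$ is a bounded domain with polygonal boundary, triangulated by a geometrically conforming mesh (no hanging nodes) of non-degenerate triangles $T$; $E$ ranges over the interior edges (those shared by two triangles). On each interior edge $E$, $n_E$ is a fixed normal vector of unit Euclidean length with arbitrary orientation. $|\cdot|_s$ is the $\ell^s$-norm on $\mathbb R^2$. $P_m(T)$ (resp. $P_m(E)$) denotes the polynomials of total degree at most $m$ on $T$ (resp. univariate polynomials of degree at most $m$ on $E$); $P_{-1}=\{0\}$. $\mathcal{DG}_r(\Omega)=\{u\in L^2(\Omega): u|_T\in P_r(T)\text{ for all }T\}$ (globally discontinuous piecewise polynomials). Let $\varphi_{T,i}$, $i=1,\dots,r(r+1)/2$, be the standard nodal (Lagrange) basis of $P_{r-1}(T)$ with Lagrange nodes $X_{T,i}$ forming the uniform lattice on $T$ (for $P_0(T)$: the barycenter), so $\varphi_{T,i}(X_{T,i'})=\delta_{ii'}$. For $r=0$ there are no indices $i$ and triangle terms are void. Let $\varphi_{E,j}$, $j=1,\dots,r+1$, be the standard nodal basis of $P_r(E)$ with equispaced Lagrange nodes $X_{E,j}$ on $E$ (including end points if $r\ge1$; the midpoint if $r=0$). The interpolation operators are $\mathcal I_T\{v\}=\sum_i v(X_{T,i})\varphi_{T,i}$ and $\mathcal I_E\{v\}=\sum_j v(X_{E,j})\varphi_{E,j}$. The weights are $c_{T,i}=\int_T\varphi_{T,i}\,dx$ and $c_{E,j}=\int_E\varphi_{E,j}\,dS$. For an interior edge $E$ between $T_1,T_2$ with outer unit normals $n_1,n_2=-n_1$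 along $E$, the scalar jump of $u$ is $[\![u]\!]=(u|_{T_1}n_1+u|_{T_2}n_2)\cdot n_E\in P_r(E)$; the vector-valued jump is $[\![u]\!]\,n_E$, whose $\ell^s$-norm is $|[\![u]\!]|\,|n_E|_s$. $\mathcal{RT}_{r+1}(\Omega)=\{p\in H(\operatorname{div};\Omega): p|_T\in P_r(T)^2+x\,P_r(T)\text{ for all }T\}$ is the Raviart--Thomas space, and $\mathcal{RT}^0_{r+1}(\Omega)$ is its subspace of functions with $p\cdot n=0$ on $\partial\Omega$. Its degrees of freedom are $\sigma_{T,i}(p)=\int_T\varphi_{T,i}\,p\,dx\in\mathbb R^2$ and $\sigma_{E,j}(p)=\int_E\varphi_{E,j}\,(p\cdot n_E)\,dS\in\mathbb R$ (over all triangles $T$ and all interior edges $E$); they uniquely determine $p\in\mathcal{RT}^0_{r+1}(\Omega)$ and may be prescribed arbitrarily. *)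

(* Defs.v *)
From mathcomp Require Import all_boot all_order all_algebra.
From mathcomp Require Import all_classical all_reals all_analysis.

Set Implicit Arguments.
Unset Strict Implicit.
Unset Printing Implicit Defensive.

Import Order.TTheory GRing.Theory Num.Theory.
Import numFieldNormedType.Exports.

Local Open Scope classical_set_scope.
Local Open Scope ring_scope.

Section Plane.
Context {R : realType}.
Implicit Types (a b v y : R * R) (f d : R * R -> R) (p : R * R -> R * R).
Implicit Types (A Omega : set (R * R)).

Definition leb2 : {measure set (measurableTypeR R * measurableTypeR R) -> \bar R} :=
  (@lebesgue_measure R \x @lebesgue_measure R)%E.

Definition intR2 A f : R := Rintegral leb2 A f.

Definition dot a b : R := a.1 * b.1 + a.2 * b.2.

Definition cross a b : R := a.1 * b.2 - a.2 * b.1.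

Definition enorm v : R := Num.sqrt (dot v v).

(* The l^s norm for s in [1, +oo]; the value at s = -oo is irrelevant. *)
Definition lnorm (s : \bar R) v : R :=
  match s with
  | s'%:E => (`|v.1| `^ s' + `|v.2| `^ s') `^ s'^-1
  | +oo%E => Num.max `|v.1| `|v.2|
  | -oo%E => 0
  end.

Definition bounded_domain Omega : Prop :=
  [/\ open Omega, connected Omega, Omega !=set0 & bounded_set Omega].

(* Bivariate polynomial functions of total degree < k, that is, P_(k-1);
   k = 0 gives P_(-1) = {0}. *)
Definition poly_deglt (k : nat) f : Prop :=
  exists c : nat -> nat -> R,
    forall y, f y = \sum_(i < k) \sum_(j < k - i) c i j * y.1 ^+ i * y.2 ^+ j.

(* P_r^2 + x P_r *)
Definition RT_local (r : nat) p : Prop :=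
  exists f1 f2 g : R * R -> R,
    [/\ poly_deglt r.+1 f1, poly_deglt r.+1 f2, poly_deglt r.+1 g &
        forall y, p y = (f1 y + y.1 * g y, f2 y + y.2 * g y)].

Definition dir (k : bool) : R * R := if k then (0, 1) else (1, 0).

Definition partial (k : bool) f : R * R -> R := fun y => 'D_(dir k) f y.

Definition grad f : R * R -> R * R :=
  fun y => (partial false f y, partial true f y).

(* All iterated partial derivatives exist and are continuous. *)
Definition smooth f : Prop :=
  forall ks : seq bool, let g := foldr partial f ks in
    continuous g /\ forall k y, derivable g y (dir k).

Definition test_function Omega f : Prop :=
  let supp := closure [set y | f y != 0] in
  [/\ smooth f, compact supp & supp `<=` Omega].

Definition L2 Omega f : Prop :=
  measurable_fun (Omega : set (measurableTypeR R * measurableTypeR R)) f /\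
  (\int[leb2]_(y in Omega) ((f y) ^+ 2)%:E < +oo)%E.

Definition weak_div Omega p d : Prop :=
  L2 Omega d /\
  forall w, test_function Omega w ->
    intR2 Omega (fun y => dot (p y) (grad w y)) =
    - intR2 Omega (fun y => d y * w y).

Definition Hdiv Omega p : Prop :=
  [/\ L2 Omega (fun y => (p y).1), L2 Omega (fun y => (p y).2) &
      exists d, weak_div Omega p d].

(* The weak divergence, a representative of an almost-everywhere class. *)
Definition divergence Omega p : R * R -> R :=
  xget (cst 0) [set d | weak_div Omega p d].

End Plane.

(* Vertices are numbered; a triangle is the set of its three vertices. *)
Record mesh (R : realType) := Mesh {
  nvtx : nat;
  vtx : 'I_nvtx -> R * R;
  triangles : {set {set 'I_nvtx}}
}.

Section Meshes.
Context {R : realType} (m : mesh R).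
Local Notation V := 'I_(nvtx m).
Local Notation x := (@vtx R m).
Implicit Types (T S : {set V}) (e : V * V) (Omega : set (R * R)).

(* Convex hull of the vertices in S: a closed triangle, edge, or vertex. *)
Definition hull S : set (R * R) :=
  [set y | exists l : V -> R,
    [/\ forall v, 0 <= l v, forall v, v \notin S -> l v = 0,
        \sum_v l v = 1 & y = \sum_v l v *: x v]].

Definition nondegenerate_triangle T : Prop :=
  #|T| = 3%N /\
  forall a b c, T = [set a; b; c]%SET -> cross (x b - x a) (x c - x a) != 0.

(* No hanging nodes: two triangles meet exactly in the (possibly empty) face
   spanned by their common vertices. *)
Definition conforming : Prop :=
  forall T S, T \in triangles m -> S \in triangles m ->
    hull T `&` hull S = hull (T :&: S)%SET.

(* Taking Omega to be the interior of the union of the closed triangles makes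
   the union its closure and excludes slits, so that an edge shared by two
   triangles is interior to Omega and any other edge lies on its boundary. *)
Definition triangulation Omega : Prop :=
  [/\ forall T, T \in triangles m -> nondegenerate_triangle T, conforming &
      Omega = interior [set y | exists2 T, T \in triangles m & hull T y]].

(* An edge is represented by its two end points, listed by increasing number. *)
Definition eset e : {set V} := [set e.1; e.2]%SET.

Definition incident T e : bool := (T \in triangles m) && (eset e \subset T).

Definition interior_edges : {set V * V} :=
  [set e : V * V | (e.1 < e.2)%N & #|[set T | incident T e]| == 2%N]%SET.

Definition boundary_edges : {set V * V} :=
  [set e : V * V | (e.1 < e.2)%N & #|[set T | incident T e]| == 1%N]%SET.

(* Functions on an edge are represented as functions of the parameter
   t in [0, 1] of the affine parametrization epoint e. *)
Definition epoint e (t : R) : R * R := (1 - t) *: x e.1 + t *: x e.2.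

Definition elength e : R := enorm (x e.2 - x e.1).

Definition int_edge e (g : R -> R) : R :=
  elength e * Rintegral (@lebesgue_measure R) `[0, 1] g.

Definition unit_normal e (n : R * R) : Prop :=
  enorm n = 1 /\ dot n (x e.2 - x e.1) = 0.

Definition outer_normal T e : R * R :=
  xget 0 [set n | unit_normal e n /\
                  forall y, hull T y -> dot n (y - x e.1) <= 0].

(* Multi-indices of the uniform lattice with k nodes per side of T, that is,
   of the Lagrange nodes of P_(k-1)(T); there are none if k = 0. *)
Definition lattice (k : nat) T : {set {ffun V -> 'I_k}} :=
  [set i : {ffun V -> 'I_k} |
    [forall v, (v \notin T) ==> (i v == 0%N :> nat)] &
    (\sum_v (i v : nat))%N.+1 == k]%SET.

Definition nodeT (k : nat) T (i : {ffun V -> 'I_k}) : R * R :=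
  if k == 1%N then (#|T|%:R)^-1 *: \sum_(v in T) x v
  else \sum_(v in T) ((i v)%:R / k.-1%:R) *: x v.

(* Nodal basis of P_(k-1)(T) *)
Definition phiT (k : nat) T (i : {ffun V -> 'I_k}) : R * R -> R :=
  xget (cst 0) [set f | poly_deglt k f /\
    forall i', i' \in lattice k T -> f (nodeT T i') = (i == i')%:R].

Definition interpT (k : nat) T (g : R * R -> R) : R * R -> R :=
  fun y => \sum_(i in lattice k T) g (nodeT T i) * phiT T i y.

Definition weightT (k : nat) T (i : {ffun V -> 'I_k}) : R :=
  intR2 (hull T) (phiT T i).

(* Parameters of the equispaced Lagrange nodes of P_r(E) *)
Definition nodeE (r : nat) (j : 'I_r.+1) : R :=
  if r == 0%N then 2^-1 else j%:R / r%:R.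

(* Nodal basis of P_r(E), in the parameter t *)
Definition phiE (r : nat) (j : 'I_r.+1) : {poly R} :=
  xget 0 [set q : {poly R} | (size q <= r.+1)%N /\
    forall j' : 'I_r.+1, q.[nodeE j'] = (j == j')%:R].

Definition interpE (r : nat) (g : R -> R) : R -> R :=
  fun t => \sum_(j < r.+1) g (nodeE j) * (phiE j).[t].

Definition weightE (r : nat) e (j : 'I_r.+1) : R :=
  int_edge e (horner (phiE j)).

(* f agrees with q almost everywhere on T *)
Definition agree_on (W : Type) T (f q : R * R -> W) : Prop :=
  \forall y \ae leb2, hull T y -> f y = q y.

(* The restriction of a piecewise polynomial to T, extended to the plane as
   a polynomial; traces on the edges of T are values of this extension. *)
Definition pieceDG (r : nat) T (u : R * R -> R) : R * R -> R :=
  xget (cst 0) [set q | poly_deglt r.+1 q /\ agree_on T u q].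

Definition pieceRT (r : nat) T (p : R * R -> R * R) : R * R -> R * R :=
  xget (cst 0) [set q | RT_local r q /\ agree_on T p q].

Definition DG (r : nat) Omega (u : R * R -> R) : Prop :=
  L2 Omega u /\
  forall T, T \in triangles m -> exists q, poly_deglt r.+1 q /\ agree_on T u q.

(* RT r is the Raviart-Thomas space with index r + 1. *)
Definition RT (r : nat) Omega (p : R * R -> R * R) : Prop :=
  Hdiv Omega p /\
  forall T, T \in triangles m -> exists q, RT_local r q /\ agree_on T p q.

Definition RT0 (r : nat) Omega (p : R * R -> R * R) : Prop :=
  RT r Omega p /\
  forall e T, e \in boundary_edges -> incident T e ->
    forall t, 0 <= t <= 1 ->
      dot (pieceRT r T p (epoint e t)) (outer_normal T e) = 0.

(* [[u]] on the edge e with fixed normal n *)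
Definition jump (r : nat) (u : R * R -> R) e (n : R * R) : R -> R :=
  fun t => \sum_(T | incident T e)
    pieceDG r T u (epoint e t) * dot (outer_normal T e) n.

(* p . n on e: the common value of the traces from the adjacent triangles,
   which coincide for p in H(div). *)
Definition normal_trace (r : nat) (p : R * R -> R * R) e (n : R * R) : R -> R :=
  xget (cst 0) [set g | forall T, incident T e ->
    forall t, 0 <= t <= 1 -> g t = dot (pieceRT r T p (epoint e t)) n].

Definition sigmaT (k : nat) (p : R * R -> R * R) T (i : {ffun V -> 'I_k}) : R * R :=
  (intR2 (hull T) (fun y => phiT T i y * (p y).1),
   intR2 (hull T) (fun y => phiT T i y * (p y).2)).

Definition sigmaE (r : nat) (p : R * R -> R * R) e (n : R * R) (j : 'I_r.+1) : R :=
  int_edge e (fun t => (phiE j).[t] * normal_trace r p e n t).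

Definition DTV (r : nat) (s : \bar R) (nE : V * V -> R * R) (u : R * R -> R) : R :=
  \sum_(T in triangles m)
    intR2 (hull T) (interpT r T (fun y => lnorm s (grad (pieceDG r T u) y))) +
  \sum_(e in interior_edges)
    int_edge e (interpE r (fun t => `|jump r u e (nE e) t| * lnorm s (nE e))).

End Meshes.

(* Main.v *)
Require Import Defs.
From mathcomp Require Import all_boot all_order all_algebra.
From mathcomp Require Import all_classical all_reals all_analysis.
From mathcomp Require Import measurable_realfun zify ring lra.
Import Order.TTheory GRing.Theory Num.Theory.
Import numFieldNormedType.Exports.
Local Open Scope classical_set_scope.
Local Open Scope ring_scope.
Set Implicit Arguments.
Unset Strict Implicit.
Unset Printing Implicit Defensive.

(** Integration by parts on each triangle gives, for every field [p] of the
    Raviart-Thomas space with vanishing normal component on the boundary,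

      int_Omega u div p = - sum_T int_T p . grad u + sum_E int_E [[u]] (p . n_E).

    On a triangle the components of [grad u] have degree at most [r - 1], and on
    an edge the jump has degree at most [r], so both coincide with their
    Lagrange interpolants. Inserting the interpolants leaves a finite expression
    ([duality_identity])

      - sum_(T, i) grad u (X_(T, i)) . sigma_(T, i) p
      + sum_(E, j) [[u]] (X_(E, j)) sigma_(E, j) p,

    which is linear in the degrees of freedom of [p]. The discrete total
    variation is, by linearity of the integral,

      sum_(T, i) c_(T, i) |grad u (X_(T, i))|_s
      + sum_(E, j) c_(E, j) |n_E|_s | [[u]] (X_(E, j)) |

    ([DTV_quadrature]). The constraints bound the degrees of freedom one by one,
    and the weights are nonnegative for [r <= 4] ([weightT_ge0],
    [integral_phiE_ge0]), so the Hoelder inequality ([lnorm_hoelder]) shows that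
    the total variation is an upper bound. It is attained: the degrees of freedom
    can be prescribed independently ([RT0_dofs]), so they can be chosen as
    extremal vectors for the dual norm ([lnorm_dual]) and as signs of the jumps,
    multiplied by the bounds that the constraints impose.

    Two facts about the space are behind this. First, the weak divergence of a
    field of the space is represented on each triangle by the classical
    divergence of its polynomial piece, and the normal traces of the two pieces
    agree on an interior edge. Both follow by testing with smooth functions:
    cutoffs exhausting an open triangle for the former ([weak_div_hull]), and
    the jump of the traces multiplied by a bump at the midpoint of the edge for
    the latter ([normal_traces_opp]), which uses that the two triangles lie on
    opposite sides of the edge ([opposite_sides]). Secondly, the local degrees of
    freedom are unisolvent: their square system is injective ([RT_kernel]), hence
    solvable, and the local solutions glue because normal traces are determined
    by their moments ([RT0_glue]). *)

(** * Integrals insensitive to null sets *)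

Section NullSets.
Context d (T : measurableType d) (R : realType).
Variable mu : {measure set T -> \bar R}.
Import HBNNSimple.

Lemma le_sup_sintegral_off_null (f g : T -> \bar R) (N : set T) :
  measurable N -> mu N = 0%E -> (forall x, 0 <= g x)%E ->
  (forall x, ~ N x -> f x = g x) ->
  (ereal_sup [set sintegral mu h |
     h in [set h : {nnsfun T >-> R} | forall x, (h x)%:E <= f x]] <=
   ereal_sup [set sintegral mu h |
     h in [set h : {nnsfun T >-> R} | forall x, (h x)%:E <= g x]])%E.
Proof.
move=> mN N0 g0 fg; apply: ge_ereal_sup => _ [h /= hf <-].
have mNC : measurable (~` N) by exact: measurableC.
have -> : sintegral mu h = sintegral mu (proj_nnsfun h mNC).
  rewrite -mrestrict -integral_nnsfun//.
  have := integral_nnsfun mu measurableT h; rewrite patch_setT => <-.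
  rewrite (@ge0_negligible_integral _ _ _ _ _ N)//.
  - by rewrite setTD.
  - by apply/measurable_EFinP; exact: measurable_funP.
  - by move=> x _; rewrite lee_fin.
apply: ereal_sup_ubound => /=; exists (proj_nnsfun h mNC) => // x.
rewrite -mrestrict patchE; case: ifPn => [|_]; last exact: g0.
by rewrite inE => /fg <-.
Qed.

(** The integral is a supremum over simple functions below the integrand, and
    a simple function can be cut off on a null set at no cost; hence the
    integrand need not be measurable. *)
Lemma integral_off_null (A B : set T) (f g : T -> \bar R) (N : set T) :
  measurable N -> mu N = 0%E ->
  (forall x, ~ N x -> (f \_ A) x = (g \_ B) x) ->
  (\int[mu]_(x in A) f x = \int[mu]_(x in B) g x)%E.
Proof.
move=> mN N0 fg.
have pos (f' g' : T -> \bar R) : (forall x, 0 <= f' x)%E -> (forall x, 0 <= g' x)%E ->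
    (forall x, ~ N x -> f' x = g' x) -> (\int[mu]_x f' x = \int[mu]_x g' x)%E.
  move=> f0 g0 fg'; rewrite !ge0_integralTE//; apply/eqP; rewrite eq_le.
  rewrite (le_sup_sintegral_off_null mN)//= (le_sup_sintegral_off_null mN)//.
  by move=> x /fg'.
rewrite [LHS]integral_mkcond [RHS]integral_mkcond integralE [RHS]integralE.
congr (_ - _)%E; apply: pos => // x /fg /= fgx.
  by rewrite !funeposE fgx.
by rewrite !funenegE fgx.
Qed.

End NullSets.

(** * Lebesgue measure on the plane *)

Section PlaneMeasure.
Context {R : realType}.
Notation MR := (measurableTypeR R).
Notation MP := (measurableTypeR R * measurableTypeR R)%type.

Lemma open_measurable2 (U : set (R * R)) : open U -> measurable (U : set MP).
Proof.
move=> oU.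
pose box (q : (rat * rat) * (rat * rat)) : set MP :=
  `]ratr q.1.1, ratr q.1.2[%classic `*` `]ratr q.2.1, ratr q.2.2[%classic.
pose Q := [set q | box q `<=` U].
have -> : (U : set MP) = \bigcup_q (if q \in Q then box q else set0).
  apply/seteqP; split=> [[a b] Uab|y [q _]]; last by case: ifPn => // /set_mem; exact.
  have := oU _ Uab; case=> -[A B] [/= /nbhs_ballP [e1 /= e10 eA] /nbhs_ballP [e2 /= e20 eB]] AB.
  have [p1 /andP[p1a p1b]] : exists q : rat, a - e1 < ratr q < a.
    by have [|q /= /itvP h] := @rat_in_itvoo R (a - e1) a; [rewrite ltrBlDr ltrDl| exists q; rewrite !h].
  have [p2 /andP[p2a p2b]] : exists q : rat, a < ratr q < a + e1.
    by have [|q /= /itvP h] := @rat_in_itvoo R a (a + e1); [rewrite ltrDl| exists q; rewrite !h].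
  have [p3 /andP[p3a p3b]] : exists q : rat, b - e2 < ratr q < b.
    by have [|q /= /itvP h] := @rat_in_itvoo R (b - e2) b; [rewrite ltrBlDr ltrDl| exists q; rewrite !h].
  have [p4 /andP[p4a p4b]] : exists q : rat, b < ratr q < b + e2.
    by have [|q /= /itvP h] := @rat_in_itvoo R b (b + e2); [rewrite ltrDl| exists q; rewrite !h].
  exists ((p1, p2), (p3, p4)) => //; rewrite ifT.
    by split => /=; rewrite in_itv/= ?p1b ?p2a ?p3b ?p4a.
  rewrite inE.
  move=> [x y] [/=]; rewrite !in_itv/= => /andP[x1 x2] /andP[y1 y2].
  apply: AB; split => /=.
    by apply: eA; rewrite /ball/= ltr_distlC; apply/andP; split; [exact: lt_trans x1|exact: lt_trans p2b].
  by apply: eB; rewrite /ball/= ltr_distlC; apply/andP; split; [exact: lt_trans y1|exact: lt_trans p4b].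
apply: countable_bigcupT_measurable; first exact: countableP.
by move=> q; case: ifP => // _; apply: measurableX; exact: measurable_itv.
Qed.

Lemma closed_measurable2 (U : set (R * R)) : closed U -> measurable (U : set MP).
Proof.
by move=> cU; rewrite -[U]setCK; apply: measurableC; apply: open_measurable2; exact: closed_openC.
Qed.

Lemma continuous_measurable2 (f : R * R -> R) (D : set MP) : continuous f ->
  measurable_fun D (f : MP -> MR).
Proof.
move=> cf; apply: measurable_funTS.
apply: (measurability _ (RGenOpens.measurableE R)).
move=> _ [_ [a [b ->] <-]]; rewrite setTI; apply: open_measurable2.
by apply: open_comp => //; exact: interval_open.
Qed.

Lemma lebesgue_affine_preimage (a b : R) (A : set MR) : a != 0 -> measurable A ->
  (lebesgue_measure ((fun t : MR => (a * (t : R) + b)%R : MR) @^-1` A) =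
   `|a|^-1%:E * lebesgue_measure A)%E.
Proof.
move=> a0 mA; set phi : MR -> MR := (fun t : MR => _).
have mphi : measurable_fun setT phi.
  apply: measurable_funD => //; exact: mulrl_measurable.
pose mu : {measure set MR -> \bar R} := mscale (NngNum (normr_ge0 a)) (measure_function_pushforward__canonical__measure_function_Measure (@lebesgue_measure R) mphi).
have na0 : 0 < `|a| by rewrite normr_gt0.
suff : (lebesgue_measure A = `|a|%:E * lebesgue_measure (phi @^-1` A))%E.
  by move=> ->; rewrite muleA -EFinM mulVf ?mul1e// gt_eqF.
transitivity (mu A); last by [].
apply: (lebesgue_measure_unique (mu:=mu)) => // X /ocitvP[->|[[x y] /= xy ->]].
  by rewrite !measure0.
rewrite /mu/mscale/= /pushforward lebesgue_measure_itv /= lte_fin xy.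
have [a_lt|a_gt|aE] := ltgtP a 0; last by rewrite aE eqxx in a0.
- have -> : phi @^-1` `]x, y] = `[(y - b) / a, (x - b) / a[%classic.
    apply/seteqP; split=> t; rewrite /= !in_itv/= /phi => /andP[h1 h2]; apply/andP; split.
    + by rewrite ler_ndivrMr// mulrC lerBrDr.
    + by rewrite ltr_ndivlMr// mulrC ltrBlDr.
    + by move: h2; rewrite ltr_ndivlMr// mulrC ltrBlDr.
    + by move: h1; rewrite ler_ndivrMr// mulrC lerBrDr.
  rewrite lebesgue_measure_itv /= lte_fin ltr_nM2r ?invr_lt0// ltrD2r xy.
  by rewrite -!EFinB -EFinM ltr0_norm//; congr (_%:E); field.
- have -> : phi @^-1` `]x, y] = `](x - b) / a, (y - b) / a]%classic.
    apply/seteqP; split=> t; rewrite /= !in_itv/= /phi => /andP[h1 h2]; apply/andP; split.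
    + by rewrite ltr_pdivrMr// mulrC ltrBlDr.
    + by rewrite ler_pdivlMr// mulrC lerBrDr.
    + by move: h1; rewrite ltr_pdivrMr// mulrC ltrBlDr.
    + by move: h2; rewrite ler_pdivlMr// mulrC lerBrDr.
  rewrite lebesgue_measure_itv /= lte_fin ltr_pM2r ?invr_gt0// ltrD2r xy.
  by rewrite -!EFinB -EFinM gtr0_norm//; congr (_%:E); field.
Qed.

(** Each shear-and-scale of one coordinate acts on the sections of a set by an
    affine map of the line, and the product measure integrates the measures of
    the sections. *)
Lemma leb2_shear2 (a b c : R) (A : set MP) : a != 0 -> measurable A ->
  leb2 ((fun y : MP => (y.1, (a * (y.2 : R) + (b * (y.1 : R) + c))%R : MR)) @^-1` A) =
  (`|a|^-1%:E * leb2 A)%E.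
Proof.
move=> a0 mA; rewrite /leb2 /= /product_measure1/=.
rewrite -ge0_integralZl//=; last exact: measurable_fun_xsection.
apply: eq_integral => x _; rewrite -(lebesgue_affine_preimage (b * x + c) a0).
  congr lebesgue_measure; apply/seteqP; split=> t /=; rewrite /xsection/= !inE//.
exact: measurable_xsection.
Qed.

Lemma leb2_shear1 (a b c : R) (A : set MP) : a != 0 -> measurable A ->
  leb2 ((fun y : MP => ((a * (y.1 : R) + (b * (y.2 : R) + c))%R : MR, y.2)) @^-1` A) =
  (`|a|^-1%:E * leb2 A)%E.
Proof.
move=> a0 mA.
have leb2E (X : set MP) : measurable X ->
    leb2 X = (\int[lebesgue_measure]_y lebesgue_measure (ysection X y))%E.
  move=> mX; rewrite /leb2 /=.
  rewrite (product_measure_unique (m' := lebesgue_measure \x^ lebesgue_measure)%E)//.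
  by move=> X1 X2 mX1 mX2; rewrite -product_measure2E.
rewrite !leb2E//; last first.
  have mf : measurable_fun setT (fun y : MP => ((a * (y.1 : R) + (b * (y.2 : R) + c))%R : MR, y.2)).
    apply: measurable_fun_pair => //=; apply: measurable_funD => /=.
      exact: measurable_funM.
    by apply: measurable_funD => //; exact: measurable_funM.
  by rewrite -[X in measurable X]setTI; exact: mf.
rewrite -ge0_integralZl//=; last exact: measurable_fun_ysection.
apply: eq_integral => x _; rewrite -(lebesgue_affine_preimage (b * x + c) a0).
  congr lebesgue_measure; apply/seteqP; split=> t /=; rewrite /ysection/= !inE//.
exact: measurable_ysection.
Qed.

(** The affine map sending the reference triangle to the triangle with vertex
    [x0] and edge vectors [a], [b]. *)
Definition aff (x0 a b : R * R) (y : R * R) : R * R := x0 + y.1 *: a + y.2 *: b.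

(** An affine map whose matrix has a nonzero corner entry is a composition of
    the two kinds of shears. *)
Lemma leb2_aff_preimage (x0 a b : R * R) (A : set MP) : cross a b != 0 -> measurable A ->
  leb2 (aff x0 a b @^-1` A) = (`|cross a b|^-1%:E * leb2 A)%E.
Proof.
have step (u v : R * R) (X : set MP) : cross u v != 0 -> u.1 != 0 -> measurable X ->
    leb2 (aff x0 u v @^-1` X) = (`|cross u v|^-1%:E * leb2 X)%E /\
    measurable (aff x0 u v @^-1` X : set MP).
  move=> uv u1 mX.
  pose f1 := fun y : MP => ((u.1 * (y.1 : R) + (v.1 * (y.2 : R) + x0.1))%R : MR, y.2).
  pose f2 := fun y : MP => (y.1, (cross u v / u.1 * (y.2 : R) +
    (u.2 / u.1 * (y.1 : R) + (x0.2 - u.2 / u.1 * x0.1)))%R : MR).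
  have -> : aff x0 u v @^-1` X = f1 @^-1` (f2 @^-1` X).
    rewrite -comp_preimage; congr (_ @^-1` X); apply/funext => y.
    rewrite /aff /f1 /f2 /cross /=; congr pair; rewrite /= /GRing.scale/=; first by ring.
    by field.
  have mf1 : measurable_fun setT f1.
    apply: measurable_fun_pair => //=; apply: measurable_funD => /=.
      exact: measurable_funM.
    by apply: measurable_funD => //; exact: measurable_funM.
  have mf2 : measurable_fun setT f2.
    apply: measurable_fun_pair => //=; apply: measurable_funD => /=.
      exact: measurable_funM.
    by apply: measurable_funD => //; exact: measurable_funM.
  have mX2 : measurable (f2 @^-1` X) by rewrite -[X in measurable X]setTI; exact: mf2.
  split; last by rewrite -[X in measurable X]setTI; exact: mf1.
  rewrite leb2_shear1// leb2_shear2//; last by rewrite mulf_neq0// invr_neq0.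
  rewrite muleA -EFinM; congr (_%:E * _)%E.
  by rewrite -invfM normrM normfV mulrCA divff ?mulr1// normr_eq0.
move=> ab mA; have [a1|a1] := eqVneq a.1 0; last by have [] := step a b A ab a1 mA.
(* a sum of two columns brings a nonzero entry to the first column *)
have b1 : b.1 != 0.
  by apply: contra_neq ab => b1; rewrite /cross a1 b1 mul0r mulr0 subr0.
have abE : cross (a + b) b = cross a b by rewrite /cross/=; ring.
have ab' : cross (a + b) b != 0.
  by rewrite abE.
have [] := step (a + b) b A ab' _ mA; first by rewrite /= a1 add0r.
rewrite abE => + mS; move=> <-; pose g := fun y : MP => (y.1, (1 * (y.2 : R) + ((-1) * (y.1 : R) + 0))%R : MR).
have -> : aff x0 a b @^-1` A = g @^-1` (aff x0 (a + b) b @^-1` A).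
  rewrite -comp_preimage; congr (_ @^-1` A); apply/funext => y.
  by rewrite /aff /g /=; congr pair; rewrite /= /GRing.scale/=; ring.
by rewrite leb2_shear2 ?oner_neq0// normr1 invr1 mul1e.
Qed.

Lemma measurable_aff (x0 a b : R * R) : measurable_fun setT (aff x0 a b : MP -> MP).
Proof.
have -> : (aff x0 a b : MP -> MP) = fun y : MP =>
    ((x0.1 + (y.1 : R) * a.1 + (y.2 : R) * b.1)%R : MR,
     (x0.2 + (y.1 : R) * a.2 + (y.2 : R) * b.2)%R : MR).
  by apply/funext.
by apply: measurable_fun_pair => /=; (apply: measurable_funD;
  first (apply: measurable_funD => //)); exact: measurable_funM.
Qed.

Lemma ge0_integral_aff (x0 a b : R * R) (A : set MP) (f : MP -> \bar R) :
  cross a b != 0 -> measurable A -> measurable_fun A f ->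
  (forall y, A y -> 0 <= f y)%E ->
  (\int[leb2]_(y in A) f y =
   `|cross a b|%:E * \int[leb2]_(y in aff x0 a b @^-1` A) f (aff x0 a b y))%E.
Proof.
move=> ab mA mf f0; have nab : 0 < `|cross a b| by rewrite normr_gt0.
have nabi : 0 <= `|cross a b|^-1 by rewrite invr_ge0 ltW.
have mphi := measurable_aff x0 a b.
rewrite -[X in (_ * X)%E](@ge0_integral_pushforward _ _ _ _ _ _ mphi)//; last first.
  by move=> y; rewrite inE; exact: f0.
rewrite [X in (_ = _ * X)%E](eq_measure_integral (mscale (NngNum nabi) (@leb2 R))); last first.
  move=> X mX XA; transitivity (leb2 (aff x0 a b @^-1` X)); first by [].
  by rewrite leb2_aff_preimage.
rewrite ge0_integral_mscale// muleA -EFinM /= mulfV ?mul1e//.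
exact: lt0r_neq0.
Qed.

Lemma intR2_aff (x0 a b : R * R) (A : set (R * R)) (f : R * R -> R) :
  cross a b != 0 -> measurable (A : set MP) -> measurable_fun (A : set MP) (f : MP -> MR) ->
  intR2 A f = `|cross a b| * intR2 (aff x0 a b @^-1` A) (fun y => f (aff x0 a b y)).
Proof.
move=> ab mA mf; have nab : 0 < `|cross a b| by rewrite normr_gt0.
have mf' : measurable_fun (A : set MP) (EFin \o f) by exact/measurable_EFinP.
rewrite /intR2 /Rintegral integralE [in RHS]integralE.
rewrite (ge0_integral_aff x0 ab mA (measurable_funepos mf'))//.
rewrite (ge0_integral_aff x0 ab mA (measurable_funeneg mf'))//.
rewrite (_ : (fun y => ((EFin \o f)^\+ (aff x0 a b y))%E) =
   ((EFin \o (fun y => f (aff x0 a b y)))^\+)%E); last by apply/funext => y; rewrite !funeposE.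
rewrite (_ : (fun y => ((EFin \o f)^\- (aff x0 a b y))%E) =
   ((EFin \o (fun y => f (aff x0 a b y)))^\-)%E); last by apply/funext => y; rewrite !funenegE.
case: integral => [r| |]; case: integral => [r'| |] /=;
  rewrite ?gt0_muley ?gt0_muleNy ?lte_fin//= ?mulr0//.
by rewrite mulrBr.
Qed.

End PlaneMeasure.

(** * Continuously differentiable functions of the plane *)

Section C1.
Context {R : realType}.
Implicit Types (f g : R * R -> R) (a v y z : R * R).

Definition C1 f : Prop :=
  continuous f /\ forall k, continuous (partial k f) /\ forall y, derivable f y (dir k).

(** Valid for both signs of [h], since the intermediate point is located by its
    distance to [s]. *)
Lemma mean_value_between (g dg : R -> R) (s h : R) :
  (forall x : R, is_derive x 1 g (dg x)) ->
  exists2 c, `|c - s| <= `|h| & g (s + h) - g s = dg c * h.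
Proof.
move=> gd.
have cg (A : set R) : {within A, continuous g}.
  apply: continuous_subspaceT => x; apply: differentiable_continuous.
  by apply/derivable1_diffP; have [] := gd x.
have [h0|h0] := leP 0 h.
  have [||c] := @MVT_segment R g dg s (s + h) _ (fun x _ => gd x) => //.
    by rewrite lerDl.
  rewrite in_itv/= => /andP[c1 c2] ->; exists c; last by rewrite addrAC subrr add0r.
  by rewrite !ger0_norm ?subr_ge0// lerBlDl.
have [||c] := @MVT_segment R g dg (s + h) s _ (fun x _ => gd x) => //.
  by rewrite gerDl ltW.
rewrite in_itv/= => /andP[c1 c2] e; exists c.
  rewrite distrC ger0_norm ?subr_ge0// ltr0_norm// lerBlDl; rewrite -lerBlDr opprK//.
by rewrite -opprB e opprD addNKr mulrN opprK.
Qed.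

Lemma is_derive_fst f (y : R * R) (c : R) : derivable f (c, y.2) (dir false) ->
  is_derive c 1 (fun s => f (s, y.2)) (partial false f (c, y.2)).
Proof.
rewrite /derivable /partial /derive => df.
have E : (fun h => h^-1 *: (((fun s => f (s, y.2)) \o shift c) (h *: 1) - f (c, y.2))) =
  (fun h : R => h^-1 *: ((f \o shift (c, y.2)) (h *: dir false) - f (c, y.2))).
  apply/funext => h /=; congr (_ *: (f _ - _)).
  by rewrite /dir; congr pair => /=; rewrite ?scaler0 ?add0r.
by split; rewrite /derivable /derive E.
Qed.

Lemma is_derive_snd f (y : R * R) (c : R) : derivable f (y.1, c) (dir true) ->
  is_derive c 1 (fun s => f (y.1, s)) (partial true f (y.1, c)).
Proof.
rewrite /derivable /partial /derive => df.
have E : (fun h => h^-1 *: (((fun s => f (y.1, s)) \o shift c) (h *: 1) - f (y.1, c))) =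
  (fun h : R => h^-1 *: ((f \o shift (y.1, c)) (h *: dir true) - f (y.1, c))).
  apply/funext => h /=; congr (_ *: (f _ - _)).
  by rewrite /dir; congr pair => /=; rewrite ?scaler0 ?add0r.
by split; rewrite /derivable /derive E.
Qed.

Lemma continuous_distP f : continuous f <-> forall z (e : R), 0 < e ->
  exists2 d : R, 0 < d & forall y, `|y.1 - z.1| < d -> `|y.2 - z.2| < d -> `|f y - f z| < e.
Proof.
split=> [cf z e e0|H z].
  have /cvgrPdist_lt /(_ e e0) /nbhs_ballP[d /= d0 H] := cf z.
  exists d => // y y1 y2; rewrite distrC; apply: H; split; rewrite /ball/= distrC//.
apply/cvgrPdist_lt => e e0; have [d d0 H'] := H z e e0.
exists (ball z.1 d, ball z.2 d); first by split; exact: nbhsx_ballx.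
by move=> y [/= y1 y2]; rewrite distrC; apply: H'; rewrite distrC.
Qed.

(** Moving along a segment splits into one move along each axis, and the mean
    value theorem applies to each. *)
Lemma is_derive_line f a v (t : R) : C1 f ->
  is_derive t 1 (fun s => f (a + s *: v)) (dot v (grad f (a + t *: v))).
Proof.
move=> [_ Cf]; set z := a + t *: v; set L := dot _ _.
suff H : (fun h => h^-1 *: (((fun s => f (a + s *: v)) \o shift t) (h *: 1) - f z)) @ 0^' --> L.
  split; first by apply/cvg_ex; exists L.
  exact: cvg_lim H.
have [c1 d1] := Cf false; have [c2 d2] := Cf true.
apply/cvgrPdist_le => e e0.
pose M := `|v.1| + `|v.2| + 1.
have M0 : 0 < M by rewrite ltr_wpDl// addr_ge0.
have eM : 0 < e / M by rewrite divr_gt0.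
have [r1 r10 H1] := (continuous_distP _).1 c1 z _ eM.
have [r2 r20 H2] := (continuous_distP _).1 c2 z _ eM.
pose r := Num.min r1 r2.
have r0 : 0 < r by rewrite lt_min r10.
near=> h.
have h0 : h != 0 by near: h; exact: nbhs_dnbhs_neq.
have hr : `|h| < r / M.
  near: h; apply: dnbhs0_lt; exact: divr_gt0.
have hv1 : `|h * v.1| < r.
  rewrite normrM; apply: (@le_lt_trans _ _ (`|h| * M)); last by rewrite -ltr_pdivlMr.
  by apply: ler_wpM2l => //; rewrite /M -addrA lerDl addr_ge0.
have hv2 : `|h * v.2| < r.
  rewrite normrM; apply: (@le_lt_trans _ _ (`|h| * M)); last by rewrite -ltr_pdivlMr.
  by apply: ler_wpM2l => //; rewrite /M addrAC lerDr addr_ge0.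
have [x1 x1z E1] := @mean_value_between (fun s => f (s, z.2 + h * v.2))
  (fun s => partial false f (s, z.2 + h * v.2)) z.1 (h * v.1)
  (fun s => @is_derive_fst f (0, z.2 + h * v.2) s (d1 _)).
have [x2 x2z E2] := @mean_value_between (fun s => f (z.1, s))
  (fun s => partial true f (z.1, s)) z.2 (h * v.2)
  (fun s => @is_derive_snd f (z.1, 0) s (d2 _)).
have -> : ((fun s => f (a + s *: v)) \o shift t) (h *: 1) - f z =
   h * (v.1 * partial false f (x1, z.2 + h * v.2) + v.2 * partial true f (z.1, x2)).
  have -> : h * (v.1 * partial false f (x1, z.2 + h * v.2) + v.2 * partial true f (z.1, x2)) =
    partial false f (x1, z.2 + h * v.2) * (h * v.1) + partial true f (z.1, x2) * (h * v.2).
    by ring.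
  have zE : f z = f (z.1, z.2) by [].
  rewrite -E1 -E2 zE [LHS]/=.
  have -> : a + (h *: 1 + t) *: v = (z.1 + h * v.1, z.2 + h * v.2).
    by rewrite /z; congr pair => /=; rewrite /GRing.scale/=; ring.
  by ring.
rewrite /GRing.scale/= mulrA mulVf// mul1r /L /dot /grad /=.
set p1 := partial false f z; set p2 := partial true f z.
have q1 : `|partial false f (x1, z.2 + h * v.2) - p1| <= e / M.
  apply: ltW; apply: H1 => /=.
    by apply: (le_lt_trans x1z); apply: (lt_le_trans hv1); rewrite ge_min lexx.
  by rewrite addrAC subrr add0r; apply: (lt_le_trans hv2); rewrite ge_min lexx.
have q2 : `|partial true f (z.1, x2) - p2| <= e / M.
  apply: ltW; apply: H2 => /=; first by rewrite subrr normr0.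
  by apply: (le_lt_trans x2z); apply: (lt_le_trans hv2); rewrite ge_min lexx orbT.
set P1 := partial false f (x1, _) in q1 *; set P2 := partial true f (_, x2) in q2 *.
have -> : v.1 * p1 + v.2 * p2 - (v.1 * P1 + v.2 * P2) = - (v.1 * (P1 - p1) + v.2 * (P2 - p2)).
  by ring.
rewrite normrN (le_trans (ler_normD _ _))// !normrM.
apply: (@le_trans _ _ (`|v.1| * (e / M) + `|v.2| * (e / M))).
  by apply: lerD; apply: ler_wpM2l.
rewrite -mulrDl mulrCA ler_piMr ?(ltW e0)// ler_pdivrMr// mul1r /M lerDl//.
Unshelve. all: by end_near. Qed.

Lemma C1_cst c : C1 (cst c).
Proof.
split; first by move=> ?; exact: cvg_cst.
move=> k; split=> [|y]; last exact: derivable_cst.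
rewrite (_ : partial k _ = cst 0) => [?|]; first exact: cvg_cst.
by apply/funext => y; rewrite /partial derive_cst.
Qed.

Lemma partialD k f g y : C1 f -> C1 g ->
  partial k (f \+ g) y = partial k f y + partial k g y.
Proof. by move=> [_ /(_ k)[_ df]] [_ /(_ k)[_ dg]]; rewrite /partial deriveD. Qed.

Lemma partialM k f g y : C1 f -> C1 g ->
  partial k (f \* g) y = f y * partial k g y + g y * partial k f y.
Proof. by move=> [_ /(_ k)[_ df]] [_ /(_ k)[_ dg]]; rewrite /partial deriveM. Qed.

Lemma C1D f g : C1 f -> C1 g -> C1 (f \+ g).
Proof.
move=> Cf Cg; split=> [y|k]; first by apply: cvgD; [exact: Cf.1|exact: Cg.1].
split=> [|y]; last by apply: derivableD; [exact: (Cf.2 k).2|exact: (Cg.2 k).2].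
rewrite (_ : partial k _ = partial k f \+ partial k g); last first.
  by apply/funext => y; rewrite partialD.
by move=> y; apply: cvgD; [exact: (Cf.2 k).1|exact: (Cg.2 k).1].
Qed.

Lemma C1M f g : C1 f -> C1 g -> C1 (f \* g).
Proof.
move=> Cf Cg; split=> [y|k]; first by apply: cvgM; [exact: Cf.1|exact: Cg.1].
split=> [|y]; last by apply: derivableM; [exact: (Cf.2 k).2|exact: (Cg.2 k).2].
rewrite (_ : partial k _ = (f \* partial k g) \+ (g \* partial k f)); last first.
  by apply/funext => y; rewrite partialM.
move=> y; apply: cvgD; apply: cvgM; [exact: Cf.1|exact: (Cg.2 k).1|exact: Cg.1|exact: (Cf.2 k).1].
Qed.

Definition affine (c p q : R) : R * R -> R := fun y => c + p * y.1 + q * y.2.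

Lemma is_derive_affine c p q y v : is_derive y v (affine c p q) (p * v.1 + q * v.2).
Proof.
have H : (fun h => h^-1 *: ((affine c p q \o shift y) (h *: v) - affine c p q y)) @ 0^' -->
    (p * v.1 + q * v.2).
  apply: cvg_near_cst; near=> h.
  have h0 : h != 0 by near: h; exact: nbhs_dnbhs_neq.
  by rewrite /affine /= /GRing.scale/=; field.
split; first by apply/cvg_ex; eexists; exact: H.
exact: cvg_lim H.
Unshelve. all: by end_near. Qed.

Lemma continuous_affine c p q : continuous (affine c p q).
Proof.
move=> y; apply: cvgD; last by apply: cvgM; [exact: cvg_cst|exact: cvg_snd].
by apply: cvgD; [exact: cvg_cst|apply: cvgM; [exact: cvg_cst|exact: cvg_fst]].
Qed.

Lemma partial_affine k c p q : partial k (affine c p q) = cst (if k then q else p).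
Proof.
apply/funext => y; rewrite /partial (@derive_val _ _ _ _ _ _ _ (is_derive_affine c p q y _)).
by case: k => /=; rewrite !(mulr0, mulr1) ?add0r ?addr0.
Qed.

Lemma C1_affine c p q : C1 (affine c p q).
Proof.
split=> [|k]; first exact: continuous_affine.
split=> [|y]; last by have [] := is_derive_affine c p q y (dir k).
by rewrite partial_affine => ?; exact: cvg_cst.
Qed.

Lemma partial_cst k (c : R) : partial k (cst c) = cst 0.
Proof. by apply/funext => y; rewrite /partial derive_cst. Qed.

Lemma C1_continuous f : C1 f -> continuous f. Proof. by case. Qed.

Lemma smooth_C1 f : smooth f -> C1 f.
Proof.
move=> sf; split; first by have [] := sf [::].
by move=> k; split; [have [] := sf [:: k]|move=> y; have [_ ] := sf [::]; exact].
Qed.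

End C1.

(** * The divergence theorem on a triangle *)

Section Divergence.
Context {R : realType}.
Notation MR := (measurableTypeR R).
Notation MP := (measurableTypeR R * measurableTypeR R)%type.
Notation mu := (@lebesgue_measure R).
Implicit Types (f g : R * R -> R) (a b v y z : R * R).

Definition in_box (M : R) : set (R * R) := [set y | `|y.1| <= M /\ `|y.2| <= M].

Lemma compact_in_box M : compact (in_box M).
Proof.
have -> : in_box M = `[- M, M]%classic `*` `[- M, M]%classic.
  by apply/seteqP; split=> y /=; rewrite /in_box /= !in_itv/= !ler_norml.
by apply: compact_setX; exact: segment_compact.
Qed.

Lemma leb2_in_box M : (leb2 (in_box M : set MP) < +oo)%E.
Proof.
have -> : in_box M = `[- M, M]%classic `*` `[- M, M]%classic.
  by apply/seteqP; split=> y /=; rewrite /in_box /= !in_itv/= !ler_norml.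
rewrite /leb2 /= product_measure1E//= lebesgue_measure_itv/=.
by case: ifP => // _; rewrite ?mule0// -!EFinB -EFinM ltry.
Qed.

Lemma leb2_bounded (A : set MP) M : A `<=` in_box M -> measurable A -> (leb2 A < +oo)%E.
Proof.
move=> AM mA; apply: le_lt_trans (leb2_in_box M); apply: le_measure => //; rewrite inE//.
by apply: closed_measurable2; apply: compact_closed; [exact: norm_hausdorff|exact: compact_in_box].
Qed.

Lemma continuous_bounded_on f M : continuous f ->
  exists2 B, 0 <= B & forall y, in_box M y -> `|f y| <= B.
Proof.
move=> cf; have : compact (f @` in_box M).
  by apply: continuous_compact; [exact: continuous_subspaceT|exact: compact_in_box].
move=> /compact_bounded [B [Br HB]]; exists (`|B| + 1); first by rewrite addr_ge0.
move=> y My; apply: (HB (`|B| + 1)); last by exists y.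
by rewrite (le_lt_trans (ler_norm _))// ltrDl.
Qed.

Lemma continuous_integrable2 f (A : set MP) M : continuous f ->
  A `<=` in_box M -> measurable A -> leb2.-integrable A (EFin \o f).
Proof.
move=> cf AM mA; apply: measurable_bounded_integrable => //.
- exact: (leb2_bounded AM).
- exact: continuous_measurable2.
have [B B0 HB] := continuous_bounded_on M cf.
exists B; split; first exact: num_real.
by move=> C BC y Ay; apply: le_trans (ltW BC); apply: HB; exact: AM.
Qed.

Definition tri0 : set (R * R) := [set y | [/\ 0 <= y.1, 0 <= y.2 & y.1 + y.2 <= 1]].

Lemma tri0_box : tri0 `<=` in_box 1.
Proof.
move=> [s t] [/= s0 t0 st]; rewrite /in_box/= !ger0_norm//; split; apply: le_trans st.
  by rewrite lerDl.
by rewrite lerDr.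
Qed.

Lemma closed_affine c p q : closed [set y : R * R | 0 <= affine c p q y].
Proof.
rewrite (_ : [set y | _] = affine c p q @^-1` [set x | 0 <= x])//.
by apply: preimage_closed; [move=> ? _; exact: continuous_affine|exact: closed_ge].
Qed.

Lemma measurable_tri0 : measurable (tri0 : set MP).
Proof.
apply: closed_measurable2.
have -> : tri0 = [set y | 0 <= affine 0 1 0 y] `&` [set y | 0 <= affine 0 0 1 y] `&`
    [set y | 0 <= affine 1 (-1) (-1) y].
  apply/seteqP; split => y; rewrite /tri0 /affine /=.
    by move=> [h1 h2 h3]; split; [split|]; lra.
  by move=> [[h1 h2] h3]; split; lra.
by apply: closedI; [apply: closedI|]; exact: closed_affine.
Qed.

Lemma FTC_01 (G g : R -> R) (c : R) : 0 <= c ->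
  (forall x : R, is_derive x 1 G (g x)) -> continuous g ->
  (\int[mu]_(x in `[0%R, c]) (g x)%:E = (G c - G 0)%:E)%E.
Proof.
move=> c0 dG cg; have [c1|c1] := ltP 0 c; last first.
  have -> : c = 0 by apply/le_anti; rewrite c1.
  by rewrite subrr set_itv1 integral_set1.
have cG : continuous G.
  by move=> x; apply: differentiable_continuous; apply/derivable1_diffP; have [] := dG x.
rewrite (@continuous_FTC2 _ g G)//.
- exact: continuous_subspaceT.
- split; first by move=> x _; have [] := dG x.
    by apply: cvg_at_right_filter; exact: cG.
  by apply: cvg_at_left_filter; exact: cG.
- by move=> x _; rewrite derive1E (@derive_val _ _ _ _ _ _ _ (dG x)).
Qed.

Lemma integrable_on_tri0 g : continuous g ->
  (lebesgue_measure \x lebesgue_measure)%E.-integrable (setT : set MP) (EFin \o (g \_ tri0)).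
Proof.
move=> cg; rewrite -restrict_EFin; apply/integrable_restrict => //.
  exact: measurable_tri0.
by rewrite setTI; exact: (continuous_integrable2 cg tri0_box measurable_tri0).
Qed.

Lemma continuous_slice2 g x : continuous g -> continuous (fun t => g (x, t)).
Proof.
move=> cg t; apply: (@continuous_comp _ _ _ (fun t => (x, t)) g) => /=; last exact: cg.
by apply: (@cvg_pair _ _ _ (nbhs t) (nbhs x) (nbhs t)) => /=; [exact: cvg_cst|exact: cvg_id].
Qed.

Lemma continuous_slice1 g x : continuous g -> continuous (fun t => g (t, x)).
Proof.
move=> cg t; apply: (@continuous_comp _ _ _ (fun t => (t, x)) g) => /=; last exact: cg.
by apply: (@cvg_pair _ _ _ (nbhs t) (nbhs t) (nbhs x)) => /=; [exact: cvg_id|exact: cvg_cst].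
Qed.

Lemma integral_tri0_snd f : C1 f ->
  intR2 tri0 (partial true f) = \int[mu]_(x in `[0, 1]) (f (x, 1 - x) - f (x, 0)).
Proof.
move=> Cf; have [cg dg] := Cf.2 true.
rewrite /intR2 /Rintegral integral_mkcond restrict_EFin.
rewrite -(integral12_prod_meas1 (integrable_on_tri0 cg)) [in RHS]integral_mkcond.
congr fine; apply: eq_integral => x _; rewrite /fubini_F patchE mem_setE in_itv/=.
case: ifPn => [/andP[x0 x1]|x01]; last first.
  rewrite -[RHS](integral0 mu setT); apply: eq_integral => t _ /=; rewrite patchE ifF//.
  apply/negbTE; apply: contra x01 => /set_mem[/= x0 t0 xt]; rewrite x0/=.
  by apply: le_trans xt; rewrite lerDl.
have x1' : 0 <= 1 - x by rewrite subr_ge0.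
rewrite -(@FTC_01 (fun t => f (x, t)) _ _ x1' (fun t => @is_derive_snd _ f (x, 0) t (dg _))
  (@continuous_slice2 _ x cg)).
rewrite [RHS]integral_mkcond; apply: eq_integral => t _ /=; rewrite !patchE.
rewrite (fun_if EFin); congr (if _ then _ else _).
rewrite mem_setE in_itv/=; apply/idP/idP.
  by move/set_mem => [/= _ -> xt]; rewrite lerBrDl.
by move=> /andP[t0 tx]; rewrite inE; split=> //=; rewrite -lerBrDl.
Qed.

Lemma integral_tri0_fst f : C1 f ->
  intR2 tri0 (partial false f) = \int[mu]_(x in `[0, 1]) (f (1 - x, x) - f (0, x)).
Proof.
move=> Cf; have [cg dg] := Cf.2 false.
rewrite /intR2 /Rintegral integral_mkcond restrict_EFin.
rewrite -(integral21_prod_meas1 (integrable_on_tri0 cg)) [in RHS]integral_mkcond.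
congr fine; apply: eq_integral => x _; rewrite /fubini_G patchE mem_setE in_itv/=.
case: ifPn => [/andP[x0 x1]|x01]; last first.
  rewrite -[RHS](integral0 mu setT); apply: eq_integral => t _ /=; rewrite patchE ifF//.
  apply/negbTE; apply: contra x01 => /set_mem[/= t0 x0 tx]; rewrite x0/=.
  by apply: le_trans tx; rewrite lerDr.
have x1' : 0 <= 1 - x by rewrite subr_ge0.
rewrite -(@FTC_01 (fun t => f (t, x)) _ _ x1' (fun t => @is_derive_fst _ f (0, x) t (dg _))
  (@continuous_slice1 _ x cg)).
rewrite [RHS]integral_mkcond; apply: eq_integral => t _ /=; rewrite !patchE.
rewrite (fun_if EFin); congr (if _ then _ else _).
rewrite mem_setE in_itv/=; apply/idP/idP.
  by move/set_mem => [/= -> _ tx]; rewrite lerBrDr.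
by move=> /andP[t0 tx]; rewrite inE; split=> //=; rewrite -lerBrDr.
Qed.

(** The barycentric coordinate attached to the vertex [x0 + a]. *)
Definition bcoord (x0 a b y : R * R) : R := cross (y - x0) b / cross a b.

Lemma bcoord_affine x0 a b :
  bcoord x0 a b = affine (- cross x0 b / cross a b) (b.2 / cross a b) (- b.1 / cross a b).
Proof. by apply/funext => y; rewrite /bcoord /affine /cross /=; ring. Qed.

Definition tri x0 a b : set (R * R) :=
  [set y | [/\ 0 <= bcoord x0 a b y, 0 <= bcoord x0 b a y & bcoord x0 a b y + bcoord x0 b a y <= 1]].

Lemma crossC a b : cross a b = - cross b a. Proof. by rewrite /cross; ring. Qed.

Lemma bcoord_aff x0 a b y : cross a b != 0 -> bcoord x0 a b (aff x0 a b y) = y.1.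
Proof.
rewrite /bcoord /aff /cross /= /GRing.scale/= => ab; field => //.
Qed.

Lemma bcoord_aff2 x0 a b y : cross a b != 0 -> bcoord x0 b a (aff x0 a b y) = y.2.
Proof.
move=> ab; have -> : aff x0 a b y = aff x0 b a (y.2, y.1) by rewrite /aff /= addrAC.
by rewrite bcoord_aff// crossC oppr_eq0.
Qed.

Lemma aff_bcoord x0 a b y : cross a b != 0 -> aff x0 a b (bcoord x0 a b y, bcoord x0 b a y) = y.
Proof.
rewrite /bcoord [cross b a]crossC /aff /cross /= => ab; rewrite [RHS]surjective_pairing; congr pair => /=.
  by rewrite /GRing.scale/=; field.
by rewrite /GRing.scale/=; field.
Qed.

Lemma preimage_tri x0 a b : cross a b != 0 -> aff x0 a b @^-1` tri x0 a b = tri0.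
Proof.
by move=> ab; apply/seteqP; split=> y; rewrite /tri /tri0 /= bcoord_aff// bcoord_aff2.
Qed.

Lemma closed_tri x0 a b : closed (tri x0 a b).
Proof.
have -> : tri x0 a b = [set y | 0 <= bcoord x0 a b y] `&` [set y | 0 <= bcoord x0 b a y] `&`
   [set y | 0 <= 1 - bcoord x0 a b y - bcoord x0 b a y].
  apply/seteqP; split => y; rewrite /tri /=.
    by move=> [h1 h2 h3]; split; [split|]; lra.
  by move=> [[h1 h2] h3]; split; lra.
apply: closedI; first by apply: closedI; rewrite bcoord_affine; exact: closed_affine.
rewrite !bcoord_affine; set c1 := _ / _; set p1 := _ / _; set q1 := _ / _.
set c2 := _ / cross b a; set p2 := _ / cross b a; set q2 := _ / cross b a.
rewrite (_ : [set y | _] = [set y | 0 <= affine (1 - c1 - c2) (- p1 - p2) (- q1 - q2) y]).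
  exact: closed_affine.
by apply/seteqP; split=> y /=; rewrite /affine => h; lra.
Qed.

Lemma measurable_tri x0 a b : measurable (tri x0 a b : set MP).
Proof. by apply: closed_measurable2; exact: closed_tri. Qed.

Lemma tri_box x0 a b : cross a b != 0 -> exists M, tri x0 a b `<=` in_box M.
Proof.
move=> ab; exists (`|x0.1| + `|x0.2| + `|a.1| + `|a.2| + `|b.1| + `|b.2|) => y yT.
rewrite -(aff_bcoord x0 y ab) /aff /=.
have [s0 t0 st] := yT.
have s1 : bcoord x0 a b y <= 1 by apply: le_trans st; rewrite lerDl.
have t1 : bcoord x0 b a y <= 1 by apply: le_trans st; rewrite lerDr.
have H (p q r : R) : `|p + bcoord x0 a b y * q + bcoord x0 b a y * r| <= `|p| + `|q| + `|r|.
  rewrite (le_trans (ler_normD _ _))// lerD// ?(le_trans (ler_normD _ _))// ?lerD//.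
    by rewrite normrM ger0_norm// ler_piMl.
  by rewrite normrM ger0_norm// ler_piMl.
have := H x0.1 a.1 b.1; have := H x0.2 a.2 b.2; rewrite /in_box /= /GRing.scale/= => h1 h2.
have p1 := normr_ge0 x0.1; have p2 := normr_ge0 x0.2; have p3 := normr_ge0 a.1.
have p4 := normr_ge0 a.2; have p5 := normr_ge0 b.1; have p6 := normr_ge0 b.2.
by split; lra.
Qed.

Lemma C1_aff f x0 a b : C1 f -> C1 (f \o aff x0 a b) /\ forall k y,
  partial k (f \o aff x0 a b) y = dot (if k then b else a) (grad f (aff x0 a b y)).
Proof.
move=> Cf; have ca : continuous (aff x0 a b).
  move=> y; rewrite /aff; apply: cvgD; last by apply: cvgZ; [exact: cvg_snd|exact: cvg_cst].
  by apply: cvgD; [exact: cvg_cst|apply: cvgZ; [exact: cvg_fst|exact: cvg_cst]].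
have D k y : is_derive y (dir k) (f \o aff x0 a b) (dot (if k then b else a) (grad f (aff x0 a b y))).
  have := is_derive_line (aff x0 a b y) (if k then b else a) 0 Cf.
  rewrite scale0r addr0 => -[].
  rewrite /derivable /derive.
  have -> : (fun h : R => h^-1 *: (((fun s : R => f (aff x0 a b y + s *: (if k then b else a))) \o shift 0) (h *: 1) -
      f (aff x0 a b y + 0 *: (if k then b else a)))) =
      (fun h => h^-1 *: (((f \o aff x0 a b) \o shift y) (h *: dir k) - (f \o aff x0 a b) y)).
    apply/funext => h /=; congr (_ *: (f _ - f _)); last by rewrite scale0r addr0.
    by case: k; rewrite /aff /=; congr pair => /=; rewrite /GRing.scale/=; ring.
  by move=> ? ?; split.
have P k y : partial k (f \o aff x0 a b) y = dot (if k then b else a) (grad f (aff x0 a b y)).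
  by rewrite /partial (@derive_val _ _ _ _ _ _ _ (D k y)).
split => //; split; first by move=> y; apply: continuous_comp; [exact: ca|exact: Cf.1].
move=> k; split=> [|y]; last by have [] := D k y.
rewrite (_ : partial k _ = fun y => dot (if k then b else a) (grad f (aff x0 a b y))); last exact/funext.
move=> y; rewrite /dot /grad /=; apply: cvgD; apply: cvgM; try exact: cvg_cst.
- by apply: (@continuous_comp _ _ _ (aff x0 a b)); [exact: ca|exact: (Cf.2 false).1].
- by apply: (@continuous_comp _ _ _ (aff x0 a b)); [exact: ca|exact: (Cf.2 true).1].
Qed.

(** The integral over [0, 1] of the flux of the field [(f1, f2)] through the
    segment from [p] to [q], counted along the normal to its right. *)
Definition flux (f1 f2 : R * R -> R) (p q : R * R) : R :=
  \int[mu]_(t in `[0, 1]) cross (f1 ((1 - t) *: p + t *: q), f2 ((1 - t) *: p + t *: q)) (q - p).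

Lemma continuous_segment f p q : continuous f -> continuous (fun t : R => f ((1 - t) *: p + t *: q)).
Proof.
move=> cf t; apply: (@continuous_comp _ _ _ (fun t : R => (1 - t) *: p + t *: q) f) => /=; last exact: cf.
apply: cvgD; apply: cvgZ; try exact: cvg_cst; last exact: cvg_id.
by apply: cvgB; [exact: cvg_cst|exact: cvg_id].
Qed.

Lemma integrable_01 (g : R -> R) : continuous g -> mu.-integrable `[0, 1] (EFin \o g).
Proof.
move=> cg; apply: continuous_compact_integrable; first exact: segment_compact.
exact: continuous_subspaceT.
Qed.

Lemma integral01D (g h : R -> R) : continuous g -> continuous h ->
  \int[mu]_(x in `[0, 1]) (g x + h x) = \int[mu]_(x in `[0, 1]) g x + \int[mu]_(x in `[0, 1]) h x.
Proof. by move=> cg ch; rewrite RintegralD//; exact: integrable_01. Qed.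

Lemma integral01B (g h : R -> R) : continuous g -> continuous h ->
  \int[mu]_(x in `[0, 1]) (g x - h x) = \int[mu]_(x in `[0, 1]) g x - \int[mu]_(x in `[0, 1]) h x.
Proof. by move=> cg ch; rewrite RintegralB//; exact: integrable_01. Qed.

Lemma integral01Z (c : R) (g : R -> R) : continuous g ->
  \int[mu]_(x in `[0, 1]) (c * g x) = c * \int[mu]_(x in `[0, 1]) g x.
Proof. by move=> cg; rewrite RintegralZl//; exact: integrable_01. Qed.

Lemma continuous_cross (f1 f2 : R -> R) (v : R * R) : continuous f1 -> continuous f2 ->
  continuous (fun t => cross (f1 t, f2 t) v).
Proof.
move=> c1 c2 t; rewrite /cross /=; apply: cvgB; apply: cvgM; try exact: cvg_cst.
  exact: c1.
exact: c2.
Qed.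

Lemma reference_divergence (G1 G2 : R * R -> R) : C1 G1 -> C1 G2 ->
  intR2 tri0 (fun y => partial false G1 y + partial true G2 y) =
  \int[mu]_(t in `[0, 1]) (G1 (1 - t, t) + G2 (1 - t, t)) -
  (\int[mu]_(t in `[0, 1]) G1 (0, t) + \int[mu]_(t in `[0, 1]) G2 (t, 0)).
Proof.
move=> C1G1 C1G2.
have cd (G : R * R -> R) : C1 G -> continuous (fun t : R => G (1 - t, t)).
  move=> CG t; apply: (@continuous_comp _ _ _ (fun t : R => (1 - t, t)) G) => /=; last exact: CG.1.
  apply: (@cvg_pair _ _ _ (nbhs t) (nbhs (1 - t)) (nbhs t)) => /=; last exact: cvg_id.
  by apply: cvgB; [exact: cvg_cst|exact: cvg_id].
have cd' (G : R * R -> R) : C1 G -> continuous (fun t : R => G (t, 1 - t)).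
  move=> CG t; apply: (@continuous_comp _ _ _ (fun t : R => (t, 1 - t)) G) => /=; last exact: CG.1.
  apply: (@cvg_pair _ _ _ (nbhs t) (nbhs t) (nbhs (1 - t))) => /=; first exact: cvg_id.
  by apply: cvgB; [exact: cvg_cst|exact: cvg_id].
rewrite /intR2 (RintegralD measurable_tri0
  (continuous_integrable2 (C1G1.2 false).1 tri0_box measurable_tri0)
  (continuous_integrable2 (C1G2.2 true).1 tri0_box measurable_tri0)).
rewrite -/(intR2 _ _) -/(intR2 _ _) integral_tri0_fst// integral_tri0_snd//.
have c1 := continuous_slice2 (x := 0) C1G1.1; have c2 := continuous_slice1 (x := 0) C1G2.1.
rewrite (integral01B (cd _ C1G1) c1).
rewrite (integral01B (cd' _ C1G2) c2).
rewrite (integral01D (cd _ C1G1) (cd _ C1G2)).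
rewrite (Rintegration_by_substitution_onem (G := fun t => G2 (t, 1 - t))) ?lexx ?ler01//; last first.
  by apply: continuous_subspaceT; exact: cd'.
have -> : \int[mu]_(x in `[unstable.onem 1, 1]) G2 (unstable.onem x, 1 - unstable.onem x) =
    \int[mu]_(t in `[0, 1]) G2 (1 - t, t).
  rewrite /unstable.onem subrr; apply: eq_Rintegral => t _; congr (G2 (_, _)).
  by rewrite opprB addrCA subrr addr0.
by rewrite addrACA opprD.
Qed.

(** The Piola transform carries the divergence on the triangle to the one on
    the reference triangle, where each partial derivative is integrated
    along its own axis. *)
Lemma divergence_tri f1 f2 x0 a b : cross a b != 0 -> C1 f1 -> C1 f2 ->
  intR2 (tri x0 a b) (fun y => partial false f1 y + partial true f2 y) =
  Num.sg (cross a b) * (flux f1 f2 x0 (x0 + a) + flux f1 f2 (x0 + a) (x0 + b) - flux f1 f2 x0 (x0 + b)).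
Proof.
move=> ab Cf1 Cf2; set J := cross a b.
have [C1f1 P1] := C1_aff x0 a b Cf1; have [C1f2 P2] := C1_aff x0 a b Cf2.
have cP : continuous (fun y => partial false f1 y + partial true f2 y).
  by move=> y; apply: cvgD; [exact: (Cf1.2 false).1|exact: (Cf2.2 true).1].
rewrite (intR2_aff x0 ab (measurable_tri _ _ _) (continuous_measurable2 cP)).
rewrite preimage_tri// -/J.
(* components of the field in the basis (a, b) *)
have comp (c d : R) : exists G, [/\ C1 G, forall y, G y = J^-1 * (c * f1 (aff x0 a b y) + d * f2 (aff x0 a b y)) &
    forall k y, partial k G y = J^-1 * (c * dot (if k then b else a) (grad f1 (aff x0 a b y)) +
      d * dot (if k then b else a) (grad f2 (aff x0 a b y)))].
  have C1' := C1M (C1_cst (J^-1 * c)) C1f1; have C2' := C1M (C1_cst (J^-1 * d)) C1f2.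
  exists ((cst (J^-1 * c) \* (f1 \o aff x0 a b)) \+ (cst (J^-1 * d) \* (f2 \o aff x0 a b))).
  split=> [|y|k y]; first exact: C1D.
    by rewrite /= mulrDr !mulrA.
  rewrite (partialD k y C1' C2') (partialM k y (C1_cst _) C1f1) (partialM k y (C1_cst _) C1f2).
  rewrite P1 P2 !partial_cst /= !mulr0 !addr0.
  by move: (J^-1) (dot _ _) (dot _ _) => *; ring.
have [G1 [CG1 V1 D1]] := comp b.2 (- b.1); have [G2 [CG2 V2 D2]] := comp (- a.2) a.1.
have E y : partial false f1 (aff x0 a b y) + partial true f2 (aff x0 a b y) =
    partial false G1 y + partial true G2 y.
  rewrite D1 D2 /dot /grad /=; move: (partial false f1 _) (partial true f1 _).
  move: (partial false f2 _) (partial true f2 _) => d21 d22 d11 d12.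
  transitivity ((a.1 * b.2 - a.2 * b.1) / J * (d11 + d22)).
    by rewrite -/(cross a b) -/J mulfV// mul1r.
  by move: (J^-1) a.1 a.2 b.1 b.2 => *; ring.
rewrite (_ : intR2 tri0 _ = intR2 tri0 (fun y => partial false G1 y + partial true G2 y)); last first.
  by rewrite /intR2; apply: eq_Rintegral => y _; exact: E.
clear D1 D2 E comp cP P1 P2 C1f1 C1f2.
rewrite (reference_divergence CG1 CG2).
have cS p q := continuous_cross (v := q - p) (@continuous_segment f1 p q Cf1.1) (@continuous_segment f2 p q Cf2.1).
have EJ (c : R) (g h : R -> R) : continuous h -> (forall t, g t = c * h t) ->
    \int[mu]_(x in `[0, 1]) g x = c * \int[mu]_(x in `[0, 1]) h x.
  move=> ch gh; rewrite -(integral01Z c ch).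
  by apply: eq_Rintegral => t _; rewrite gh.
have nJ : `|J| * J^-1 = Num.sg J by rewrite normrEsg -mulrA mulfV// mulr1.
have -> : \int[mu]_(x in `[0, 1]) G1 (0, x) = J^-1 * flux f1 f2 x0 (x0 + b).
  apply: EJ => [|t]; first exact: cS.
  have -> : (1 - t) *: x0 + t *: (x0 + b) = aff x0 a b (0, t).
    by rewrite /aff /= scale0r addr0 scalerDr addrA -scalerDl subrK scale1r.
  rewrite V1 /cross /= [x0.1 + _]addrC [x0.2 + _]addrC !addrK.
  by move: (J^-1) (f1 _) (f2 _) => *; ring.
have -> : \int[mu]_(x in `[0, 1]) G2 (x, 0) = - J^-1 * flux f1 f2 x0 (x0 + a).
  apply: EJ => [|t]; first exact: cS.
  have -> : (1 - t) *: x0 + t *: (x0 + a) = aff x0 a b (t, 0).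
    by rewrite /aff /= scale0r addr0 scalerDr addrA -scalerDl subrK scale1r.
  rewrite V2 /cross /= [x0.1 + _]addrC [x0.2 + _]addrC !addrK.
  by move: (J^-1) (f1 _) (f2 _) => *; ring.
have -> : \int[mu]_(t in `[0, 1]) (G1 (1 - t, t) + G2 (1 - t, t)) = J^-1 * flux f1 f2 (x0 + a) (x0 + b).
  apply: EJ => [|t]; first exact: cS.
  have -> : (1 - t) *: (x0 + a) + t *: (x0 + b) = aff x0 a b (1 - t, t).
    by rewrite /aff /= !scalerDr addrACA -scalerDl subrK scale1r addrA.
  rewrite V1 V2 /cross /= !opprD !addrA.
  by move: (J^-1) (f1 _) (f2 _) x0.1 x0.2 => *; ring.
by rewrite -nJ; move: (flux _ _ _ _) (flux _ _ _ _) (flux _ _ _ _) (J^-1) => *; ring.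
Qed.

End Divergence.

(** * Bivariate polynomial functions *)

Section PlanePolynomials.
Context {R : realType}.
Implicit Types (f g : R * R -> R) (a b v y z : R * R) (k l : nat).

Definition mono i j : R * R -> R := fun y => y.1 ^+ i * y.2 ^+ j.

Lemma poly_degltD k f g : poly_deglt k f -> poly_deglt k g -> poly_deglt k (fun y => f y + g y).
Proof.
move=> [c fc] [d gd]; exists (fun i j => c i j + d i j) => y.
rewrite fc gd -big_split/=; apply: eq_bigr => i _; rewrite -big_split/=.
by apply: eq_bigr => j _; rewrite !mulrDl.
Qed.

Lemma poly_degltZ k x f : poly_deglt k f -> poly_deglt k (fun y => x * f y).
Proof.
move=> [c fc]; exists (fun i j => x * c i j) => y.
rewrite fc mulr_sumr; apply: eq_bigr => i _; rewrite mulr_sumr.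
by apply: eq_bigr => j _; rewrite !mulrA.
Qed.

Lemma poly_deglt0 k : poly_deglt k (fun _ : R * R => 0).
Proof.
by exists (fun _ _ => 0) => y; rewrite big1// => i _; rewrite big1// => j _; rewrite !mul0r.
Qed.

Lemma poly_deglt_sum k (I : Type) (s : seq I) (P : pred I) (F : I -> R * R -> R) :
  (forall i, P i -> poly_deglt k (F i)) -> poly_deglt k (fun y => \sum_(i <- s | P i) F i y).
Proof.
move=> H; elim: s => [|i s IH].
  rewrite (_ : (fun y => _) = fun=> 0); first exact: poly_deglt0.
  by apply/funext => y; rewrite big_nil.
rewrite (_ : (fun y => _) = fun y => (if P i then F i y else 0) + \sum_(i <- s | P i) F i y).
  by apply: poly_degltD => //; case: (P i) (H i) => [h|_]; [exact: h|exact: poly_deglt0].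
by apply/funext => y; rewrite big_cons; case: ifP => // _; rewrite add0r.
Qed.

Lemma poly_deglt_mono k i j : (i + j < k)%N -> poly_deglt k (mono i j).
Proof.
move=> ijk; exists (fun i' j' => ((i' == i) && (j' == j))%:R) => y.
have ik : (i < k)%N by apply: leq_ltn_trans ijk; exact: leq_addr.
have jk : (j < k - i)%N by rewrite ltn_subRL.
rewrite (bigD1 (Ordinal ik))//= (bigD1 (Ordinal jk))//= !eqxx mul1r.
rewrite big1 ?addr0 => [|j' jj']; last first.
  by rewrite (negbTE (_ : (j' : nat) != j)) ?mul0r//; apply: contra_neq jj' => h; exact: val_inj.
rewrite big1 ?addr0// => i' ii'; rewrite big1// => j' _.
by rewrite (negbTE (_ : (i' : nat) != i)) ?mul0r//; apply: contra_neq ii' => h; exact: val_inj.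
Qed.

Lemma poly_deglt_ind k (P : (R * R -> R) -> Prop) :
  P (fun=> 0) -> (forall f g, P f -> P g -> P (fun y => f y + g y)) ->
  (forall x f, P f -> P (fun y => x * f y)) ->
  (forall i j, (i + j < k)%N -> P (mono i j)) ->
  forall f, poly_deglt k f -> P f.
Proof.
move=> P0 PD PZ PM f [c /funext ->].
have Psum (I : Type) (s : seq I) (F : I -> R * R -> R) :
    (forall i, P (F i)) -> P (fun y => \sum_(i <- s) F i y).
  move=> H; elim: s => [|i s IH].
    by rewrite (_ : (fun y => _) = fun=> 0)//; apply/funext => y; rewrite big_nil.
  rewrite (_ : (fun y => _) = fun y => F i y + \sum_(i <- s) F i y); first exact: PD.
  by apply/funext => y; rewrite big_cons.
apply: (Psum) => i; apply: (Psum) => j.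
rewrite (_ : (fun y => _) = fun y => c i j * mono i j y).
  apply/PZ/PM; have := ltn_ord j; lia.
by apply/funext => y; rewrite /mono mulrA.
Qed.

Lemma poly_deglt_widen k l f : (k <= l)%N -> poly_deglt k f -> poly_deglt l f.
Proof.
move=> kl; apply: poly_deglt_ind => [|g h|x g|i j ijk].
- exact: poly_deglt0.
- exact: poly_degltD.
- exact: poly_degltZ.
- by apply: poly_deglt_mono; exact: leq_trans kl.
Qed.

Lemma poly_degltM k l f g : poly_deglt k.+1 f -> poly_deglt l.+1 g ->
  poly_deglt (k + l).+1 (fun y => f y * g y).
Proof.
move=> fk gl; move: f fk; apply: poly_deglt_ind => [|f1 f2 h1 h2|x f1 h|i j ijk].
- by rewrite (_ : (fun y => _) = fun=> 0); [exact: poly_deglt0|apply/funext => y; rewrite mul0r].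
- rewrite (_ : (fun y => _) = fun y => f1 y * g y + f2 y * g y); first exact: poly_degltD.
  by apply/funext => y; rewrite mulrDl.
- rewrite (_ : (fun y => _) = fun y => x * (f1 y * g y)); first exact: poly_degltZ.
  by apply/funext => y; rewrite mulrA.
move: g gl; apply: poly_deglt_ind => [|f1 f2 h1 h2|x f1 h|i' j' ijk'].
- by rewrite (_ : (fun y => _) = fun=> 0); [exact: poly_deglt0|apply/funext => y; rewrite mulr0].
- rewrite (_ : (fun y => _) = fun y => mono i j y * f1 y + mono i j y * f2 y); first exact: poly_degltD.
  by apply/funext => y; rewrite mulrDr.
- rewrite (_ : (fun y => _) = fun y => x * (mono i j y * f1 y)); first exact: poly_degltZ.
  by apply/funext => y; rewrite mulrCA.
rewrite (_ : (fun y => _) = mono (i + i') (j + j')); first by apply: poly_deglt_mono; lia.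
by apply/funext => y; rewrite /mono !exprD; ring.
Qed.

Lemma poly_deglt_cst (c : R) : poly_deglt 1 (fun=> c).
Proof.
rewrite (_ : (fun=> c) = fun y => c * mono 0 0 y); first by apply/poly_degltZ/poly_deglt_mono.
by apply/funext => y; rewrite /mono !expr0 !mulr1.
Qed.

Lemma poly_deglt_affine (c p q : R) : poly_deglt 2 (affine c p q).
Proof.
rewrite (_ : affine c p q = fun y => c * mono 0 0 y + p * mono 1 0 y + q * mono 0 1 y).
  by apply: poly_degltD; [apply: poly_degltD|]; apply/poly_degltZ/poly_deglt_mono.
by apply/funext => y; rewrite /mono /affine !expr0 !expr1 !mulr1 mul1r.
Qed.

Lemma poly_degltX k n f : poly_deglt k.+1 f -> poly_deglt (k * n).+1 (fun y => f y ^+ n).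
Proof.
move=> fk; elim: n => [|n IH].
  by rewrite muln0 (_ : (fun y => _) = fun=> 1); [exact: poly_deglt_cst|apply/funext => y; rewrite expr0].
rewrite mulnS (_ : (fun y => _) = fun y => f y * f y ^+ n); first exact: poly_degltM.
by apply/funext => y; rewrite exprS.
Qed.

Lemma poly_deglt_aff k f x0 a b : poly_deglt k f -> poly_deglt k (f \o aff x0 a b).
Proof.
move: f; apply: poly_deglt_ind => [|f1 f2 h1 h2|x f1 h|i j ijk] /=.
- exact: poly_deglt0.
- exact: poly_degltD.
- exact: poly_degltZ.
apply: poly_deglt_widen ijk _; rewrite -[i]mul1n -[j]mul1n.
have -> : mono (1 * i) (1 * j) \o aff x0 a b =
   fun y => affine x0.1 a.1 b.1 y ^+ i * affine x0.2 a.2 b.2 y ^+ j.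
  apply/funext => y; rewrite !mul1n /mono /affine /aff /= /GRing.scale/=.
  by rewrite ![a.1 * _]mulrC ![b.1 * _]mulrC ![a.2 * _]mulrC ![b.2 * _]mulrC.
by apply: poly_degltM; apply: poly_degltX; exact: poly_deglt_affine.
Qed.

Lemma poly_deglt_line k f a v : poly_deglt k f ->
  exists2 p : {poly R}, (size p <= k)%N & forall t, f (a + t *: v) = p.[t].
Proof.
move: f; apply: poly_deglt_ind => [|f1 f2 [p1 s1 e1] [p2 s2 e2]|x f1 [p s e]|i j ijk].
- by exists 0; [rewrite size_poly0|move=> t; rewrite horner0].
- exists (p1 + p2); first by rewrite (leq_trans (size_polyD _ _))// geq_max s1.
  by move=> t; rewrite hornerD e1 e2.
- exists (x *: p); first by rewrite (leq_trans (size_scale_leq _ _)).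
  by move=> t; rewrite hornerZ e.
pose lin c d : {poly R} := c%:P + d *: 'X.
have sl c d : (size (lin c d) <= 2)%N.
  rewrite (leq_trans (size_polyD _ _))// geq_max (leq_trans (size_polyC_leq1 _))//=.
  by rewrite (leq_trans (size_scale_leq _ _))// size_polyX.
exists (lin a.1 v.1 ^+ i * lin a.2 v.2 ^+ j).
  apply: leq_trans (size_polyMleq _ _) _.
  have h1 := size_poly_exp_leq (lin a.1 v.1) i; have h2 := size_poly_exp_leq (lin a.2 v.2) j.
  have := sl a.1 v.1; have := sl a.2 v.2 => s2 s1.
  have m1 : ((size (lin a.1 v.1)).-1 * i <= i)%N by rewrite -{2}[i]mul1n leq_mul2r; apply/orP; right; lia.
  have m2 : ((size (lin a.2 v.2)).-1 * j <= j)%N by rewrite -{2}[j]mul1n leq_mul2r; apply/orP; right; lia.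
  by lia.
move=> t; rewrite hornerM !horner_exp /lin !hornerE /mono /=.
by rewrite /GRing.scale/= ![t * _]mulrC.
Qed.

Lemma is_derive_mono i j y v : is_derive y v (mono i j)
  (i%:R * v.1 * mono i.-1 j y + j%:R * v.2 * mono i j.-1 y).
Proof.
have d1 : is_derive y v (fun y : R * R => y.1) v.1.
  have := is_derive_affine 0 1 0 y v; rewrite mul1r mul0r addr0.
  by rewrite (_ : affine 0 1 0 = fun y => y.1)//; apply/funext => z; rewrite /affine add0r mul1r mul0r addr0.
have d2 : is_derive y v (fun y : R * R => y.2) v.2.
  have := is_derive_affine 0 0 1 y v; rewrite mul1r mul0r add0r.
  by rewrite (_ : affine 0 0 1 = fun y => y.2)//; apply/funext => z; rewrite /affine add0r mul0r add0r mul1r.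
have X1 := is_deriveX i d1; have X2 := is_deriveX j d2.
have := is_deriveM X1 X2.
rewrite (_ : _ * _ = mono i j); last first.
  by apply/funext => z; rewrite fctE !exprfctE.
move=> M; apply: (is_derive_eq M).
rewrite /mono !exprfctE.
move: (y.1 ^+ i) (y.2 ^+ j) (y.1 ^+ i.-1) (y.2 ^+ j.-1) (i%:R : R) (j%:R : R) v.1 v.2 => A B C D I J V W.
by rewrite /GRing.scale/=; ring.
Qed.

Lemma partial_mono (k : bool) i j : partial k (mono i j) =
  fun y => if k then j%:R * mono i j.-1 y else i%:R * mono i.-1 j y.
Proof.
apply/funext => y; rewrite /partial (@derive_val _ _ _ _ _ _ _ (is_derive_mono i j y (dir k))).
by case: k => /=; rewrite !(mulr0, mulr1) !mul0r ?add0r ?addr0.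
Qed.

Lemma continuous_mono i j : continuous (mono i j).
Proof.
have cX (g : R * R -> R) n : continuous g -> continuous (fun y => g y ^+ n).
  move=> cg; elim: n => [|n IH] y.
    by rewrite (_ : (fun y => _) = cst 1); [exact: cvg_cst|apply/funext => z; rewrite expr0].
  rewrite (_ : (fun y => _) = fun y => g y * g y ^+ n); last by apply/funext => z; rewrite exprS.
  by apply: cvgM; [exact: cg|exact: IH].
by move=> y; apply: cvgM; apply: cX => z; [exact: cvg_fst|exact: cvg_snd].
Qed.

Lemma C1_mono i j : C1 (mono i j).
Proof.
split=> [|k]; first exact: continuous_mono.
split=> [|y]; last by have [] := is_derive_mono i j y (dir k).
rewrite partial_mono => y; case: k; (apply: cvgM; first exact: cvg_cst); exact: continuous_mono.
Qed.

Lemma poly_deglt_C1 k f : poly_deglt k f -> C1 f /\ forall b : bool, poly_deglt k.-1 (partial b f).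
Proof.
move: f; apply: poly_deglt_ind => [|f1 f2 [c1 h1] [c2 h2]|x f1 [c h]|i j ijk].
- by split; [exact: C1_cst|move=> b; rewrite partial_cst; exact: poly_deglt0].
- split; first exact: C1D.
  move=> b; rewrite (_ : partial b _ = fun y => partial b f1 y + partial b f2 y).
    exact: poly_degltD.
  by apply/funext => y; rewrite -partialD.
- split; first exact: (C1M (C1_cst x) c).
  move=> b; rewrite (_ : partial b _ = fun y => x * partial b f1 y); first exact: poly_degltZ.
  by apply/funext => y; rewrite (partialM b y (C1_cst x) c) partial_cst mulr0 addr0.
split; first exact: C1_mono.
have pz (x : R) i' j' : (x != 0 -> (i' + j' < k.-1)%N) -> poly_deglt k.-1 (fun y => x * mono i' j' y).
  have [-> _|_ H] := eqVneq x 0; last by apply: poly_degltZ; exact/poly_deglt_mono/H.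
  by rewrite (_ : (fun y => _) = fun=> 0); [exact: poly_deglt0|apply/funext => y; rewrite mul0r].
by move=> b; rewrite partial_mono; case: b; apply: pz; rewrite pnatr_eq0; lia.
Qed.



Lemma poly_coef_eq0 k (c : nat -> R) : (forall t, \sum_(i < k) c i * t ^+ i = 0) ->
  forall i, (i < k)%N -> c i = 0.
Proof.
move=> H i ik; pose p := \poly_(i < k) c i.
have p0 : p = 0.
  apply/eqP; apply: contraT => pn0.
  have := max_poly_roots (rs := [seq n%:R | n <- iota 0 (size p)]) pn0.
  rewrite size_map size_iota ltnn => -> //.
    by apply/allP => t _; rewrite rootE horner_poly H.
  rewrite map_inj_uniq ?iota_uniq//; move=> x y /eqP; rewrite eqr_nat; exact/eqP.
by have := coef_poly k c i; rewrite -/p p0 coef0 ik.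
Qed.

(** A polynomial vanishing near a point vanishes along every line through it. *)
Lemma poly_deglt_eq0_near k f z : poly_deglt k f -> (\forall y \near z, f y = 0) -> forall y, f y = 0.
Proof.
move=> fk fz y; have [p ps pe] := poly_deglt_line z (y - z) fk.
suff p0 : p = 0 by have := pe 1; rewrite p0 horner0 scale1r addrCA subrr addr0.
apply/eqP; apply: contraT => pn0.
have [e e0 He] : exists2 e : R, 0 < e & forall t, `|t| < e -> p.[t] = 0.
  have c : (z + t *: (y - z)) @[t --> (0 : R)] --> z + 0 *: (y - z).
    by apply: cvgD; [exact: cvg_cst|apply: cvgZ; [exact: cvg_id|exact: cvg_cst]].
  rewrite scale0r addr0 in c.
  have /nbhs_ballP[e /= e0 He] := c _ fz; exists e => // t te; rewrite -pe; apply: He.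
  by rewrite /ball/= sub0r normrN.
have := max_poly_roots (rs := [seq e / (n + 2)%:R | n <- iota 0 (size p)]) pn0.
rewrite size_map size_iota ltnn => -> //.
  apply/allP => t /mapP[n _ ->]; rewrite rootE He// gtr0_norm ?divr_gt0// ?ltr0n ?addn2//.
  by rewrite ltr_pdivrMr ?ltr0n// ltr_pMr// ltr1n.
rewrite map_inj_uniq ?iota_uniq// => m n /(mulfI (lt0r_neq0 e0)) /invr_inj /eqP.
by rewrite eqr_nat eqn_add2r => /eqP.
Qed.

End PlanePolynomials.

(** * Barycentric coordinates on a triangle of the mesh *)

Section Barycentric.
Context {R : realType} (m : mesh R).
Notation MR := (measurableTypeR R).
Notation MP := (measurableTypeR R * measurableTypeR R)%type.
Local Notation V := 'I_(nvtx m).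
Local Notation x := (@vtx R m).
Implicit Types (T S : {set V}) (e : V * V) (u v w : V) (y z : R * R).

Lemma card3_sorted (key : V -> nat) T : #|T| = 3%N -> exists a b c,
  [/\ T = [set a; b; c]%SET, [/\ a != b, b != c & a != c] & (key a <= key b <= key c)%N].
Proof.
move=> T3; have /card_gt2P[a [b [c [[aT bT cT] [ab bc ca]]]]] : (2 < #|T|)%N by rewrite T3.
have TE : T = [set a; b; c]%SET.
  apply/esym/eqP; rewrite eqEcard; apply/andP; split.
    by apply/fintype.subsetP => v; rewrite !inE => /orP[/orP[]|] /eqP ->.
  by rewrite T3 finset.setUC !cardsU1 !inE cards1 negb_or ab ca eq_sym bc.
have perm (p q r : V) : p \in T -> q \in T -> r \in T -> p != q -> q != r -> p != r ->
    T = [set p; q; r]%SET.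
  move=> pT qT rT pq qr pr; apply/esym/eqP; rewrite eqEcard; apply/andP; split.
    by apply/fintype.subsetP => v; rewrite !inE => /orP[/orP[]|] /eqP ->.
  by rewrite T3 finset.setUC !cardsU1 !inE cards1 negb_or pq [r == p]eq_sym pr [r == q]eq_sym qr.
have ac : a != c by rewrite eq_sym.
have [k1|k1] := leqP (key a) (key b); have [k2|k2] := leqP (key b) (key c);
  have [k3|k3] := leqP (key a) (key c).
- by exists a, b, c; split=> //; rewrite k1.
- by exists a, b, c; split=> //; rewrite k1.
- by exists a, c, b; split; [apply: perm => //; rewrite eq_sym|split=> //; rewrite eq_sym|rewrite k3 ltnW].
- by exists c, a, b; split; [apply: perm => //; rewrite eq_sym|split=> //; rewrite eq_sym|rewrite k1 ltnW].
- by exists b, a, c; split; [apply: perm => //; rewrite eq_sym|split=> //; rewrite eq_sym|rewrite k3 ltnW].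
- by exists b, c, a; split; [apply: perm => //; rewrite eq_sym|split=> //; rewrite eq_sym|rewrite k2 ltnW].
- by exists c, b, a; split; [apply: perm => //; rewrite eq_sym|split=> //; rewrite eq_sym|rewrite ltnW// ltnW].
- by exists c, b, a; split; [apply: perm => //; rewrite eq_sym|split=> //; rewrite eq_sym|rewrite ltnW// ltnW].
Qed.

Lemma sum_triangle (W : nmodType) (a b c : V) (F : V -> W) : a != b -> b != c -> a != c ->
  (forall v, v \notin [set a; b; c]%SET -> F v = 0) -> \sum_v F v = F a + F b + F c.
Proof.
move=> ab bc ac F0; rewrite (bigD1 a)//= (bigD1 b)/=; last by rewrite eq_sym.
rewrite (bigD1 c)/=; last by rewrite ![c == _]eq_sym ac bc.
rewrite big1 ?addr0 ?addrA// => v /andP[/andP[va vb] vc]; apply: F0.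
by rewrite !inE (negbTE va) (negbTE vb) (negbTE vc).
Qed.

Definition barycentric T (lam : V -> R * R -> R) : Prop :=
  [/\ forall v, exists c p q, lam v = affine c p q, forall v, v \notin T -> lam v = cst 0,
      forall y, \sum_v lam v y = 1 & forall y, \sum_v lam v y *: x v = y].

Definition bary T : V -> R * R -> R := xget (fun _ => cst 0) [set lam | barycentric T lam].

Lemma nondegenerate_triple T : nondegenerate_triangle T -> forall a b c,
  T = [set a; b; c]%SET -> cross (x b - x a) (x c - x a) != 0 /\ [/\ a != b, b != c & a != c].
Proof.
move=> [T3 Tx] a b c TE; split; first exact: Tx.
have := T3; rewrite TE finset.setUC !cardsU1 !inE cards1 negb_or [c == a]eq_sym [c == b]eq_sym.
by case: (a != b) => //; case: (a != c) => //; case: (b != c).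
Qed.

(** Barycentric coordinates are unique, because the edge vectors at a vertex
    are independent. *)
Lemma barycentric_inj T (l l' : V -> R) : nondegenerate_triangle T ->
  (forall v, v \notin T -> l v = 0) -> (forall v, v \notin T -> l' v = 0) ->
  \sum_v l v = \sum_v l' v -> \sum_v l v *: x v = \sum_v l' v *: x v -> l =1 l'.
Proof.
move=> ndT l0 l0'; have [T3 _] := ndT.
have [a [b [c [TE [ab bc ac] _]]]] := @card3_sorted (fun _ => 0%N) T T3.
have [J _] := nondegenerate_triple ndT TE.
have l0T v : v \notin [set a; b; c]%SET -> l v = 0 by rewrite -TE; exact: l0.
have l0T' v : v \notin [set a; b; c]%SET -> l' v = 0 by rewrite -TE; exact: l0'.
rewrite (sum_triangle ab bc ac l0T) (sum_triangle ab bc ac l0T').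
rewrite !(sum_triangle ab bc ac) => [|v /l0T' ->|v /l0T ->]; rewrite ?scale0r//.
move=> s1 s2.
have /= e1 := congr1 fst s2; have /= e2 := congr1 snd s2.
move: e1 e2; rewrite /GRing.scale/= => e1 e2.
have bE : (l b - l' b) * cross (x b - x a) (x c - x a) = 0.
  rewrite /cross/=; move: s1 e1 e2.
  move: (l a) (l b) (l c) (l' a) (l' b) (l' c) (x a).1 (x b).1 (x c).1 (x a).2 (x b).2 (x c).2.
  move=> la lb lc la' lb' lc' a1 b1 c1 a2 b2 c2 s1 e1 e2.
  have laE : la = la' + lb' + lc' - lb - lc by lra.
  rewrite {s1}laE in e1 e2.
  have h1 : (lb - lb') * (b1 - a1) = - (lc - lc') * (c1 - a1) by lra.
  have h2 : (lb - lb') * (b2 - a2) = - (lc - lc') * (c2 - a2) by lra.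
  transitivity ((lb - lb') * (b1 - a1) * (c2 - a2) - (lb - lb') * (b2 - a2) * (c1 - a1)); first by ring.
  by rewrite h1 h2; ring.
have cE : (l c - l' c) * cross (x b - x a) (x c - x a) = 0.
  rewrite /cross/=; move: s1 e1 e2.
  move: (l a) (l b) (l c) (l' a) (l' b) (l' c) (x a).1 (x b).1 (x c).1 (x a).2 (x b).2 (x c).2.
  move=> la lb lc la' lb' lc' a1 b1 c1 a2 b2 c2 s1 e1 e2.
  have laE : la = la' + lb' + lc' - lb - lc by lra.
  rewrite {s1}laE in e1 e2.
  have h1 : (lc - lc') * (c1 - a1) = - (lb - lb') * (b1 - a1) by lra.
  have h2 : (lc - lc') * (c2 - a2) = - (lb - lb') * (b2 - a2) by lra.
  transitivity ((lc - lc') * (c2 - a2) * (b1 - a1) - (lc - lc') * (c1 - a1) * (b2 - a2)); first by ring.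
  by rewrite h1 h2; ring.
move/eqP: bE; rewrite mulf_eq0 (negbTE J) orbF subr_eq0 => /eqP bE.
move/eqP: cE; rewrite mulf_eq0 (negbTE J) orbF subr_eq0 => /eqP cE.
have aE : l a = l' a by move: s1; rewrite bE cE => /addIr /addIr.
move=> v; have [|/[dup]] := boolP (v \in T); last by move=> /l0 -> /l0' ->.
by rewrite TE !inE => /orP[/orP[]|] /eqP ->.
Qed.

Lemma baryP T : nondegenerate_triangle T -> barycentric T (bary T).
Proof.
move=> ndT; have [T3 _] := ndT.
have [a [b [c [TE [ab bc ac] _]]]] := @card3_sorted (fun _ => 0%N) T T3.
have [J _] := nondegenerate_triple ndT TE.
pose B := bcoord (x a) (x b - x a) (x c - x a); pose C := bcoord (x a) (x c - x a) (x b - x a).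
pose lam v : R * R -> R := if v == a then fun y => 1 - B y - C y else if v == b then B
  else if v == c then C else cst 0.
have [la lb lc] : [/\ lam a = fun y => 1 - B y - C y, lam b = B & lam c = C].
  by rewrite /lam !eqxx [b == a]eq_sym (negbTE ab) [c == a]eq_sym (negbTE ac) [c == b]eq_sym (negbTE bc).
apply: (@xgetPex _ (fun _ => cst 0) [set lam | barycentric T lam]); exists lam.
have off v : v \notin [set a; b; c]%SET -> lam v = cst 0.
  by rewrite !inE !negb_or /lam => /andP[/andP[/negbTE -> /negbTE ->] /negbTE ->].
split.
- move=> v; rewrite /lam; case: eqP => _.
    rewrite /B /C !bcoord_affine; set c1 := _ / _; set p1 := (x c - x a).2 / _; set q1 := (- (x c - x a).1) / _.
    set c2 := _ / cross (x c - x a) _; set p2 := _ / cross (x c - x a) _; set q2 := _ / cross (x c - x a) _.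
    exists (1 - c1 - c2), (- p1 - p2), (- q1 - q2); apply/funext => y.
    by rewrite /affine; ring.
  case: eqP => _; first by rewrite /B bcoord_affine; do 3!eexists.
  case: eqP => _; first by rewrite /C bcoord_affine; do 3!eexists.
  by exists 0, 0, 0; apply/funext => y; rewrite /affine !mul0r !addr0.
- by move=> v; rewrite TE; exact: off.
- move=> y; rewrite (sum_triangle ab bc ac) => [|v /off -> //]; rewrite la lb lc; ring.
- move=> y; rewrite (sum_triangle ab bc ac) => [|v /off ->]; last by rewrite scale0r.
  rewrite la lb lc -[RHS](aff_bcoord (x a) y J) /aff /=.
  rewrite -/(B y) -/(C y) !scalerBl scale1r !scalerBr.
  move: (B y) (C y) (x a) (x b) (x c) => s t [a1 a2] [b1 b2] [c1 c2].
  by congr pair; rewrite /= /GRing.scale/=; ring.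
Qed.


Lemma bary_affine T v : nondegenerate_triangle T -> exists c p q, bary T v = affine c p q.
Proof. by move=> /baryP[]. Qed.

Lemma bary_off T v : nondegenerate_triangle T -> v \notin T -> bary T v = cst 0.
Proof. by move=> /baryP[_ + _ _]; exact. Qed.

Lemma bary_sum T y : nondegenerate_triangle T -> \sum_v bary T v y = 1.
Proof. by move=> /baryP[_ _ + _]; exact. Qed.

Lemma bary_point T y : nondegenerate_triangle T -> \sum_v bary T v y *: x v = y.
Proof. by move=> /baryP[_ _ _ +]; exact. Qed.

Lemma bary_eq T y (l : V -> R) : nondegenerate_triangle T ->
  (forall v, v \notin T -> l v = 0) -> \sum_v l v = 1 -> \sum_v l v *: x v = y ->
  forall v, bary T v y = l v.
Proof.
move=> ndT l0 l1 ly; apply: (@barycentric_inj T) => //.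
- by move=> v vT; rewrite bary_off.
- by rewrite bary_sum.
- by rewrite bary_point.
Qed.

Lemma continuous_bary T v : nondegenerate_triangle T -> continuous (bary T v).
Proof. by move=> /(bary_affine v)[c [p [q ->]]]; exact: continuous_affine. Qed.

Lemma bary_vertex T v w : nondegenerate_triangle T -> w \in T -> bary T v (x w) = (v == w)%:R.
Proof.
move=> ndT wT; apply: (bary_eq (l := fun v => (v == w)%:R)) => //.
- by move=> u uT; case: eqP => // uw; rewrite uw wT in uT.
- by rewrite (bigD1 w)//= eqxx big1 ?addr0// => u /negbTE ->.
- by rewrite (bigD1 w)//= eqxx scale1r big1 ?addr0// => u /negbTE ->; rewrite scale0r.
Qed.

Lemma hullP T S y : nondegenerate_triangle T -> S \subset T ->
  hull S y <-> (forall v, 0 <= bary T v y) /\ (forall v, v \notin S -> bary T v y = 0).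
Proof.
move=> ndT /fintype.subsetP ST; split=> [[l [l0 lS l1 yE]]|[b0 bS]].
  have E := bary_eq ndT (fun v vT => lS v (contra (ST v) vT)) l1 (esym yE).
  by split=> [v|v vS]; rewrite E// lS.
by exists (fun v => bary T v y); split=> //; rewrite ?bary_sum ?bary_point.
Qed.

Lemma hull_triP T y : nondegenerate_triangle T -> hull T y <-> forall v, 0 <= bary T v y.
Proof.
move=> ndT; split=> [/(hullP _ ndT)[]//|h]; apply/(hullP _ ndT) => //; split=> // v vT.
by rewrite bary_off.
Qed.

Lemma hull_sub T S : S \subset T -> hull S `<=` @hull R m T.
Proof.
move=> /fintype.subsetP ST y [l [l0 lS l1 yE]]; exists l; split=> // v vT; apply: lS.
by apply: contra vT; exact: ST.
Qed.

Lemma in_triple T a b c v : T = [set a; b; c]%SET -> v \in T -> v = a \/ v = b \/ v = c.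
Proof. by move=> ->; rewrite !inE => /orP[/orP[]|] /eqP ->; [left|right; left|right; right]. Qed.

Lemma bary_bcoord T a b c y : nondegenerate_triangle T -> T = [set a; b; c]%SET ->
  [/\ bary T a y = 1 - bcoord (x a) (x b - x a) (x c - x a) y - bcoord (x a) (x c - x a) (x b - x a) y,
    bary T b y = bcoord (x a) (x b - x a) (x c - x a) y & bary T c y = bcoord (x a) (x c - x a) (x b - x a) y].
Proof.
move=> ndT TE; have [J [ab bc ac]] := nondegenerate_triple ndT TE.
have s1 := bary_sum y ndT; have s2 := bary_point y ndT.
have off v : v \notin [set a; b; c]%SET -> bary T v y = 0 by rewrite -TE => /bary_off ->.
rewrite (sum_triangle ab bc ac off) in s1.
rewrite (sum_triangle ab bc ac) in s2; last by move=> v /off ->; rewrite scale0r.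
have yE : y = aff (x a) (x b - x a) (x c - x a) (bary T b y, bary T c y).
  rewrite -{1}s2 /aff /= (_ : bary T a y = 1 - bary T b y - bary T c y); last by rewrite -s1; ring.
  move: (bary T b y) (bary T c y) (x a) (x b) (x c) => s t [a1 a2] [b1 b2] [c1 c2].
  by congr pair; rewrite /= /GRing.scale/=; ring.
have E1 := bcoord_aff (x a) (bary T b y, bary T c y) J.
have E2 := bcoord_aff2 (x a) (bary T b y, bary T c y) J.
rewrite -yE /= in E1 E2; rewrite E1 E2; split=> //.
by rewrite -s1; ring.
Qed.

Lemma hull_tri T a b c : nondegenerate_triangle T -> T = [set a; b; c]%SET ->
  hull T = tri (x a) (x b - x a) (x c - x a).
Proof.
move=> ndT TE; apply/seteqP; split=> y.
  move/(hull_triP y ndT) => h; have [h1 h2 h3] := bary_bcoord y ndT TE.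
  have := h a; have := h b; have := h c; rewrite h1 h2 h3 => ? ? ?; split=> //; lra.
move=> [h1 h2 h3]; apply/(hull_triP y ndT) => v; have [e1 e2 e3] := bary_bcoord y ndT TE.
have [|vT] := boolP (v \in T); last by rewrite bary_off.
by move=> /(in_triple TE)[->|[->|->]]; [rewrite e1 -addrA -opprD subr_ge0|rewrite e2|rewrite e3].
Qed.

Lemma triangle_vertices T : nondegenerate_triangle T -> exists a b c, T = [set a; b; c]%SET.
Proof. by move=> [/(card3_sorted (fun _ => 0%N))[a [b [c [TE _ _]]]] _]; exists a, b, c. Qed.

Lemma closed_hull T : nondegenerate_triangle T -> closed (hull T).
Proof.
move=> ndT; have [a [b [c TE]]] := triangle_vertices ndT.
by rewrite (hull_tri ndT TE); exact: closed_tri.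
Qed.

Lemma measurable_hull T : nondegenerate_triangle T -> measurable (hull T : set MP).
Proof. by move=> ndT; apply: closed_measurable2; exact: closed_hull. Qed.

Lemma hull_box T : nondegenerate_triangle T -> exists M, hull T `<=` in_box M.
Proof.
move=> ndT; have [a [b [c TE]]] := triangle_vertices ndT.
by rewrite (hull_tri ndT TE); apply: tri_box; have [] := nondegenerate_triple ndT TE.
Qed.

Lemma integrable_hull T (f : R * R -> R) : nondegenerate_triangle T -> continuous f ->
  leb2.-integrable (hull T : set MP) (EFin \o f).
Proof.
move=> ndT cf; have [M hM] := hull_box ndT.
exact: (continuous_integrable2 cf hM (measurable_hull ndT)).
Qed.

(** Vertices outside [T] have coordinate 0, so only those of [T] are constrained. *)
Definition otri T : set (R * R) := [set y | forall v, v \in T -> 0 < bary T v y].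

Lemma otri_hull T : nondegenerate_triangle T -> otri T `<=` hull T.
Proof.
move=> ndT y h; apply/(hull_triP y ndT) => v.
by have [/h/ltW//|vT] := boolP (v \in T); rewrite bary_off.
Qed.

Lemma open_otri T : nondegenerate_triangle T -> open (otri T).
Proof.
move=> ndT; have [a [b [c TE]]] := triangle_vertices ndT.
have o v : open (bary T v @^-1` [set t | 0 < t]).
  by apply: open_comp; [move=> ? _; exact: continuous_bary|exact: open_gt].
rewrite (_ : otri T = (bary T a @^-1` [set t | 0 < t]) `&` (bary T b @^-1` [set t | 0 < t]) `&`
    (bary T c @^-1` [set t | 0 < t])); first by apply: openI => //; exact: openI.
apply/seteqP; split=> y; rewrite /otri /= TE.
  by move=> h; split; [split|]; apply: h; rewrite !inE eqxx ?orbT.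
by move=> [[ha hb] hc] v; rewrite !inE => /orP[/orP[]|] /eqP ->.
Qed.

Lemma otri_centroid T : nondegenerate_triangle T -> otri T (3^-1 *: \sum_(v in T) x v).
Proof.
move=> ndT v vT; rewrite (bary_eq (l := fun v => if v \in T then 3^-1 else 0))// ?vT ?invr_gt0//.
- by move=> u /negbTE ->.
- by rewrite -big_mkcond sumr_const ndT.1 -[LHS]mulr_natr mulVf// pnatr_eq0.
- rewrite scaler_sumr [RHS]big_mkcond; apply: eq_bigr => u _; case: ifP => //; rewrite scale0r//.
Qed.

(** A vertical line is a product with a point, and every other line meets each
    vertical line in one point. *)
Lemma leb2_line_eq0 (c p q : R) : (p != 0) || (q != 0) ->
  leb2 ([set y : MP | affine c p q y = 0]) = 0%E.
Proof.
move=> pq; have mL : measurable ([set y : MP | affine c p q y = 0]).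
  apply: closed_measurable2.
  rewrite (_ : [set y | _] = affine c p q @^-1` [set x | x = 0])//.
  by apply: preimage_closed; [move=> ? _; exact: continuous_affine|exact: closed_eq].
have [q0|q0] := eqVneq q 0.
  rewrite q0 eqxx orbF in pq.
  rewrite (_ : [set y | _] = [set - c / p] `*` setT); last first.
    apply/seteqP; split=> y /=; rewrite /affine q0 mul0r addr0.
      by move=> e; split=> //; rewrite -[y.1](mulKf pq) -(addKr c (p * y.1)) e addr0 mulrC.
    by move=> [-> _]; rewrite mulrCA divff// mulr1 subrr.
  by rewrite /leb2 /= product_measure1E//= lebesgue_measure_set1 mul0e.
rewrite /leb2 /= /product_measure1 /=; apply: integral0_eq => t _.
rewrite (_ : xsection _ t = [set - (c + p * t) / q]) ?lebesgue_measure_set1//.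
apply/seteqP; split=> s; rewrite /xsection /= inE /affine /=.
  by move=> e; rewrite -[s](mulKf q0) -(addKr (c + p * t) (q * s)) e addr0 mulrC.
by move=> ->; rewrite mulrCA divff// mulr1 subrr.
Qed.

Lemma bary_zero_null T v : nondegenerate_triangle T -> v \in T ->
  leb2.-negligible ([set y | bary T v y = 0] : set MP).
Proof.
move=> ndT vT; have [c [p [q bE]]] := bary_affine v ndT.
exists [set y : MP | affine c p q y = 0]; split.
- apply: closed_measurable2.
  rewrite (_ : [set y | _] = affine c p q @^-1` [set x | x = 0])//.
  by apply: preimage_closed; [move=> ? _; exact: continuous_affine|exact: closed_eq].
- apply: leb2_line_eq0; rewrite -negb_and; apply/negP => /andP[/eqP p0 /eqP q0].
  have [w wT wv] : exists2 w, w \in T & v != w.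
    have [a [b [d TE]]] := triangle_vertices ndT; have [_ [ab bd ad]] := nondegenerate_triple ndT TE.
    have [va|va] := eqVneq v a; first by exists b; rewrite ?va// TE !inE eqxx orbT.
    by exists a => //; rewrite TE !inE eqxx.
  have := bary_vertex v ndT vT; have := bary_vertex v ndT wT.
  rewrite eqxx (negbTE wv) bE /affine p0 q0 !mul0r !addr0 => -> /esym/eqP.
  by rewrite oner_eq0.
- by move=> y; rewrite /= bE.
Qed.

Lemma hull_otri_null T : nondegenerate_triangle T ->
  leb2.-negligible (hull T `\` otri T : set MP).
Proof.
move=> ndT; have [a [b [c TE]]] := triangle_vertices ndT.
have n v : v \in T -> leb2.-negligible ([set y | bary T v y = 0] : set MP).
  exact: bary_zero_null.
have aT : a \in T by rewrite TE !inE eqxx.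
have bT : b \in T by rewrite TE !inE eqxx orbT.
have cT : c \in T by rewrite TE !inE eqxx !orbT.
apply: negligibleS (negligibleU (negligibleU (n _ aT) (n _ bT)) (n _ cT)) => y [/(hull_triP y ndT) h].
apply: contra_notP => /= H v vT; rewrite lt_neqAle h andbT eq_sym; apply/eqP => v0; apply: H.
by move: v0; have [->|[->|->]] := in_triple TE vT => ?; [left; left|left; right|right].
Qed.

(** * Null sets and polynomials *)

Lemma intR2_off_null (A B : set (R * R)) (f g : R * R -> R) (N : set MP) :
  leb2.-negligible N -> (forall y, ~ N y -> (f \_ A) y = (g \_ B) y) -> intR2 A f = intR2 B g.
Proof.
move=> [M [mM M0 NM]] H; rewrite /intR2 /Rintegral; congr fine.
apply: (integral_off_null mM M0) => y My.
have Ny : ~ N y by move=> /NM.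
by have := congr1 EFin (H y Ny); rewrite !patchE !(fun_if EFin).
Qed.

Lemma open_not_negligible (U : set (R * R)) z : open U -> U z -> ~ leb2.-negligible (U : set MP).
Proof.
move=> oU Uz [N [mN N0 UN]].
have := oU _ Uz; case=> -[A B] [/= /nbhs_ballP [e1 /= e10 eA] /nbhs_ballP [e2 /= e20 eB]] AB.
have : (leb2 (ball z.1 e1 `*` ball z.2 e2 : set MP) <= leb2 N)%E.
  apply: le_measure; rewrite ?inE//.
    by apply: measurableX; exact: measurable_ball.
  by move=> y [y1 y2]; apply: UN; apply: AB; split; [exact: eA|exact: eB].
rewrite N0 /leb2 /= product_measure1E//; [|exact: measurable_ball|exact: measurable_ball].
move=> H; have : (lebesgue_measure (ball z.1 e1) * lebesgue_measure (ball z.2 e2) <= 0%:E :> \bar R)%E.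
  exact: H.
have E (t e : R) : 0 < e -> (lebesgue_measure (ball t e) = (e *+ 2)%R%:E)%E.
  by move=> e0; rewrite lebesgue_measure_ball ?ltW.
by rewrite (E _ _ e10) (E _ _ e20) -EFinM lee_fin leNgt mulr_gt0// mulrn_wgt0.
Qed.

(** The points of the open triangle where [f] does not vanish form an open set,
    and nonempty open sets are not negligible. *)
Lemma continuous_ae_eq0 T (f : R * R -> R) : nondegenerate_triangle T -> continuous f ->
  leb2.-negligible ([set y | hull T y /\ f y != 0] : set MP) -> forall y, otri T y -> f y = 0.
Proof.
move=> ndT cf N0 y yT; apply/eqP; apply: contraT => fy.
have oU : open (otri T `&` f @^-1` [set t | t != 0]).
  apply: openI; first exact: open_otri.
  by apply: open_comp; [move=> ? _; exact: cf|exact: open_neq].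
exfalso; apply: (open_not_negligible oU (z := y)) => //.
by apply: negligibleS N0 => z [/(otri_hull ndT) ? ?].
Qed.

Lemma integral_hull_eq0 T (f : R * R -> R) : nondegenerate_triangle T -> continuous f ->
  (forall y, hull T y -> 0 <= f y) -> intR2 (hull T) f = 0 -> forall y, otri T y -> f y = 0.
Proof.
move=> ndT cf f0 If; apply: continuous_ae_eq0 => //.
have mh := measurable_hull ndT.
have mf : measurable_fun (hull T : set MP) (EFin \o f).
  by apply/measurable_EFinP; exact: continuous_measurable2.
have If' : (\int[leb2]_(y in hull T) (EFin \o f) y = 0)%E.
  rewrite -[LHS]fineK; first by congr EFin.
  exact: (integrable_fin_num mh (integrable_hull ndT cf)).
have := (ae_eq_integral_abs leb2 mh mf).1.
move=> H; have {}H : ae_eq leb2 (hull T) (EFin \o f) (cst 0%E).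
  apply: H; rewrite -[RHS]If'; apply: eq_integral => y; rewrite inE => hy /=.
  by rewrite ger0_norm// f0.
move: H; rewrite /ae_eq /=; apply: negligibleS => y /= [hy fy] H.
by move: fy; have /= := H hy; case=> ->; rewrite eqxx.
Qed.

Lemma poly_deglt_otri_eq0 T k (f : R * R -> R) : nondegenerate_triangle T -> poly_deglt k f ->
  (forall y, otri T y -> f y = 0) -> forall y, f y = 0.
Proof.
move=> ndT fk f0; apply: (poly_deglt_eq0_near fk (z := 3^-1 *: \sum_(v in T) x v)).
have : nbhs (3^-1 *: \sum_(v in T) x v) (otri T).
  by apply: open_nbhs_nbhs; split; [exact: open_otri|exact: otri_centroid].
exact: filterS.
Qed.

End Barycentric.

(** * Outer normals and Green's formula on a mesh triangle *)

Section GreenTriangle.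
Context {R : realType} (m : mesh R).
Notation MR := (measurableTypeR R).
Notation MP := (measurableTypeR R * measurableTypeR R)%type.
Notation mu := (@lebesgue_measure R).
Local Notation V := 'I_(nvtx m).
Local Notation x := (@vtx R m).
Implicit Types (T S : {set V}) (e : V * V) (u v w : V) (y z n : R * R).

Definition tangent e : R * R := x e.2 - x e.1.

Lemma enorm_sqr z : enorm z ^+ 2 = dot z z.
Proof. by rewrite /enorm sqr_sqrtr// /dot addr_ge0// -expr2 sqr_ge0. Qed.

Lemma enorm_ge0 z : 0 <= enorm z. Proof. exact: sqrtr_ge0. Qed.

Lemma elength_sqr e : @elength R m e ^+ 2 = (tangent e).1 ^+ 2 + (tangent e).2 ^+ 2.
Proof. by rewrite /elength enorm_sqr /dot !expr2. Qed.

Lemma elength_gt0 T a b c : nondegenerate_triangle T -> T = [set a; b; c]%SET -> 0 < @elength R m (a, b).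
Proof.
move=> ndT TE; have [J _] := nondegenerate_triple ndT TE.
rewrite lt_neqAle enorm_ge0 andbT eq_sym -sqrf_eq0 elength_sqr /tangent/=.
rewrite paddr_eq0 ?sqr_ge0// !sqrf_eq0; apply: contraNN J => /andP[/eqP h1 /eqP h2].
by rewrite /cross /= h1 h2 !mul0r subrr.
Qed.

(** Orthogonality to the edge leaves one degree of freedom, the coordinate
    along the rotated tangent, which the length fixes up to sign. *)
Lemma unit_normal_coord e n : 0 < @elength R m e -> unit_normal (m := m) e n ->
  (n.1 * (tangent e).2 - n.2 * (tangent e).1) ^+ 2 = @elength R m e ^+ 2 /\
  forall f : R * R, dot f n * @elength R m e ^+ 2 =
        (n.1 * (tangent e).2 - n.2 * (tangent e).1) * cross f (tangent e).
Proof.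
rewrite /unit_normal -/(tangent e) => L0 [n1 nt]; have := enorm_sqr n; rewrite n1 expr1n /dot -!expr2 => nn.
have LE := elength_sqr e.
move: nt; rewrite /dot => nt.
split.
  rewrite LE; move: (tangent e) nt => t nt.
  transitivity ((n.1 ^+ 2 + n.2 ^+ 2) * (t.1 ^+ 2 + t.2 ^+ 2) - (n.1 * t.1 + n.2 * t.2) ^+ 2); first by ring.
  by rewrite -nn nt mul1r expr0n subr0.
move=> f; rewrite LE /cross; move: (tangent e) nt => t nt.
transitivity ((n.1 * t.2 - n.2 * t.1) * (f.1 * t.2 - f.2 * t.1) +
    (n.1 * t.1 + n.2 * t.2) * (f.1 * t.1 + f.2 * t.2)); first by ring.
by rewrite nt mul0r addr0.
Qed.

Lemma sqr_eq_sg (k J L : R) : k ^+ 2 = L ^+ 2 -> 0 < L -> J != 0 -> 0 <= k * J -> k = Num.sg J * L.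
Proof.
move=> /eqP; rewrite eqf_sqr => /orP[] /eqP -> L0 J0; have [Jn|Jp|Je] := ltgtP J 0.
- by rewrite pmulr_rge0// leNgt Jn.
- by rewrite gtr0_sg// mul1r.
- by rewrite Je eqxx in J0.
- by rewrite ltr0_sg// mulN1r.
- by rewrite mulNr oppr_ge0 pmulr_rle0// leNgt Jp.
- by rewrite Je eqxx in J0.
Qed.

(** A unit normal is one of the two unit multiples of the rotated tangent; the
    third vertex selects its sign. *)
Lemma outer_normalP T a b c : nondegenerate_triangle T -> T = [set a; b; c]%SET ->
  unit_normal (m := m) (a, b) (outer_normal T (a, b)) /\
  forall f, dot f (outer_normal T (a, b)) * @elength R m (a, b) =
    Num.sg (cross (x b - x a) (x c - x a)) * cross f (tangent (a, b)).
Proof.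
move=> ndT TE; have [J _] := nondegenerate_triple ndT TE.
have L0 := elength_gt0 ndT TE; set L := elength _ in L0 *.
have LE := elength_sqr (a, b); rewrite -/L in LE.
pose n0 : R * R := (Num.sg (cross (x b - x a) (x c - x a)) / L) *: ((tangent (a, b)).2, - (tangent (a, b)).1).
have sg2 : Num.sg (cross (x b - x a) (x c - x a)) ^+ 2 = 1 by rewrite sqr_sg J.
have P0 : unit_normal (m := m) (a, b) n0 /\ forall y, hull T y -> dot n0 (y - x a) <= 0.
  split; first split.
  - rewrite /enorm (_ : dot _ _ = 1) ?sqrtr1//.
    transitivity (Num.sg (cross (x b - x a) (x c - x a)) ^+ 2 * L^-1 ^+ 2 *
      ((tangent (a, b)).1 ^+ 2 + (tangent (a, b)).2 ^+ 2)).
      rewrite /n0; move: (Num.sg _) (L^-1) (tangent _) => g Li t.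
      by rewrite /dot /= /GRing.scale/=; ring.
    by rewrite sg2 mul1r -LE exprVn mulVf// expf_neq0// gt_eqF.
  - by rewrite -/(tangent (a, b)) /n0 /dot /= /GRing.scale/=; ring.
  move=> y; rewrite (hull_tri ndT TE) => -[h1 h2 _].
  have E := aff_bcoord (x a) y J; rewrite -E /aff /=.
  move: (bcoord _ _ _ _) (bcoord _ _ _ _) h1 h2 {E} => s t s0 t0.
  rewrite (_ : dot _ _ = - (s / L * `|cross (x b - x a) (x c - x a)|)).
    by rewrite oppr_le0 mulr_ge0// divr_ge0// ltW.
  rewrite normrEsg /n0; move: (Num.sg _) (L^-1) => g Li.
  by rewrite /dot /cross /tangent /= /GRing.scale/=; ring.
have [un os] := @xgetPex _ 0 [set n | unit_normal (m := m) (a, b) n /\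
  forall y, hull T y -> dot n (y - x (a, b).1) <= 0] (ex_intro _ n0 P0).
rewrite -/(outer_normal T (a, b)) in un os; split=> // f.
have [k2 kf] := unit_normal_coord L0 un.
set k := (_ * _ - _) in k2 kf.
have hc : hull T (x c).
  apply/(hull_triP _ ndT) => v; rewrite bary_vertex ?ler0n//.
  by rewrite TE !inE eqxx orbT.
have := os _ hc; rewrite /= => osc.
have kJ : 0 <= k * cross (x b - x a) (x c - x a).
  have L20 : 0 <= L ^+ 2 by rewrite sqr_ge0.
  have := mulr_le0_ge0 osc L20.
  rewrite (_ : dot _ _ = dot (x c - x a) (outer_normal T (a, b))); last by rewrite /dot; ring.
  by rewrite kf crossC mulrN oppr_le0.
have kE := sqr_eq_sg k2 L0 J kJ.
apply: (mulIf (lt0r_neq0 L0)); rewrite -mulrA -expr2 kf kE.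
by rewrite mulrAC.
Qed.

Definition tri_edge T : pred (V * V) := fun e => (e.1 < e.2)%N && (eset e \subset T).

Lemma sum_tri_edges T a b c (F : V * V -> R) : T = [set a; b; c]%SET -> (a < b)%N -> (b < c)%N ->
  \sum_(e | tri_edge T e) F e = F (a, b) + F (b, c) + F (a, c).
Proof.
move=> TE ab bc; have ac := ltn_trans ab bc.
have ne u v : (u < v)%N -> v != u by move=> uv; apply: contraTneq uv => ->; rewrite ltnn.
rewrite (bigD1 (a, b))/=; last by rewrite /tri_edge ab /eset TE /= finset.subUset !finset.sub1set !inE !eqxx ?orbT.
rewrite (bigD1 (b, c))/=; last first.
  by rewrite /tri_edge bc /eset TE /= finset.subUset !finset.sub1set !inE !eqxx ?orbT xpair_eqE (negbTE (ne _ _ ab)).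
rewrite (bigD1 (a, c))/=; last first.
  rewrite /tri_edge ac /eset TE /= finset.subUset !finset.sub1set !inE !eqxx ?orbT !xpair_eqE.
  by rewrite (negbTE (ne _ _ bc)) eq_sym (negbTE (ne _ _ ab)) !andbF.
rewrite big1 ?addr0 ?addrA// => -[u v] /andP[/andP[/andP[/andP[/= uv]]]].
rewrite /eset /= finset.subUset !finset.sub1set => /andP[uT vT].
have [uE|[uE|uE]] := in_triple TE uT; have [vE|[vE|vE]] := in_triple TE vT; subst u v;
  rewrite ?eqxx //; move: uv; rewrite ?ltnn //= => uv; exfalso; lia.
Qed.

Lemma flux_int_edge T a b c (f1 f2 : R * R -> R) : nondegenerate_triangle T -> T = [set a; b; c]%SET ->
  continuous f1 -> continuous f2 ->
  int_edge (a, b) (fun t => dot (f1 (epoint (a, b) t), f2 (epoint (a, b) t)) (outer_normal T (a, b))) =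
  Num.sg (cross (x b - x a) (x c - x a)) * flux f1 f2 (x a) (x b).
Proof.
move=> ndT TE c1 c2; have [_ H] := outer_normalP ndT TE.
rewrite /int_edge /flux -[in RHS]integral01Z -?integral01Z.
- by apply: eq_Rintegral => t _; rewrite mulrC H.
- move=> t; rewrite /dot /=; apply: cvgD; apply: cvgM; try exact: cvg_cst.
    exact: (@continuous_segment _ f1 (x a) (x b) c1).
  exact: (@continuous_segment _ f2 (x a) (x b) c2).
- by apply: continuous_cross; exact: continuous_segment.
Qed.

(** With the vertices in increasing order, the three segments of
    [divergence_tri] are the edges with the orientation of their parametrization. *)
Lemma divergence_hull T (f1 f2 : R * R -> R) : nondegenerate_triangle T -> C1 f1 -> C1 f2 ->
  intR2 (hull T) (fun y => partial false f1 y + partial true f2 y) =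
  \sum_(e | tri_edge T e) int_edge e (fun t => dot (f1 (epoint e t), f2 (epoint e t)) (outer_normal T e)).
Proof.
move=> ndT C1f1 C1f2; have [T3 _] := ndT.
have [a [b [c [TE [ab bc ac] /andP[ab' bc']]]]] := card3_sorted (fun v => v : nat) T3.
have {}ab' : (a < b)%N by rewrite ltn_neqAle ab' andbT; apply: contra_neq ab => /val_inj.
have {}bc' : (b < c)%N by rewrite ltn_neqAle bc' andbT; apply: contra_neq bc => /val_inj.
have [J _] := nondegenerate_triple ndT TE.
rewrite (sum_tri_edges _ TE ab' bc').
have TE2 : T = [set b; c; a]%SET by rewrite TE; apply/setP => v; rewrite !inE; case: (v == a); case: (v == b); case: (v == c).
have TE3 : T = [set a; c; b]%SET by rewrite TE; apply/setP => v; rewrite !inE orbAC.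
rewrite (flux_int_edge ndT TE C1f1.1 C1f2.1) (flux_int_edge ndT TE2 C1f1.1 C1f2.1).
rewrite (flux_int_edge ndT TE3 C1f1.1 C1f2.1).
have xE u : x a + (x u - x a) = x u by rewrite addrCA subrr addr0.
rewrite (hull_tri ndT TE) (divergence_tri (x a) J C1f1 C1f2) !xE.
rewrite (_ : cross (x c - x b) (x a - x b) = cross (x b - x a) (x c - x a)); last by rewrite /cross/=; ring.
by rewrite [cross (x c - x a) _]crossC sgrN mulNr -!mulrDr -mulrBr.
Qed.

(** The divergence theorem for the field [(w * f1, w * f2)]. *)
Lemma green_hull T (w f1 f2 : R * R -> R) : nondegenerate_triangle T -> C1 w -> C1 f1 -> C1 f2 ->
  intR2 (hull T) (fun y => dot (f1 y, f2 y) (grad w y)) =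
  \sum_(e | tri_edge T e) int_edge e (fun t => w (epoint e t) *
     dot (f1 (epoint e t), f2 (epoint e t)) (outer_normal T e)) -
  intR2 (hull T) (fun y => (partial false f1 y + partial true f2 y) * w y).
Proof.
move=> ndT C1w C1f1 C1f2; apply/eqP; rewrite -subr_eq opprK addrC; apply/eqP.
have mh := measurable_hull ndT.
have c1 : continuous (fun y => (partial false f1 y + partial true f2 y) * w y).
  move=> y; apply: cvgM; last exact: C1w.1.
  by apply: cvgD; [exact: (C1f1.2 false).1|exact: (C1f2.2 true).1].
have c2 : continuous (fun y => dot (f1 y, f2 y) (grad w y)).
  move=> y; rewrite /dot/=; apply: cvgD; apply: cvgM; [exact: C1f1.1|exact: (C1w.2 false).1
    |exact: C1f2.1|exact: (C1w.2 true).1].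
rewrite /intR2 -(RintegralD mh (integrable_hull ndT c1) (integrable_hull ndT c2)).
transitivity (intR2 (hull T) (fun y => partial false (f1 \* w) y + partial true (f2 \* w) y)).
  apply: eq_Rintegral => y _.
  by rewrite (partialM false y C1f1 C1w) (partialM true y C1f2 C1w) /dot /grad /=; ring.
rewrite (divergence_hull ndT (C1M C1f1 C1w) (C1M C1f2 C1w)).
apply: eq_bigr => e _; rewrite /int_edge; congr (_ * _); apply: eq_Rintegral => t _.
by rewrite /dot /=; ring.
Qed.

End GreenTriangle.

(** * Nodal bases *)

Section EdgeNodes.
Context {R : realType}.
Notation mu := (@lebesgue_measure R).

Lemma eq_integral01 (f g : R -> R) : f =1 g ->
  \int[mu]_(t in `[0, 1]) f t = \int[mu]_(t in `[0, 1]) g t.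
Proof. by move=> /funext ->. Qed.

Lemma integral01X (n : nat) : \int[mu]_(t in `[0, 1]) (t ^+ n) = n.+1%:R^-1.
Proof.
have cX k : continuous (fun t : R => t ^+ k) by exact: exprn_continuous.
have dX (t : R) : is_derive t 1 (fun t : R => n.+1%:R^-1 * t ^+ n.+1) (t ^+ n).
  have := is_deriveM (is_derive_cst (n.+1%:R^-1 : R) t 1) (is_deriveX n.+1 (is_derive_id t (1 : R))).
  rewrite (_ : _ * _ = fun t : R => n.+1%:R^-1 * t ^+ n.+1); last first.
    by apply/funext => s; rewrite fctE exprfctE.
  move=> H; apply: (is_derive_eq H); rewrite scaler0 addr0 /GRing.scale/= mulr1.
  by rewrite mulrA mulVf ?mul1r// pnatr_eq0.
rewrite /Rintegral (FTC_01 ler01 dX (cX n)) /=.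
by rewrite expr1n mulr1 expr0n/= mulr0 subr0.
Qed.

Lemma continuous_poly (p : {poly R}) : continuous (horner p).
Proof. exact: continuous_horner. Qed.

Lemma integral01_horner (p : {poly R}) n : (size p <= n)%N ->
  \int[mu]_(t in `[0, 1]) p.[t] = \sum_(i < n) p`_i / i.+1%:R.
Proof.
move=> pn; have pE t : p.[t] = \sum_(i < n) p`_i * t ^+ i by exact: horner_coef_wide.
rewrite (eq_integral01 pE).
have : exists c : nat -> R, forall i, p`_i = c i by exists (fun i => p`_i).
move=> [c pc]; under eq_integral01 do under eq_bigr do rewrite pc.
under [RHS]eq_bigr do rewrite pc.
move=> {pE pn pc}; elim: n => [|n IH].
  rewrite big_ord0 (@eq_integral01 _ (cst 0)) => [|t]; last by rewrite big_ord0.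
  by rewrite /Rintegral integral0.
have cS k : continuous (fun t : R => \sum_(i < k) c i * t ^+ i).
  have -> : (fun t : R => \sum_(i < k) c i * t ^+ i) = horner (\poly_(i < k) c i).
    by apply/funext => t; rewrite horner_poly.
  exact: continuous_poly.
have cM : continuous (fun t : R => c n * t ^+ n).
  by move=> t; apply: cvgM; [exact: cvg_cst|exact: exprn_continuous].
rewrite (@eq_integral01 _ (fun t => \sum_(i < n) c i * t ^+ i + c n * t ^+ n)) => [|t].
  rewrite (integral01D (cS n) cM) IH big_ord_recr/=; congr (_ + _).
  by rewrite integral01Z ?integral01X//; exact: exprn_continuous.
by rewrite big_ord_recr.
Qed.

Lemma nodeE_inj r : injective (@nodeE R r).
Proof.
move=> i j; rewrite /nodeE; case: eqP => [r0 _|/eqP r0].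
  by apply: val_inj => /=; have := ltn_ord i; have := ltn_ord j; lia.
move=> /(mulIf _) H; apply/val_inj/eqP; rewrite -(eqr_nat R); apply/eqP/H.
by rewrite invr_eq0 pnatr_eq0.
Qed.

Lemma poly_nodes_eq0 r (p : {poly R}) : (size p <= r.+1)%N ->
  (forall j : 'I_r.+1, p.[nodeE j] = 0) -> p = 0.
Proof.
move=> ps p0; apply/eqP; apply: contraT => pn0.
have := max_poly_roots (rs := [seq nodeE j | j <- enum 'I_r.+1]) pn0.
rewrite size_map size_enum_ord [(r.+1 < _)%N]ltnNge ps /= => -> //.
  by apply/allP => t /mapP[j _ ->]; rewrite rootE p0.
rewrite map_inj_uniq ?enum_uniq//; exact: nodeE_inj.
Qed.

Lemma phiEP r (j : 'I_r.+1) : (size (@phiE R r j) <= r.+1)%N /\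
  forall j' : 'I_r.+1, (phiE j).[nodeE j'] = (j == j')%:R :> R.
Proof.
pose q : {poly R} := (\prod_(l < r.+1 | l != j) (nodeE j - nodeE l))^-1 *:
  \prod_(l < r.+1 | l != j) ('X - (nodeE l)%:P).
apply: (@xgetPex _ 0 [set q : {poly R} | (size q <= r.+1)%N /\
    forall j' : 'I_r.+1, q.[nodeE j'] = (j == j')%:R]); exists q; split.
  rewrite (leq_trans (size_scale_leq _ _))// -big_filter size_prod_XsubC.
  by rewrite size_filter -sum1_count sum1_card cardC1 card_ord.
move=> j'; rewrite hornerZ horner_prod; case: eqP => [<-|/eqP jj'].
  under [X in _ * X]eq_bigr do rewrite hornerXsubC.
  rewrite mulVf//; apply/prodf_neq0 => l lj; rewrite subr_eq0; apply: contra_neq lj => e.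
  exact/esym/nodeE_inj.
rewrite [X in _ * X](bigD1 j')/=; last by rewrite eq_sym.
by rewrite hornerXsubC subrr mul0r mulr0.
Qed.

(** Both sides have degree at most [r] and agree at the [r.+1] nodes. *)
Lemma phiE_reproduce r (q : {poly R}) : (size q <= r.+1)%N ->
  q = \sum_(j < r.+1) q.[nodeE j] *: phiE j.
Proof.
move=> qr; apply/eqP; rewrite -subr_eq0; apply/eqP; apply: (@poly_nodes_eq0 r).
  rewrite (leq_trans (size_polyD _ _))// geq_max qr size_polyN.
  apply: (leq_trans (size_sum _ _ _)); apply/bigmax_leqP => j _.
  by rewrite (leq_trans (size_scale_leq _ _))//; have [] := phiEP j.
move=> j; rewrite hornerD hornerN horner_sum (bigD1 j)//= hornerZ (phiEP j).2 eqxx mulr1.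
rewrite big1 ?addr0 ?subrr// => l lj.
by rewrite hornerZ (phiEP l).2 (negbTE lj) mulr0.
Qed.

Lemma phiE_interp r (q : {poly R}) t : (size q <= r.+1)%N ->
  q.[t] = \sum_(j < r.+1) q.[nodeE j] * (phiE j).[t].
Proof.
by move=> qr; rewrite {1}(phiE_reproduce qr) horner_sum; apply: eq_bigr => j _; rewrite hornerZ.
Qed.

(** A quadrature rule at the nodes that integrates the monomials exactly has
    the integrals of the nodal basis as its weights; for [r <= 4] these
    are the positive weights of the midpoint rule and of the closed
    Newton-Cotes rules. *)
Lemma integral_phiE_ge0 r (j : 'I_r.+1) : (r <= 4)%N -> 0 <= \int[mu]_(t in `[0, 1]) (phiE j).[t].
Proof.
move=> r4.
suff [w w0 Hw] : exists2 w : 'I_r.+1 -> R, (forall l, 0 <= w l) &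
    forall i, (i < r.+1)%N -> \sum_l w l * nodeE l ^+ i = i.+1%:R^-1.
  rewrite (integral01_horner (n := r.+1)) ?(phiEP j).1//.
  rewrite (eq_bigr (fun i : 'I_r.+1 => \sum_l w l * ((phiE j)`_i * nodeE l ^+ i))); last first.
    move=> i _; rewrite -(Hw i (ltn_ord i)) mulr_sumr; apply: eq_bigr => l _.
    by rewrite mulrCA.
  rewrite exchange_big/= sumr_ge0// => l _; rewrite -mulr_sumr mulr_ge0//.
  rewrite -(horner_coef_wide _ (phiEP j).1) (phiEP j).2; exact: ler0n.
case: r r4 j => [|[|[|[|[|//]]]]] _ j.
- exists (fun l => [:: 1]`_l); first by move=> [[|//] ?] /=; lra.
  by move=> [|//] _; rewrite !big_ord_recr big_ord0 /= /nodeE /=; field.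
- exists (fun l => [:: 2^-1; 2^-1]`_l); first by move=> [[|[|//]] ?] /=; lra.
  by move=> [|[|//]] _; rewrite !big_ord_recr big_ord0 /= /nodeE /=; field.
- exists (fun l => [:: 6^-1; 4 / 6; 6^-1]`_l); first by move=> [[|[|[|//]]] ?] /=; lra.
  by move=> [|[|[|//]]] _; rewrite !big_ord_recr big_ord0 /= /nodeE /=; field.
- exists (fun l => [:: 8^-1; 3 / 8; 3 / 8; 8^-1]`_l); first by move=> [[|[|[|[|//]]]] ?] /=; lra.
  by move=> [|[|[|[|//]]]] _; rewrite !big_ord_recr big_ord0 /= /nodeE /=; field.
- exists (fun l => [:: 7 / 90; 32 / 90; 12 / 90; 32 / 90; 7 / 90]`_l).
    by move=> [[|[|[|[|[|//]]]]] ?] /=; lra.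
  by move=> [|[|[|[|[|//]]]]] _; rewrite !big_ord_recr big_ord0 /= /nodeE /=; field.
Qed.

End EdgeNodes.

Section TriangleNodes.
Context {R : realType}.
Notation mu := (@lebesgue_measure R).
Notation MP := (measurableTypeR R * measurableTypeR R)%type.

(** In the expansion in powers of [y.2 - c], the terms without this factor form
    the restriction to the line. *)
Lemma poly_deglt_factor k (f : R * R -> R) (c : R) : poly_deglt k.+1 f -> (forall s, f (s, c) = 0) ->
  exists2 g, poly_deglt k g & forall y, f y = (y.2 - c) * g y.
Proof.
move=> fk f0; pose h := f \o aff (0, c) (1, 0) (0, 1).
have fh y : f y = h (y.1, y.2 - c).
  rewrite /h /=; congr f; rewrite /aff /= [LHS]surjective_pairing; congr pair => /=; rewrite /GRing.scale/=; ring.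
have [d hE] : poly_deglt k.+1 h := poly_deglt_aff (0, c) (1, 0) (0, 1) fk.
have d0 i : (i < k.+1)%N -> d i 0%N = 0.
  apply: (poly_coef_eq0 (c := fun i => d i 0%N)) => s.
  rewrite -[RHS](f0 s) fh /= subrr -/h hE /=; apply: eq_bigr => i' _.
  have ik := ltn_ord i'; rewrite (subSn (n := k)) 1?ltnS -1?ltnS// big_ord_recl/= expr0 mulr1.
  by rewrite big1 ?addr0// => j _; rewrite expr0n/= mulr0.
exists (fun y => \sum_(i < k) \sum_(j < k - i) d i j.+1 * y.1 ^+ i * (y.2 - c) ^+ j).
  pose g y := \sum_(i < k) \sum_(j < k - i) d i j.+1 * y.1 ^+ i * y.2 ^+ j.
  have gk : poly_deglt k g by exists (fun i j => d i j.+1).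
  have := poly_deglt_aff (0, - c) (1, 0) (0, 1) gk; rewrite (_ : _ \o _ = fun y => g (y.1, y.2 - c))//.
  apply/funext => y /=; congr g.
  by rewrite /aff /= [LHS]surjective_pairing; congr pair => /=; rewrite /GRing.scale/=; ring.
move=> y; rewrite fh -/h hE big_ord_recr/= subSn// subnn big_ord_recl big_ord0 /= d0// !mul0r !addr0.
rewrite mulr_sumr; apply: eq_bigr => i _.
rewrite subSn 1?ltnW// big_ord_recl/= d0 ?mul0r ?add0r; last by rewrite ltnS ltnW.
rewrite mulr_sumr; apply: eq_bigr => j _ /=; rewrite /bump /= add1n exprS.
by rewrite mulrCA !mulrA.
Qed.

(** The longest row of the lattice has more nodes than the degree allows roots,
    so the equation of its line can be divided out, which leaves a lattice with
    one row less. *)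
Lemma poly_lattice_eq0 k (h : R) (q0 : nat) (f : R * R -> R) : h != 0 -> poly_deglt k f ->
  (forall p q, (p + q < k)%N -> f (p%:R * h, (q0 + q)%:R * h) = 0) -> forall y, f y = 0.
Proof.
move=> h0; elim: k q0 f => [|k IH] q0 f fk f0 y.
  by have [d ->] := fk; rewrite big_ord0.
have line s : f (s, q0%:R * h) = 0.
  have [p ps pE] := poly_deglt_line (0, q0%:R * h) (1, 0) fk.
  have pE' t : p.[t] = f (t, q0%:R * h).
    by rewrite -pE; congr f; congr pair; rewrite /= /GRing.scale/=; ring.
  rewrite -pE'; suff -> : p = 0 by rewrite horner0.
  apply/eqP; apply: contraT => pn0.
  have := max_poly_roots (rs := [seq n%:R * h | n <- iota 0 k.+1]) pn0.
  rewrite size_map size_iota [(k.+1 < _)%N]ltnNge ps -[~~ true]/false => -> //.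
    apply/allP => t /mapP[n]; rewrite mem_iota /= add0n => nk ->.
    by rewrite rootE pE' -[q0]addn0 f0// addn0.
  rewrite map_inj_uniq ?iota_uniq//; move=> a b /= /(mulIf h0) /eqP; rewrite eqr_nat; exact/eqP.
have [g gk gE] := poly_deglt_factor fk line.
suff g0 : forall y, g y = 0 by rewrite gE g0 mulr0.
apply: (IH q0.+1) => // p q pq; have := f0 p q.+1; rewrite addnS => /(_ pq) /eqP.
rewrite gE /= (_ : (q0 + q.+1)%:R * h - q0%:R * h = q.+1%:R * h); last first.
  by rewrite natrD mulrDl addrAC subrr add0r.
by rewrite !mulf_eq0 pnatr_eq0 (negbTE h0) /= addSnnS => /eqP.
Qed.

Lemma poly_deglt_prod (I : Type) (s : seq I) (P : pred I) (d : I -> nat) (F : I -> R * R -> R) :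
  (forall i, P i -> poly_deglt (d i).+1 (F i)) ->
  poly_deglt (\sum_(i <- s | P i) d i).+1 (fun y => \prod_(i <- s | P i) F i y).
Proof.
move=> H; elim: s => [|i s IH].
  rewrite big_nil (_ : (fun y => _) = fun=> 1); first exact: poly_deglt_cst.
  by apply/funext => y; rewrite big_nil.
rewrite big_cons; have [Pi|Pi] := boolP (P i).
  rewrite (_ : (fun y => _) = fun y => F i y * \prod_(i <- s | P i) F i y).
    exact: poly_degltM (H _ Pi) IH.
  by apply/funext => y; rewrite big_cons Pi.
rewrite (_ : (fun y => _) = fun y => \prod_(i <- s | P i) F i y)//.
by apply/funext => y; rewrite big_cons (negbTE Pi).
Qed.

Context (m : mesh R).
Local Notation V := 'I_(nvtx m).
Local Notation x := (@vtx R m).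
Implicit Types (T S : {set V}) (e : V * V) (u v w : V) (y z n : R * R).

Lemma poly_deglt_bary T v : nondegenerate_triangle T -> poly_deglt 2 (bary T v).
Proof. by move=> /(bary_affine v)[c [p [q ->]]]; exact: poly_deglt_affine. Qed.

Lemma latticeP k T (i : {ffun V -> 'I_k}) : i \in lattice k T <->
  (forall v, v \notin T -> i v = 0 :> nat) /\ (\sum_v (i v : nat)).+1 = k.
Proof.
rewrite inE; split=> [/andP[/forallP h /eqP s]|[h s]].
  by split=> // v vT; have := h v; rewrite vT => /eqP.
apply/andP; split; last exact/eqP.
by apply/forallP => v; apply/implyP => /h ->.
Qed.

Lemma bary_nodeT k T (i : {ffun V -> 'I_k}) v : nondegenerate_triangle T -> i \in lattice k T ->
  k.-1%:R * bary T v (nodeT T i) = (i v)%:R.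
Proof.
move=> ndT /latticeP[ioff isum]; rewrite /nodeT; case: eqP => [k1|/eqP k1].
  have km : k.-1 = 0%N by rewrite k1.
  have -> : i v = 0%N :> nat by have : (i v < k)%N by []; lia.
  by rewrite km mul0r.
have k0 : k.-1%:R != 0 :> R by rewrite pnatr_eq0; move: k1 isum => /eqP; lia.
pose l u : R := (i u)%:R / k.-1%:R.
have l0 u : u \notin T -> l u = 0 by move=> /ioff; rewrite /l => ->; rewrite mul0r.
have l1 : \sum_u l u = 1.
  rewrite /l -mulr_suml -natr_sum; have -> : (\sum_u (i u : nat))%N = k.-1 by rewrite -[in RHS]isum.
  by rewrite mulfV.
have lx : \sum_u l u *: x u = \sum_(u in T) ((i u)%:R / k.-1%:R) *: x u.
  rewrite [RHS]big_mkcond/=; apply: eq_bigr => u _; case: ifPn => // /l0 ->.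
  by rewrite scale0r.
rewrite (bary_eq ndT l0 l1 lx) /l mulrCA mulfV ?mulr1//.
Qed.

(** The lattice polynomial of the node [i]: for each vertex, a product of the
    equations of the lattice lines separating the node from the opposite
    side, normalized at the node. *)
Definition lattice_poly k T (i : {ffun V -> 'I_k}) : R * R -> R := fun y =>
  \prod_v \prod_(l < i v) ((k.-1%:R * bary T v y - l%:R) / ((i v)%:R - l%:R)).

Lemma poly_deglt_lattice_poly k T (i : {ffun V -> 'I_k}) : nondegenerate_triangle T ->
  i \in lattice k T -> poly_deglt k (lattice_poly T i).
Proof.
move=> ndT /latticeP[_ isum]; rewrite -[X in poly_deglt X]isum.
apply: poly_deglt_prod => v _.
have E : i v = (\sum_(l < i v) 1)%N :> nat by rewrite sum1_card card_ord.
rewrite [X in poly_deglt X.+1]E; apply: poly_deglt_prod => l _.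
rewrite (_ : (fun y => _) = fun y => ((i v)%:R - l%:R)^-1 * (k.-1%:R * bary T v y + (- l%:R))); last first.
  by apply/funext => y; rewrite mulrC.
apply: poly_degltZ; apply: poly_degltD; first by apply: poly_degltZ; exact: poly_deglt_bary.
exact: (@poly_deglt_widen _ 1 2 _ _ (poly_deglt_cst _)).
Qed.

Lemma lattice_poly_node k T (i i' : {ffun V -> 'I_k}) : nondegenerate_triangle T ->
  i \in lattice k T -> i' \in lattice k T -> lattice_poly T i (nodeT T i') = (i == i')%:R.
Proof.
move=> ndT iL iL'; rewrite /lattice_poly; case: eqP => [<-|ii'].
  rewrite big1// => v _; rewrite big1// => l _; rewrite bary_nodeT// mulfV// subr_eq0 eqr_nat.
  by rewrite gtn_eqF.
(* equal sums: some index decreases *)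
have [v vi] : exists v, (i' v < i v)%N.
  apply/existsP; apply: contraT; rewrite negb_exists => /forallP le; exfalso; apply: ii'.
  have {}le v : (i v <= i' v)%N by rewrite leqNgt le.
  move/latticeP: iL => [_ s]; move/latticeP: iL' => [_ s'].
  have : (\sum_v (i v : nat) == \sum_v (i' v : nat))%N by apply/eqP; lia.
  have := leqif_sum (fun v (_ : true) => leqif_eq (le v)) => /leqifP.
  case: ifPn => [/forallP h _ _|_ /ltn_eqF -> //].
  by apply/ffunP => v; apply/val_inj/eqP; have := h v.
rewrite (bigD1 v)//= (bigD1 (Ordinal vi))//= bary_nodeT// subrr mul0r.
by rewrite !mul0r.
Qed.

Lemma lattice_eq0 k T (f : R * R -> R) : nondegenerate_triangle T -> poly_deglt k f ->
  (forall i, i \in lattice k T -> f (nodeT T i) = 0) -> forall y, f y = 0.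
Proof.
move=> ndT fk f0 y; have [a [b [c TE]]] := triangle_vertices ndT.
have [J [ab bc ac]] := nondegenerate_triple ndT TE.
have [k0|k0] := posnP k; first by move: fk; rewrite k0 => -[d ->]; rewrite big_ord0.
have lat p q : (p + q < k)%N -> exists2 i : {ffun V -> 'I_k}, i \in lattice k T &
    [/\ i a = (k.-1 - p - q)%N :> nat, i b = p :> nat & i c = q :> nat].
  move=> pq; pose w (v : V) : nat := if v == a then (k.-1 - p - q)%N else if v == b then p else
     if v == c then q else 0%N.
  have wk v : (w v < k)%N by rewrite /w; case: ifP => _; [lia|case: ifP => _; [lia|case: ifP => _; lia]].
  have [wa wb wc] : [/\ w a = (k.-1 - p - q)%N, w b = p & w c = q].
    by rewrite /w !eqxx [b == a]eq_sym (negbTE ab) [c == a]eq_sym (negbTE ac) [c == b]eq_sym (negbTE bc).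
  exists [ffun v => Ordinal (wk v)]; last by rewrite !ffunE /=.
  have woff v : v \notin [set a; b; c]%SET -> w v = 0%N.
    by rewrite !inE !negb_or /w => /andP[/andP[/negbTE -> /negbTE ->] /negbTE ->].
  apply/latticeP; split=> [v|]; first by rewrite ffunE /= TE; exact: woff.
  under eq_bigr do rewrite ffunE /=.
  by rewrite (sum_triangle ab bc ac woff) wa wb wc; lia.
have aTE : c \in T by rewrite TE !inE eqxx !orbT.
have [k1|k1] := eqVneq k 1%N.
  have [i iL _] := lat 0%N 0%N k0; have := f0 i iL.
  have [d fE] : poly_deglt 1 f by rewrite -k1.
  by rewrite !fE !big_ord_recr !big_ord0 /= !expr0.
have k10 : k.-1%:R != 0 :> R by rewrite pnatr_eq0; lia.
pose g := f \o aff (x a) (x b - x a) (x c - x a).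
have gk : poly_deglt k g by exact: poly_deglt_aff.
suff g0 : forall z, g z = 0.
  have := g0 (bcoord (x a) (x b - x a) (x c - x a) y, bcoord (x a) (x c - x a) (x b - x a) y).
  by rewrite /g /= aff_bcoord.
apply: (@poly_lattice_eq0 k k.-1%:R^-1 0%N) => //; first by rewrite invr_eq0.
move=> p q /lat[i iL [ia ib ic]]; rewrite add0n -[RHS](f0 i iL) /g /=; congr f.
have off v : v \notin [set a; b; c]%SET -> bary T v (nodeT T i) = 0 by rewrite -TE => /bary_off ->.
have := bary_point (nodeT T i) ndT; rewrite (sum_triangle ab bc ac) => [|v /off ->]; last by rewrite scale0r.
have := bary_sum (nodeT T i) ndT; rewrite (sum_triangle ab bc ac off).
have Bb := bary_nodeT b ndT iL; have Bc := bary_nodeT c ndT iL; rewrite ib in Bb; rewrite ic in Bc.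
rewrite -Bb -Bc ![_ * _ / _]mulrAC !mulfV// !mul1r.
move: (bary T a _) (bary T b _) (bary T c _) => la lb lc s <-; rewrite /aff /=.
have -> : la = 1 - lb - lc by rewrite -s; ring.
move: (x a) (x b) (x c) => [a1 a2] [b1 b2] [c1 c2].
by congr pair; rewrite /= /GRing.scale/=; ring.
Qed.

(** The lattice polynomials satisfy the conditions that define the nodal basis,
    and [lattice_eq0] makes the solution unique. *)
Lemma phiTE k T (i : {ffun V -> 'I_k}) : nondegenerate_triangle T -> i \in lattice k T ->
  phiT T i =1 lattice_poly T i.
Proof.
move=> ndT iL; have [pk pn] : [set f | poly_deglt k f /\
    forall i', i' \in lattice k T -> f (nodeT T i') = (i == i')%:R] (phiT T i).
  apply: xgetPex; exists (lattice_poly T i); split; first exact: poly_deglt_lattice_poly.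
  by move=> i' iL'; exact: lattice_poly_node.
move=> y; apply/eqP; rewrite -subr_eq0 -mulN1r; apply/eqP; move: y.
apply: (lattice_eq0 ndT) => [|i' iL'].
  by apply: (poly_degltD pk); apply: poly_degltZ; exact: poly_deglt_lattice_poly.
by rewrite pn// lattice_poly_node// mulN1r subrr.
Qed.

Lemma poly_deglt_phiT k T (i : {ffun V -> 'I_k}) : nondegenerate_triangle T -> i \in lattice k T ->
  poly_deglt k (phiT T i).
Proof.
by move=> ndT iL; rewrite (_ : phiT T i = lattice_poly T i);
  [exact: poly_deglt_lattice_poly|apply/funext; exact: phiTE].
Qed.

Lemma phiT_interp k T (f : R * R -> R) y : nondegenerate_triangle T -> poly_deglt k f ->
  f y = \sum_(i in lattice k T) f (nodeT T i) * phiT T i y.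
Proof.
move=> ndT fk; apply/eqP; rewrite -subr_eq0 -mulN1r; apply/eqP; move: y.
apply: (lattice_eq0 ndT) => [|i iL].
  apply: (poly_degltD fk); apply: poly_degltZ; apply: poly_deglt_sum => i iL.
  by apply: poly_degltZ; exact: poly_deglt_phiT.
rewrite (bigD1 i)//= phiTE// lattice_poly_node// eqxx mulr1 big1 ?addr0 ?mulN1r ?subrr//.
by move=> j /andP[jL ji]; rewrite phiTE// lattice_poly_node// (negbTE ji) mulr0.
Qed.

(** * Nonnegativity of the weights *)

Lemma integral_hull_tri0 T a b c (g : R * R -> R) : nondegenerate_triangle T -> T = [set a; b; c]%SET ->
  continuous g -> intR2 (hull T) (fun y => g (bary T b y, bary T c y)) =
    `|cross (x b - x a) (x c - x a)| * intR2 tri0 g.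
Proof.
move=> ndT TE cg; have [J [ab bc ac]] := nondegenerate_triple ndT TE.
have cB : continuous (fun y => g (bary T b y, bary T c y)).
  move=> y; apply: (@continuous_comp _ _ _ (fun y => (bary T b y, bary T c y)) g) => /=; last exact: cg.
  by apply: (@cvg_pair _ _ _ (nbhs y) (nbhs (bary T b y)) (nbhs (bary T c y))); exact: continuous_bary.
rewrite (hull_tri ndT TE) (intR2_aff (x a) J (measurable_tri _ _ _) (continuous_measurable2 cB)).
rewrite preimage_tri//; congr (_ * intR2 _ _); apply/funext => -[s t].
pose l v : R := if v == a then 1 - s - t else if v == b then s else if v == c then t else 0.
have [la lb lc] : [/\ l a = 1 - s - t, l b = s & l c = t].
  by rewrite /l !eqxx [b == a]eq_sym (negbTE ab) [c == a]eq_sym (negbTE ac) [c == b]eq_sym (negbTE bc).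
have off v : v \notin [set a; b; c]%SET -> l v = 0.
  by rewrite !inE !negb_or /l => /andP[/andP[/negbTE -> /negbTE ->] /negbTE ->].
have E := @bary_eq _ _ T (aff (x a) (x b - x a) (x c - x a) (s, t)) l ndT.
rewrite !E ?lb ?lc//.
- by rewrite TE.
- by rewrite (sum_triangle ab bc ac off) la lb lc; ring.
- rewrite (sum_triangle ab bc ac) => [|v /off ->]; last by rewrite scale0r.
  rewrite la lb lc /aff /=; move: (x a) (x b) (x c) => [a1 a2] [b1 b2] [c1 c2].
  by congr pair; rewrite /= /GRing.scale/=; ring.
- by rewrite TE.
- by rewrite (sum_triangle ab bc ac off) la lb lc; ring.
- rewrite (sum_triangle ab bc ac) => [|v /off ->]; last by rewrite scale0r.
  rewrite la lb lc /aff /=; move: (x a) (x b) (x c) => [a1 a2] [b1 b2] [c1 c2].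
  by congr pair; rewrite /= /GRing.scale/=; ring.
Qed.

Lemma integral_tri0_mono (i j : nat) :
  intR2 tri0 (mono i j) = i.+1%:R^-1 * \int[mu]_(t in `[0, 1]) ((1 - t) ^+ i.+1 * t ^+ j).
Proof.
have E : partial false (cst i.+1%:R^-1 \* mono i.+1 j) = mono i j :> (R * R -> R).
  apply/funext => y; rewrite (partialM false y (C1_cst _) (C1_mono i.+1 j)) partial_cst mulr0 addr0.
  by rewrite partial_mono /= mulrA mulVf ?mul1r// pnatr_eq0.
rewrite -E integral_tri0_fst; last exact: C1M (C1_cst i.+1%:R^-1) (C1_mono i.+1 j).
rewrite -integral01Z; last first.
  rewrite (_ : (fun t => _) = horner ((1 - 'X) ^+ i.+1 * 'X^j)); first exact: continuous_poly.
  by apply/funext => t; rewrite !hornerE.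
by apply: eq_integral01 => t; rewrite /mono /= expr0n /= mul0r mulr0 subr0.
Qed.

Lemma integral_tri0_mono0 j : intR2 tri0 (@mono R 0 j) = j.+1%:R^-1 - j.+2%:R^-1.
Proof.
rewrite integral_tri0_mono invr1 mul1r -!integral01X -integral01B; try exact: exprn_continuous.
by apply: eq_integral01 => t; rewrite expr1 mulrBl mul1r -exprS.
Qed.

Lemma integral_tri0_mono1 j : intR2 tri0 (@mono R 1 j) =
  2^-1 * (j.+1%:R^-1 - j.+2%:R^-1 - (j.+2%:R^-1 - j.+3%:R^-1)).
Proof.
have cX k : continuous (fun t : R => t ^+ k) by exact: exprn_continuous.
have cB k : continuous (fun t : R => t ^+ k - t ^+ k.+1).
  by move=> t; apply: cvgB; exact: cX.
rewrite integral_tri0_mono -!integral01X -!integral01B//.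
by congr (_ * _); apply: eq_integral01 => t; rewrite !exprS expr0; ring.
Qed.

Lemma integral_tri0_lin (c1 c2 c3 : R) (f1 f2 f3 : R * R -> R) :
  continuous f1 -> continuous f2 -> continuous f3 ->
  intR2 tri0 (fun y => c1 * f1 y + c2 * f2 y + c3 * f3 y) =
  c1 * intR2 tri0 f1 + c2 * intR2 tri0 f2 + c3 * intR2 tri0 f3.
Proof.
move=> k1 k2 k3.
have I (f : R * R -> R) : continuous f -> leb2.-integrable (tri0 : set MP) (EFin \o f).
  by move=> cf; exact: (continuous_integrable2 cf tri0_box measurable_tri0).
have Z (c : R) (f : R * R -> R) : continuous f -> continuous (fun y => c * f y).
  by move=> cf y; apply: cvgM; [exact: cvg_cst|exact: cf].
have D (f g : R * R -> R) : continuous f -> continuous g -> continuous (fun y => f y + g y).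
  by move=> cf cg y; apply: cvgD; [exact: cf|exact: cg].
rewrite /intR2 (RintegralD measurable_tri0 (I _ (D _ _ (Z c1 _ k1) (Z c2 _ k2))) (I _ (Z c3 _ k3))).
rewrite (RintegralD measurable_tri0 (I _ (Z c1 _ k1)) (I _ (Z c2 _ k2))).
by rewrite !RintegralZl//; (exact: measurable_tri0 || exact: I).
Qed.

(** A factor of the lattice polynomial is nonnegative for indices at most 1;
    for [k <= 4] only the shapes (0,0,2), (0,0,3) and (0,1,2) remain, whose
    integrals over the reference triangle are 0, 1/60 and 9/240. *)
Lemma weightT_ge0 k T (i : {ffun V -> 'I_k}) : nondegenerate_triangle T -> (k <= 4)%N ->
  i \in lattice k T -> 0 <= weightT T i.
Proof.
move=> ndT k4 iL; have /latticeP[ioff isum] := iL.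
have [a [b [c [TE [ab bc ac] /andP[iab ibc]]]]] := card3_sorted (fun v => i v : nat) ndT.1.
have ioff' v : v \notin [set a; b; c]%SET -> i v = 0%N :> nat by rewrite -TE; exact: ioff.
have s3 : (i a + i b + i c).+1 = k.
  by rewrite -[RHS]isum (sum_triangle ab bc ac ioff').
pose P (n : nat) (t : R) : R := \prod_(l < n) ((k.-1%:R * t - l%:R) / (n%:R - l%:R)).
have prodE y : phiT T i y = P (i a) (bary T a y) * P (i b) (bary T b y) * P (i c) (bary T c y).
  rewrite phiTE// /lattice_poly (bigD1 a)//= (bigD1 b)/=; last by rewrite eq_sym.
  rewrite (bigD1 c)/=; last by rewrite ![c == _]eq_sym ac bc.
  rewrite [X in _ * (_ * (_ * X))]big1 ?mulr1 ?mulrA// => v /andP[/andP[va vb] vc].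
  rewrite (_ : i v = 0%N :> nat) ?big_ord0//.
  by apply: ioff'; rewrite !inE (negbTE va) (negbTE vb) (negbTE vc).
have P01 (n : nat) t : (n <= 1)%N -> 0 <= t -> 0 <= P n t.
  case: n => [|[|//]] _ t0; first by rewrite /P big_ord0.
  by rewrite /P big_ord_recr big_ord0 /= mul1r !subr0 divr1 mulr_ge0.
rewrite /weightT (_ : phiT T i = fun y => P (i a) (bary T a y) * P (i b) (bary T b y) * P (i c) (bary T c y)); last first.
  exact/funext.
have [c1|c2] := leqP (i c) 1.
  apply: Rintegral_ge0 => y /(hull_triP y ndT) h.
  by rewrite !mulr_ge0// P01//; lia.
have P0 t : P 0%N t = 1 by rewrite /P big_ord0.
have P1 t : P 1%N t = k.-1%:R * t by rewrite /P big_ord_recr big_ord0 /= mul1r !subr0 divr1.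
have P2 t : P 2 t = k.-1%:R * t * (k.-1%:R * t - 1) / 2.
  by rewrite /P !big_ord_recr big_ord0 /= mul1r !subr0; field.
have P3 t : P 3 t = k.-1%:R * t * (k.-1%:R * t - 1) * (k.-1%:R * t - 2) / 6.
  by rewrite /P !big_ord_recr big_ord0 /= mul1r !subr0; field.
have a0 : i a = 0%N :> nat by lia.
have red (n1 n2 : nat) (g : R * R -> R) : i b = n1 :> nat -> i c = n2 :> nat -> continuous g ->
    (forall s t, P n1 s * P n2 t = g (s, t)) -> 0 <= intR2 tri0 g ->
    0 <= intR2 (hull T) (fun y => P (i a) (bary T a y) * P (i b) (bary T b y) * P (i c) (bary T c y)).
  move=> -> -> cg gE g0; rewrite a0 (_ : (fun y => _) = fun y => g (bary T b y, bary T c y)).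
    by rewrite (integral_hull_tri0 ndT TE cg) mulr_ge0.
  by apply/funext => y; rewrite P0 mul1r gE.
have cm p q : continuous (@mono R p q) by exact: continuous_mono.
have cl (c1 c3 : R) p1 q1 p2 q2 p3 q3 c2' : continuous (fun y => c1 * @mono R p1 q1 y + c2' * mono p2 q2 y + c3 * mono p3 q3 y).
  by move=> y; do 2?apply: cvgD; (apply: cvgM; [exact: cvg_cst|exact: cm]).
have : (i b = 0 :> nat /\ i c = 2 :> nat /\ k = 3) \/ (i b = 0 :> nat /\ i c = 3 :> nat /\ k = 4) \/
  (i b = 1 :> nat /\ i c = 2 :> nat /\ k = 4) by lia.
move=> [[b0 [c2' k3]]|[[b0 [c3 kE]]|[b1 [c2' kE]]]].
- apply: (red _ _ _ b0 c2' (cl 2 0 0%N 2%N 0%N 1%N 0%N 0%N (-1))).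
    by move=> s t; rewrite P0 P2 k3 /mono /= !expr0 !expr1 expr2; field.
  by rewrite integral_tri0_lin// !integral_tri0_mono0; lra.
- apply: (red _ _ _ b0 c3 (cl (9/2) 1 0%N 3%N 0%N 2%N 0%N 1%N (-(9/2)))).
    by move=> s t; rewrite P0 P3 kE /mono /= !expr0 !expr1 !exprS expr0; field.
  by rewrite integral_tri0_lin// !integral_tri0_mono0; lra.
- apply: (red _ _ _ b1 c2' (cl (27/2) 0 1%N 2%N 1%N 1%N 0%N 0%N (-(9/2)))).
    by move=> s t; rewrite P1 P2 kE /mono /= !expr0 !expr1 expr2; field.
  by rewrite integral_tri0_lin// !integral_tri0_mono1 integral_tri0_mono0; lra.
Qed.

End TriangleNodes.

(** * Unisolvence of the Raviart-Thomas degrees of freedom on one triangle *)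

(** A square matrix with trivial kernel is invertible. *)
Lemma injective_square_solvable (F : fieldType) (I : finType) (A : I -> I -> F) :
  (forall c : I -> F, (forall k, \sum_n c n * A n k = 0) -> forall n, c n = 0) ->
  forall b : I -> F, exists c : I -> F, forall k, \sum_n c n * A n k = b k.
Proof.
move=> inj b; pose M : 'M[F]_#|I| := \matrix_(i, j) A (enum_val i) (enum_val j).
have rowE (c : I -> F) k : ((\row_i c (enum_val i)) *m M) ord0 k = \sum_n c n * A n (enum_val k).
  rewrite mxE (reindex (@enum_val I I)) /=; first by apply: eq_bigr => i _; rewrite !mxE.
  by exists enum_rank => ? _; [exact: enum_valK|exact: enum_rankK].
have fM : row_free M.
  rewrite -kermx_eq0; apply/eqP/row_matrixP => i; rewrite row0.
  have k0 : row i (kermx M) *m M = 0 by rewrite -row_mul mulmx_ker row0.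
  pose c n := row i (kermx M) ord0 (enum_rank n).
  have cE : row i (kermx M) = \row_i c (enum_val i).
    by apply/rowP => j; rewrite [RHS]mxE /c enum_valK.
  apply/rowP => j; rewrite cE !mxE; apply: inj => k.
  by rewrite -[k]enum_rankK -rowE -cE k0 mxE.
pose s := (\row_i b (enum_val i)) *m invmx M.
exists (fun n => s ord0 (enum_rank n)) => k; rewrite -[k in LHS]enum_rankK -rowE.
have -> : (\row_i s ord0 (enum_rank (enum_val i))) = s.
  by apply/rowP => j; rewrite mxE enum_valK.
by rewrite /s mulmxKV -?row_free_unit// mxE enum_rankK.
Qed.

Section Moments.
Context {R : realType}.
Notation mu := (@lebesgue_measure R).

Lemma integral01_sum (I : finType) (c : I -> R) (f : I -> R -> R) : (forall i, continuous (f i)) ->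
  \int[mu]_(t in `[0, 1]) (\sum_i c i * f i t) = \sum_i c i * \int[mu]_(t in `[0, 1]) f i t.
Proof.
move=> cf; elim: (index_enum I) => [|i s IH].
  rewrite big_nil (@eq_integral01 _ _ (cst 0)) => [|t]; last by rewrite big_nil.
  by rewrite /Rintegral integral0.
have cs (s' : seq I) : continuous (fun t => \sum_(i <- s') c i * f i t).
  elim: s' => [|j s' IHs] t.
    by rewrite (_ : (fun t => _) = cst 0); [exact: cvg_cst|apply/funext => ?; rewrite big_nil].
  rewrite (_ : (fun t => _) = fun t => c j * f j t + \sum_(i <- s') c i * f i t).
    by apply: cvgD; [apply: cvgM; [exact: cvg_cst|exact: cf]|exact: IHs].
  by apply/funext => ?; rewrite big_cons.
have ci : continuous (fun t => c i * f i t) by move=> t; apply: cvgM; [exact: cvg_cst|exact: cf].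
rewrite (@eq_integral01 _ _ (fun t => c i * f i t + \sum_(j <- s) c j * f j t)) => [|t]; last by rewrite big_cons.
by rewrite (integral01D ci (cs s)) IH big_cons integral01Z.
Qed.

Lemma continuous_integral01_eq0 (f : R -> R) : continuous f -> (forall t, 0 <= f t) ->
  \int[mu]_(t in `[0, 1]) f t = 0 -> forall t, 0 < t < 1 -> f t = 0.
Proof.
move=> cf f0 If t t01; apply/eqP; apply: contraT => ft.
pose I : set (measurableTypeR R) := `[0, 1]%classic.
have mI : measurable I by exact: measurable_itv.
have mf : measurable_fun I (EFin \o f).
  by apply/measurable_EFinP; apply: measurable_funTS; exact: continuous_measurable_fun.
have If' : (\int[mu]_(y in I) (EFin \o f) y = 0)%E.
  rewrite -[LHS]fineK; first by congr EFin.
  by apply: integrable_fin_num => //; exact: integrable_01.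
have H : ae_eq mu I (EFin \o f) (cst 0%E).
  apply: (ae_eq_integral_abs mu mI mf).1.
  by rewrite -[RHS]If'; apply: eq_integral => y _ /=; rewrite ger0_norm.
have [N [mN N0 HN]] : mu.-negligible (`]0, 1[%classic `&` f @^-1` [set s | s != 0]).
  apply: negligibleS H => s [/= s01 fs] Hs; have Is : I s.
    by move: s01; rewrite /I /= !in_itv/= => /andP[/ltW -> /ltW ->].
  by have /= [f0s] := Hs Is; rewrite f0s eqxx in fs.
have oU : open (`]0, 1[%classic `&` f @^-1` [set s | s != 0]).
  apply: openI; first exact: interval_open.
  by apply: open_comp; [move=> ? _; exact: cf|exact: open_neq].
have /nbhs_ballP [e /= e0 eU] : nbhs t (`]0, 1[%classic `&` f @^-1` [set s | s != 0]).
  by apply: open_nbhs_nbhs; split=> //; split=> //=; rewrite in_itv.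
have : (mu (ball t e) <= mu N)%E.
  by apply: le_measure; rewrite ?inE//; [exact: measurable_ball|move=> s /eU; exact: HN].
have -> : (mu (ball t e) = (e *+ 2)%R%:E)%E by rewrite lebesgue_measure_ball ?ltW.
by rewrite N0 lee_fin leNgt mulrn_wgt0.
Qed.

(** The moments up to the degree of [q] yield the integral of its square. *)
Lemma moments01_eq0 n (q : {poly R}) : (size q <= n)%N ->
  (forall j, (j < n)%N -> \int[mu]_(t in `[0, 1]) (t ^+ j * q.[t]) = 0) -> q = 0.
Proof.
move=> qn q0; have cq := @continuous_horner R q.
have cX k : continuous (fun t : R => t ^+ k) by exact: exprn_continuous.
have Q2 : \int[mu]_(t in `[0, 1]) (q.[t] ^+ 2) = 0.
  rewrite (@eq_integral01 _ _ (fun t => \sum_(j < n) q`_j * (t ^+ j * q.[t]))) => [|t]; last first.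
    rewrite expr2 {1}(horner_coef_wide _ qn) mulr_suml; apply: eq_bigr => j _.
    by rewrite mulrA.
  rewrite (@integral01_sum _ (fun j : 'I_n => q`_j) (fun (j : 'I_n) t => t ^+ j * q.[t])).
    by rewrite big1// => j _; rewrite q0// mulr0.
  by move=> j t; apply: cvgM; [exact: cX|exact: cq].
have q01 t : 0 < t < 1 -> q.[t] = 0.
  move=> t01; apply/eqP; rewrite -sqrf_eq0; apply/eqP.
  apply: (@continuous_integral01_eq0 (fun t => q.[t] ^+ 2)) t01 => // s; last exact: sqr_ge0.
  by rewrite (_ : (fun t => _) = fun t => q.[t] * q.[t]); [apply: cvgM; exact: cq|apply/funext => ?; rewrite expr2].
apply/eqP; apply: contraT => qn0.
have := max_poly_roots (rs := [seq (n + 2)%:R^-1 | n <- iota 0 (size q)]) qn0.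
rewrite size_map size_iota ltnn => -> //.
  apply/allP => t /mapP[k _ ->]; rewrite rootE q01// invr_gt0 ltr0n addn2/=.
  by rewrite invf_lt1 ?ltr0n// ltr1n.
rewrite map_inj_uniq ?iota_uniq// => k l /invr_inj /eqP.
by rewrite eqr_nat eqn_add2r => /eqP.
Qed.

Context (m : mesh R).
Local Notation V := 'I_(nvtx m).
Local Notation x := (@vtx R m).
Implicit Types (T S : {set V}) (e : V * V) (u v w : V) (y z : R * R).

Lemma intR2_hull_sum T (I : finType) (c : I -> R) (f : I -> R * R -> R) : nondegenerate_triangle T ->
  (forall i, continuous (f i)) ->
  intR2 (hull T) (fun y => \sum_i c i * f i y) = \sum_i c i * intR2 (hull T) (f i).
Proof.
move=> ndT cf; rewrite /intR2; elim: (index_enum I) => [|i s IH].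
  rewrite big_nil /Rintegral; under eq_integral do rewrite big_nil.
  by rewrite integral0.
have cs (s' : seq I) : continuous (fun y => \sum_(i <- s') c i * f i y).
  elim: s' => [|j s' IHs] t.
    by rewrite (_ : (fun t => _) = cst 0); [exact: cvg_cst|apply/funext => ?; rewrite big_nil].
  rewrite (_ : (fun t => _) = fun t => c j * f j t + \sum_(i <- s') c i * f i t).
    by apply: cvgD; [apply: cvgM; [exact: cvg_cst|exact: cf]|exact: IHs].
  by apply/funext => ?; rewrite big_cons.
have ci : continuous (fun t => c i * f i t) by move=> t; apply: cvgM; [exact: cvg_cst|exact: cf].
rewrite big_cons -IH -(RintegralZl (c i) (measurable_hull ndT) (integrable_hull ndT (cf i))).
rewrite -(RintegralD (measurable_hull ndT) (integrable_hull ndT ci) (integrable_hull ndT (cs s))).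
by apply: eq_Rintegral => y _; rewrite big_cons.
Qed.

Lemma epointE e t : @epoint R m e t = x e.1 + t *: tangent e.
Proof. by rewrite /epoint /tangent scalerBl scale1r scalerBr addrAC addrA. Qed.

Lemma poly_epoint k e (f : R * R -> R) : poly_deglt k f ->
  exists2 q : {poly R}, (size q <= k)%N & forall t, f (epoint e t) = q.[t].
Proof.
move=> fk; have [q qs qE] := poly_deglt_line (x e.1) (tangent e) fk.
by exists q => // t; rewrite epointE qE.
Qed.

(** The normal component of the radial part is a polynomial times the
    constant [y . n], so the trace stays in degree [r]. *)
Lemma RT_local_trace r e (p : R * R -> R * R) (n : R * R) : RT_local r p -> dot n (tangent e) = 0 ->
  exists2 q : {poly R}, (size q <= r.+1)%N & forall t, dot (p (epoint e t)) n = q.[t].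
Proof.
move=> [f1 [f2 [g [k1 k2 kg pE]]]] nt.
have K t : (epoint e t).1 * n.1 + (epoint e t).2 * n.2 = dot (x e.1) n.
  have -> : dot (x e.1) n = (x e.1).1 * n.1 + (x e.1).2 * n.2 + t * dot n (tangent e).
    by rewrite nt mulr0 addr0.
  by rewrite epointE /dot /= /GRing.scale/=; ring.
have Pk : poly_deglt r.+1 (fun y => n.1 * f1 y + n.2 * f2 y + dot (x e.1) n * g y).
  by apply: poly_degltD; [apply: poly_degltD|]; exact: poly_degltZ.
have [q qs qE] := poly_epoint e Pk; exists q => // t; rewrite -qE -(K t) pE /dot /=; ring.
Qed.

Lemma RT_local_comp r (p : R * R -> R * R) : RT_local r p ->
  poly_deglt r.+2 (fun y => (p y).1) /\ poly_deglt r.+2 (fun y => (p y).2).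
Proof.
move=> [f1 [f2 [g [k1 k2 kg pE]]]].
have y1 : poly_deglt 2 (fun y : R * R => y.1).
  have := poly_deglt_affine (0:R) 1 0; rewrite (_ : affine _ _ _ = fun y => y.1)//.
  by apply/funext => y; rewrite /affine; ring.
have y2 : poly_deglt 2 (fun y : R * R => y.2).
  have := poly_deglt_affine (0:R) 0 1; rewrite (_ : affine _ _ _ = fun y => y.2)//.
  by apply/funext => y; rewrite /affine; ring.
split.
  rewrite (_ : (fun y => _) = fun y => f1 y + y.1 * g y); last by apply/funext => y; rewrite pE.
  by apply: poly_degltD; [exact: poly_deglt_widen k1|exact: (poly_degltM y1 kg)].
rewrite (_ : (fun y => _) = fun y => f2 y + y.2 * g y); last by apply/funext => y; rewrite pE.
by apply: poly_degltD; [exact: poly_deglt_widen k2|exact: (poly_degltM y2 kg)].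
Qed.

(** A polynomial of degree less than [k] cannot cancel a homogeneous function
    of degree [k]: compare the growth along a line through the origin. *)
Lemma homogeneous_part_eq0 k (f h : R * R -> R) : poly_deglt k f ->
  (forall t y, h (t *: y) = t ^+ k * h y) -> (forall y, f y + h y = 0) -> forall y, h y = 0.
Proof.
move=> fk hh fh y; have [p ps pE] := poly_deglt_line 0 y fk.
have H t : p.[t] + h y * t ^+ k = 0 by rewrite -pE add0r -(fh (t *: y)) hh mulrC.
pose c j := p`_j + h y * (j == k)%:R.
have := @poly_coef_eq0 R k.+1 c _ k (ltnSn k).
rewrite /c eqxx mulr1 nth_default// add0r; apply=> t.
rewrite -[RHS](H t) (horner_coef_wide t (leqW ps)).
rewrite (eq_bigr (fun i : 'I_k.+1 => p`_i * t ^+ i + h y * (i == k :> nat)%:R * t ^+ i)); last first.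
  by move=> i _; rewrite mulrDl.
rewrite big_split/=; congr (_ + _); rewrite (bigD1 ord_max)//= eqxx mulr1 big1 ?addr0// => i ik.
rewrite (_ : (i == k :> nat) = false) ?mulr0 ?mul0r//; apply: contra_neqF ik => /eqP ik.
exact: val_inj.
Qed.

Definition hmono r (j : 'I_r.+1) : R * R -> R := mono (r - j) j.

Lemma hmonoZ r j (t : R) y : hmono j (t *: y) = t ^+ r * @hmono r j y.
Proof.
have -> : t ^+ r = t ^+ (r - j) * t ^+ j by rewrite -exprD subnK// -ltnS.
rewrite /hmono /mono /= /GRing.scale/= !exprMn.
by move: (t ^+ (r - j)) (t ^+ j) (y.1 ^+ _) (y.2 ^+ _) => *; ring.
Qed.

Lemma hmono_indep r (c : 'I_r.+1 -> R) : (forall y, \sum_j c j * hmono j y = 0) -> forall j, c j = 0.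
Proof.
move=> H j; pose d k := if insub k is Some i then c i else 0.
have dE (i : 'I_r.+1) : d i = c i by rewrite /d valK.
rewrite -dE; apply: (@poly_coef_eq0 R r.+1 d) => // t.
rewrite -[RHS](H (1, t)); apply: eq_bigr => i _; rewrite dE /hmono /mono /=.
by rewrite expr1n mul1r.
Qed.

Definition pairs r := {ij : 'I_r * 'I_r | ij \in [pred ij : 'I_r * 'I_r | (ij.1 + ij.2 < r)%N]}.

Definition pmono r (p : pairs r) : R * R -> R := mono (val p).1 (val p).2.

Lemma pmono_indep r (c : pairs r -> R) : (forall y, \sum_p c p * pmono p y = 0) -> forall p, c p = 0.
Proof.
move=> H p; pose d i j := if insub i is Some i' then if insub j is Some j' then
   if insub (i', j') is Some p then c p else 0 else 0 else 0.
have dE (i j : 'I_r) : d i j = if insub (i, j) is Some p then c p else 0 by rewrite /d !valK.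
have dp (q : pairs r) : d (val q).1 (val q).2 = c q by rewrite dE -surjective_pairing valK.
rewrite -dp.
apply: (@poly_coef_eq0 R r (fun j => d (val p).1 j)) => // t.
apply: (@poly_coef_eq0 R r (fun i => \sum_(j < r) d i j * t ^+ j) _ (val p).1) => // s.
rewrite -[RHS](H (s, t)).
transitivity (\sum_i \sum_j d (i : 'I_r) (j : 'I_r) * mono i j (s, t)).
  apply: eq_bigr => i _; rewrite mulr_suml; apply: eq_bigr => j _.
  by rewrite /mono /= mulrAC mulrA.
rewrite pair_big /=.
rewrite (bigID [pred ij : 'I_r * 'I_r | (ij.1 + ij.2 < r)%N])/= [X in _ + X]big1 ?addr0; last first.
  by move=> [i j] /= /negbTE ij; rewrite dE insubF ?mul0r// inE.
rewrite (eq_bigr (fun ij : 'I_r * 'I_r => (if insub ij is Some p then c p else 0) * mono ij.1 ij.2 (s, t))); last first.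
  by move=> ij _; rewrite dE -surjective_pairing.
rewrite [LHS](big_sub [pred ij : 'I_r * 'I_r | (ij.1 + ij.2 < r)%N]
  (fun ij => (if insub ij is Some p then c p else 0) * mono ij.1 ij.2 (s, t))).
by apply: eq_bigr => q _; rewrite valK.
Qed.

Lemma poly_deglt_pmono r (p : pairs r) : poly_deglt r (pmono p).
Proof. by apply: poly_deglt_mono; have := valP p. Qed.

Lemma poly_deglt_hmono r j : poly_deglt r.+1 (@hmono r j).
Proof. by apply: poly_deglt_mono; rewrite subnK// -ltnS. Qed.

End Moments.

Section Unisolvence.
Context {R : realType} (m : mesh R).
Notation mu := (@lebesgue_measure R).
Local Notation V := 'I_(nvtx m).
Local Notation x := (@vtx R m).
Implicit Types (T S : {set V}) (e : V * V) (u v w : V) (y z : R * R).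

Lemma poly_deglt_continuous k (f : R * R -> R) : poly_deglt k f -> continuous f.
Proof. by move=> /poly_deglt_C1[[]]. Qed.

(** Euler's identity for homogeneous functions of degree [r]. *)
Lemma euler_hmono r (c : 'I_r.+1 -> R) y :
  let g := fun y => \sum_j c j * hmono j y in
  y.1 * partial false g y + y.2 * partial true g y = r%:R * g y.
Proof.
move=> g; rewrite /g; suff [_ H] : C1 (fun y => \sum_j c j * hmono j y) /\ forall y,
    y.1 * partial false (fun y => \sum_j c j * hmono j y) y +
    y.2 * partial true (fun y => \sum_j c j * hmono j y) y = r%:R * (\sum_j c j * hmono j y).
  exact: H.
elim: (index_enum _) => [|j s [C1s Es]].
  rewrite (_ : (fun y => \sum_(j <- [::]) _) = cst 0); last by apply/funext => z; rewrite big_nil.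
  by split=> [|z]; [exact: C1_cst|rewrite !partial_cst !mulr0 addr0 big_nil mulr0].
have sE : (fun y => \sum_(i <- j :: s) c i * hmono i y) =
    (cst (c j) \* hmono j) \+ (fun y => \sum_(i <- s) c i * hmono i y).
  by apply/funext => z; rewrite big_cons.
have Cj := C1M (C1_cst (c j)) (C1_mono (r - j) j : C1 (hmono j)).
rewrite sE; split=> [|z]; first exact: C1D.
rewrite !(partialD _ _ Cj C1s) !(partialM _ _ (C1_cst (c j)) (C1_mono (r - j) j)) !partial_cst /=.
rewrite big_cons [RHS]mulrDr -(Es z).
have Ej : z.1 * partial false (hmono j) z + z.2 * partial true (hmono j) z = r%:R * hmono j z.
  rewrite /hmono !partial_mono /mono.
  have p1 (k : nat) (t : R) : t * (k%:R * t ^+ k.-1) = k%:R * t ^+ k.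
    by case: k => [|k]; rewrite ?mul0r ?mulr0//= exprS mulrCA.
  have -> : r%:R = (r - j)%:R + j%:R :> R by rewrite -natrD subnK// -ltnS.
  have := p1 (r - j)%N z.1; have := p1 j z.2.
  move: (z.1 ^+ (r - j).-1) (z.1 ^+ (r - j)) (z.2 ^+ j.-1) (z.2 ^+ j) => X' X Y' Y.
  move: ((r - j)%:R : R) (j%:R : R) z.1 z.2 => n k s' t' B A.
  transitivity (s' * (n * X') * Y + X * (t' * (k * Y'))); first by ring.
  by rewrite A B; ring.
move: Ej; move: (partial false (fun y => \sum_(i <- s) c i * hmono i y) z).
move: (partial true (fun y => \sum_(i <- s) c i * hmono i y) z) => B A.
rewrite -/(hmono j); move: (partial false (hmono j) z) (partial true (hmono j) z) => B' A' Ej.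
by rewrite mulrCA -Ej; ring.
Qed.

Lemma moments_cross_eq0 T (F1 F2 q : R * R -> R) (t : R * R) : nondegenerate_triangle T ->
  continuous F1 -> continuous F2 -> continuous q ->
  intR2 (hull T) (fun y => q y * F1 y) = 0 -> intR2 (hull T) (fun y => q y * F2 y) = 0 ->
  intR2 (hull T) (fun y => cross (F1 y, F2 y) t * q y) = 0.
Proof.
move=> ndT c1 c2 cq m1 m2.
have k1 : continuous (fun y => q y * F1 y) by move=> y; apply: cvgM; [exact: cq|exact: c1].
have k2 : continuous (fun y => q y * F2 y) by move=> y; apply: cvgM; [exact: cq|exact: c2].
pose G (b : bool) := if b then (fun y => q y * F2 y) else (fun y => q y * F1 y).
pose C (b : bool) := if b then - t.1 else t.2.
have := intR2_hull_sum (I := bool) C (f := G) ndT; rewrite big_bool /= m1 m2 !mulr0 addr0 => <-; last first.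
  by case.
rewrite /intR2; apply: eq_Rintegral => y _; rewrite big_bool /C /G /cross /=; ring.
Qed.

(** The component across the edge vanishes on the edge, hence is the barycentric
    coordinate of the opposite vertex times a polynomial of degree less than
    [r]. Testing with this polynomial integrates a nonnegative function to 0. *)
Lemma tangential_part_eq0 T a b c r (F1 F2 : R * R -> R) : nondegenerate_triangle T ->
  T = [set a; b; c]%SET -> poly_deglt r.+1 F1 -> poly_deglt r.+1 F2 ->
  (forall q, poly_deglt r q -> intR2 (hull T) (fun y => q y * F1 y) = 0) ->
  (forall q, poly_deglt r q -> intR2 (hull T) (fun y => q y * F2 y) = 0) ->
  (forall t, cross (F1 (x a + t *: (x c - x a)), F2 (x a + t *: (x c - x a))) (x c - x a) = 0) ->
  forall y, cross (F1 y, F2 y) (x c - x a) = 0.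
Proof.
move=> ndT TE k1 k2 m1 m2 tr0; have [J [ab bc ac]] := nondegenerate_triple ndT TE.
have J' : cross (x c - x a) (x b - x a) != 0 by rewrite crossC oppr_eq0.
pose phi y := cross (F1 y, F2 y) (x c - x a).
have kphi : poly_deglt r.+1 phi.
  rewrite (_ : phi = fun y => (x c - x a).2 * F1 y + (- (x c - x a).1) * F2 y).
    by apply: poly_degltD; exact: poly_degltZ.
  by apply/funext => y; rewrite /phi /cross /=; ring.
have tr0' s : (phi \o aff (x a) (x c - x a) (x b - x a)) (s, 0) = 0.
  by rewrite /= /aff /= scale0r addr0; exact: tr0.
have [g kg gE] := poly_deglt_factor (poly_deglt_aff (x a) (x c - x a) (x b - x a) kphi) tr0'.
pose B := bcoord (x a) (x b - x a) (x c - x a); pose C := bcoord (x a) (x c - x a) (x b - x a).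
pose psi y := g (C y, B y).
have phiE y : phi y = B y * psi y.
  by have := gE (C y, B y); rewrite /= subr0 /C /B aff_bcoord.
have kpsi : poly_deglt r psi.
  have [c1 [p1 [q1 e1]]] : exists c p q, C = affine c p q by rewrite /C bcoord_affine; do 3!eexists.
  have [c2 [p2 [q2 e2]]] : exists c p q, B = affine c p q by rewrite /B bcoord_affine; do 3!eexists.
  have := poly_deglt_aff (c1, c2) (p1, p2) (q1, q2) kg; rewrite (_ : _ \o _ = psi)//.
  apply/funext => y; rewrite /psi /= e1 e2; congr g.
  by rewrite /aff /affine; congr pair; rewrite /= /GRing.scale/=; ring.
have cpsi := poly_deglt_continuous kpsi; have cphi := poly_deglt_continuous kphi.
have I0 : intR2 (hull T) (fun y => phi y * psi y) = 0.
  apply: (moments_cross_eq0 _ ndT) => //; [exact: poly_deglt_continuous k1|exact: poly_deglt_continuous k2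
    |exact: m1|exact: m2].
have zero : forall y, otri T y -> phi y * psi y = 0.
  apply: (integral_hull_eq0 ndT) => // [y|y]; first by apply: cvgM; [exact: cphi|exact: cpsi].
  by rewrite (hull_tri ndT TE) => -[h _ _]; rewrite phiE -mulrA mulr_ge0// -expr2 sqr_ge0.
apply: (poly_deglt_otri_eq0 ndT kphi) => y /zero /eqP; rewrite mulf_eq0 => /orP[/eqP//|/eqP e].
by rewrite phiE e mulr0.
Qed.

(** Injectivity of the degrees of freedom. The divergence has degree at most
    [r], and Green's formula turns the integral of its square into edge terms
    and moments against its gradient, which all vanish. Hence the divergence is
    0, and so is its homogeneous part of degree [r], which is [(r + 2) g] by
    Euler's identity. The remaining field is tangential on every edge, so its
    components across two edges vanish by [tangential_part_eq0]. *)
Lemma RT_kernel T r (F1 F2 : R * R -> R) (c : 'I_r.+1 -> R) (g := fun y => \sum_j c j * hmono j y)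
    (p := fun y : R * R => (F1 y + y.1 * g y, F2 y + y.2 * g y)) :
  nondegenerate_triangle T -> poly_deglt r.+1 F1 -> poly_deglt r.+1 F2 ->
  (forall q, poly_deglt r q -> intR2 (hull T) (fun y => q y * (p y).1) = 0) ->
  (forall q, poly_deglt r q -> intR2 (hull T) (fun y => q y * (p y).2) = 0) ->
  (forall e, tri_edge T e -> forall t, dot (p (epoint e t)) (outer_normal T e) = 0) ->
  [/\ forall y, F1 y = 0, forall y, F2 y = 0 & forall y, g y = 0].
Proof.
move=> ndT k1 k2 m1 m2 tr0.
have kg : poly_deglt r.+1 g.
  by apply: poly_deglt_sum => j _; apply: poly_degltZ; exact: poly_deglt_hmono.
have [kp1 kp2] : poly_deglt r.+2 (fun y => (p y).1) /\ poly_deglt r.+2 (fun y => (p y).2).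
  by apply: RT_local_comp; exists F1, F2, g; split.
have [Cp1 d1] := poly_deglt_C1 kp1; have [Cp2 d2] := poly_deglt_C1 kp2.
have [CF1 dF1] := poly_deglt_C1 k1; have [CF2 dF2] := poly_deglt_C1 k2; have [Cg _] := poly_deglt_C1 kg.
pose D y := partial false (fun y => (p y).1) y + partial true (fun y => (p y).2) y.
have kD : poly_deglt r.+1 D by apply: poly_degltD; [exact: d1|exact: d2].
have [CD dD] := poly_deglt_C1 kD.
have D0 : forall y, D y = 0.
  (* Green's formula with the test function D itself *)
  have I0 : intR2 (hull T) (fun y => D y * D y) = 0.
    have := green_hull ndT CD Cp1 Cp2; rewrite big1 ?sub0r => [|e eT]; last first.
      rewrite /int_edge (@eq_integral01 _ _ (cst 0)) ?Rintegral_cst ?mul0r ?mulr0// => t.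
      by rewrite -surjective_pairing tr0// mulr0.
    have -> : intR2 (hull T) (fun y => dot ((p y).1, (p y).2) (grad D y)) = 0.
      pose G (b : bool) := if b then (fun y => partial true D y * (p y).2) else (fun y => partial false D y * (p y).1).
      have := intR2_hull_sum (I := bool) (fun=> 1) (f := G) ndT.
      rewrite big_bool /= m1 ?m2; [|exact: dD|exact: dD].
      rewrite !mulr0 addr0 => <-; last first.
        case=> y; apply: cvgM; [exact: (CD.2 true).1|exact: Cp2.1|exact: (CD.2 false).1|exact: Cp1.1].
      rewrite /intR2; apply: eq_Rintegral => y _; rewrite big_bool /G /dot /grad /=.
      move: (partial false D y) (partial true D y) (p y).1 (p y).2 => A B C E.
      by rewrite !mul1r addrC mulrC [B * _]mulrC.
    by move=> /esym/eqP; rewrite oppr_eq0 => /eqP.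
  have cD := CD.1.
  apply: (poly_deglt_otri_eq0 ndT kD) => y yT; apply/eqP; rewrite -sqrf_eq0 expr2; apply/eqP; move: y yT.
  apply: (integral_hull_eq0 ndT) => // [y|y _]; first by apply: cvgM; exact: cD.
  by rewrite -expr2 sqr_ge0.
have g0 : forall y, g y = 0.
  have kdF : poly_deglt r (fun y => partial false F1 y + partial true F2 y).
    by apply: poly_degltD; [exact: dF1|exact: dF2].
  have H := @homogeneous_part_eq0 R r _ (fun y => r.+2%:R * g y) kdF.
  have r20 : r.+2%:R != 0 :> R by rewrite pnatr_eq0.
  move=> y; apply: (mulfI r20); rewrite mulr0; apply: H => {y} [t y|y].
    rewrite mulrCA; congr (_ * _); rewrite /g mulr_sumr; apply: eq_bigr => j _.
    by rewrite hmonoZ mulrCA.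
  rewrite -[RHS](D0 y) /D.
  have C_1 : C1 (fun y : R * R => y.1).
    have := C1_affine (0:R) 1 0; rewrite (_ : affine _ _ _ = fun y => y.1)//.
    by apply/funext => z; rewrite /affine; ring.
  have C_2 : C1 (fun y : R * R => y.2).
    have := C1_affine (0:R) 0 1; rewrite (_ : affine _ _ _ = fun y => y.2)//.
    by apply/funext => z; rewrite /affine; ring.
  have e1 : partial false (fun y => (p y).1) y = partial false F1 y + (y.1 * partial false g y + g y).
    have := partialD false y CF1 (C1M C_1 Cg) => ->; rewrite (partialM false y C_1 Cg).
    rewrite (_ : partial false (fun y : R * R => y.1) y = 1) ?mulr1//.
    have := partial_affine false (0:R) 1 0; rewrite (_ : affine _ _ _ = fun y => y.1) => [->//|].
    by apply/funext => z; rewrite /affine; ring.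
  have e2 : partial true (fun y => (p y).2) y = partial true F2 y + (y.2 * partial true g y + g y).
    have := partialD true y CF2 (C1M C_2 Cg) => ->; rewrite (partialM true y C_2 Cg).
    rewrite (_ : partial true (fun y : R * R => y.2) y = 1) ?mulr1//.
    have := partial_affine true (0:R) 0 1; rewrite (_ : affine _ _ _ = fun y => y.2) => [->//|].
    by apply/funext => z; rewrite /affine; ring.
  rewrite e1 e2 -[r.+2]addn2 natrD mulrDl -(euler_hmono c y) -/g.
  by move: (g y) (partial false g y) (partial true g y) (partial false F1 y) (partial true F2 y) => *; ring.
have pF y : p y = (F1 y, F2 y) by rewrite /p !g0 !mulr0 !addr0.
have [a [b [d [TE [ab bd ad] /andP[ab' bd']]]]] := card3_sorted (fun v => v : nat) ndT.1.
have {}ab' : (a < b)%N by rewrite ltn_neqAle ab' andbT; apply: contra_neq ab => /val_inj.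
have {}bd' : (b < d)%N by rewrite ltn_neqAle bd' andbT; apply: contra_neq bd => /val_inj.
have TE' : T = [set a; d; b]%SET by rewrite TE; apply/setP => v; rewrite !inE; case: (v == a); case: (v == b); case: (v == d).
have edge u v w : T = [set u; v; w]%SET -> (u < v)%N ->
    forall t, cross (F1 (x u + t *: (x v - x u)), F2 (x u + t *: (x v - x u))) (x v - x u) = 0.
  move=> TE2 uv t; have eT : tri_edge T (u, v).
    by rewrite /tri_edge uv /eset TE2 /= finset.subUset !finset.sub1set !inE !eqxx ?orbT.
  have [_ H] := outer_normalP ndT TE2.
  have := tr0 _ eT t; rewrite pF epointE /= => z0.
  have := H (F1 (x u + t *: (x v - x u)), F2 (x u + t *: (x v - x u))); rewrite /tangent/= in z0 *.
  rewrite z0 mul0r => /esym/eqP; rewrite mulf_eq0 sgr_eq0.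
  by have [/negbTE -> _] := nondegenerate_triple ndT TE2; move=> /= /eqP.
have m1' q : poly_deglt r q -> intR2 (hull T) (fun y => q y * F1 y) = 0.
  by move=> /m1 H; rewrite -[RHS]H /intR2; apply: eq_Rintegral => y _; rewrite pF.
have m2' q : poly_deglt r q -> intR2 (hull T) (fun y => q y * F2 y) = 0.
  by move=> /m2 H; rewrite -[RHS]H /intR2; apply: eq_Rintegral => y _; rewrite pF.
have t1 := tangential_part_eq0 ndT TE k1 k2 m1' m2' (edge _ _ _ TE' (ltn_trans ab' bd')).
have t2 := tangential_part_eq0 ndT TE' k1 k2 m1' m2' (edge _ _ _ TE ab').
have [J _] := nondegenerate_triple ndT TE.
have comb y : F1 y = 0 /\ F2 y = 0.
  have := t1 y; have := t2 y; rewrite /cross /= => e1 e2; split.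
    apply: (mulfI J); rewrite mulr0 /cross.
    transitivity ((x b - x a).1 * (F1 y * (x d - x a).2 - F2 y * (x d - x a).1) -
      (x d - x a).1 * (F1 y * (x b - x a).2 - F2 y * (x b - x a).1)).
      by move: (x b - x a) (x d - x a) (F1 y) (F2 y) => u v s t; ring.
    by rewrite /= e1 e2 !mulr0 subrr.
  apply: (mulfI J); rewrite mulr0 /cross.
  transitivity ((x b - x a).2 * (F1 y * (x d - x a).2 - F2 y * (x d - x a).1) -
      (x d - x a).2 * (F1 y * (x b - x a).2 - F2 y * (x b - x a).1)).
    by move: (x b - x a) (x d - x a) (F1 y) (F2 y) => u v s t; ring.
  by rewrite /= e1 e2 !mulr0 subrr.
by split=> // y; have [] := comb y.
Qed.

Definition coord2 (k : bool) (z : R * R) : R := if k then z.2 else z.1.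

(** The coefficients of the basis below and the degrees of freedom share one
    index type, so that their matrix is square: ['I_3] numbers the edges of the
    triangle for the latter, and for the former the two coordinate directions
    and the radial one. *)
Definition RT_index r := ((bool * pairs r) + ('I_3 * 'I_r.+1))%type.

Definition RT_basis r (n : RT_index r) : R * R -> R * R :=
  match n with
  | inl (k, p) => fun y => if k then (0, pmono p y) else (pmono p y, 0)
  | inr (i, j) => fun y => if i == 0 :> nat then (hmono j y, 0)
                           else if i == 1%N :> nat then (0, hmono j y)
                           else (y.1 * hmono j y, y.2 * hmono j y)
  end.

Lemma RT_basis_comb r (c : RT_index r -> R) : exists F1 F2 : R * R -> R,
  let g := fun y => \sum_j c (inr (inord 2, j)) * hmono j y in
  [/\ poly_deglt r.+1 F1, poly_deglt r.+1 F2,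
      forall y, (\sum_n c n * (RT_basis n y).1, \sum_n c n * (RT_basis n y).2) =
        (F1 y + y.1 * g y, F2 y + y.2 * g y) &
      (forall y, F1 y = 0) -> (forall y, F2 y = 0) -> (forall y, g y = 0) -> forall n, c n = 0].
Proof.
pose f k y := \sum_p c (inl (k, p)) * pmono p y.
pose h k y := \sum_j c (inr (k, j)) * hmono j y.
have kf k : poly_deglt r (f k).
  by apply: poly_deglt_sum => p _; apply: poly_degltZ; exact: poly_deglt_pmono.
have kh k : poly_deglt r.+1 (h k).
  by apply: poly_deglt_sum => p _; apply: poly_degltZ; exact: poly_deglt_hmono.
have kfw k : poly_deglt r.+1 (f k) by exact: poly_deglt_widen (kf k).
have split_sum (G : RT_index r -> R) : \sum_n G n = (\sum_p G (inl (false, p)) + \sum_p G (inl (true, p))) +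
   (\sum_j G (inr (inord 0, j)) + \sum_j G (inr (inord 1, j)) + \sum_j G (inr (inord 2, j))).
  rewrite big_sumType /=; congr (_ + _).
    transitivity (\sum_k \sum_p G (inl (k, p))); last by rewrite big_bool addrC.
    by rewrite pair_bigA; apply: eq_bigr => -[k p].
  transitivity (\sum_i \sum_j G (inr (i, j))); first by rewrite pair_bigA; apply: eq_bigr => -[i j].
  rewrite big_ord_recl big_ord_recl big_ord_recl big_ord0 /= addr0 addrA.
  by do 2?congr (_ + _); apply: eq_bigr => j _; congr (G (inr (_, _))); apply: val_inj; rewrite /= inordK.
exists (fun y => f false y + h (inord 0) y), (fun y => f true y + h (inord 1) y); split.
- exact: poly_degltD.
- exact: poly_degltD.
- move=> y; rewrite !split_sum /RT_basis /= !inordK//=.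
  congr pair.
    rewrite [X in _ + X + _]big1 ?addr0 => [|p _]; last by rewrite mulr0.
    rewrite [X in _ + (_ + X + _)]big1 ?addr0 => [|p _]; last by rewrite mulr0.
    by rewrite addrA mulr_sumr; congr (_ + _); apply: eq_bigr => j _; rewrite mulrCA.
  rewrite [X in X + _ + _]big1 ?add0r => [|p _]; last by rewrite mulr0.
  rewrite [X in _ + (X + _ + _)]big1 ?add0r => [|p _]; last by rewrite mulr0.
  by rewrite addrA mulr_sumr; congr (_ + _); apply: eq_bigr => j _; rewrite mulrCA.
move=> z1 z2 z3.
have hh k t y : h k (t *: y) = t ^+ r * h k y.
  by rewrite /h mulr_sumr; apply: eq_bigr => j _; rewrite hmonoZ mulrCA.
have h0 := homogeneous_part_eq0 (kf false) (hh (inord 0)) z1.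
have h1 := homogeneous_part_eq0 (kf true) (hh (inord 1)) z2.
have f0 y : f false y = 0 by have := z1 y; rewrite h0 addr0.
have f1 y : f true y = 0 by have := z2 y; rewrite h1 addr0.
move=> [[[] p]|[i j]].
- exact: (pmono_indep f1).
- exact: (pmono_indep f0).
have [|[]] : i = inord 0 \/ i = inord 1 \/ i = inord 2.
  case: i => [[|[|[|//]]] Hi]; [left|right; left|right; right]; apply: val_inj; rewrite /= inordK//.
- by move=> ->; exact: (hmono_indep h0).
- by move=> ->; exact: (hmono_indep h1).
- by move=> ->; exact: (hmono_indep z3).
Qed.

Lemma tri_edge_cases T a b c e : T = [set a; b; c]%SET -> (a < b)%N -> (b < c)%N ->
  tri_edge T e -> e = (a, b) \/ e = (b, c) \/ e = (a, c).
Proof.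
move=> TE ab bc; case: e => u v; rewrite /tri_edge /= => /andP[uv].
rewrite /eset /= finset.subUset !finset.sub1set => /andP[uT vT].
have [uE|[uE|uE]] := in_triple TE uT; have [vE|[vE|vE]] := in_triple TE vT; subst u v;
  try (by left); try (by right; left); try (by right; right); exfalso; move: uv; rewrite ?ltnn//; lia.
Qed.

Lemma continuous_RT_basis r k (n : RT_index r) : continuous (fun y => coord2 k (RT_basis n y)).
Proof.
have c0 : continuous (cst 0 : R * R -> R) by move=> ?; exact: cvg_cst.
have cm i j : continuous (@mono R i j) by exact: continuous_mono.
have cf : continuous (fun y : R * R => y.1) by move=> ?; exact: cvg_fst.
have cs : continuous (fun y : R * R => y.2) by move=> ?; exact: cvg_snd.
case: n => [[b p]|[i j]]; rewrite /coord2 /RT_basis.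
  by case: b; case: k; rewrite //=; exact: cm.
move: (nat_of_ord i == 0%N) (nat_of_ord i == 1%N) => [] []; case: k; rewrite //=;
  try exact: cm; move=> y; apply: cvgM; (exact: cf || exact: cs || exact: cm).
Qed.

Lemma poly_deglt_pmonoP r (f : R * R -> R) : poly_deglt r f ->
  exists d : pairs r -> R, forall y, f y = \sum_p d p * pmono p y.
Proof.
move: f; apply: poly_deglt_ind => [|f g [d fE] [d' gE]|t f [d fE]|i j ijr].
- by exists (fun=> 0) => y; rewrite big1// => p _; rewrite mul0r.
- exists (fun p => d p + d' p) => y; rewrite fE gE -big_split/=; apply: eq_bigr => p _.
  by rewrite mulrDl.
- exists (fun p => t * d p) => y; rewrite fE mulr_sumr; apply: eq_bigr => p _.
  by rewrite mulrA.
have ir : (i < r)%N by lia.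
have jr : (j < r)%N by lia.
have P : (Ordinal ir, Ordinal jr) \in [pred ij : 'I_r * 'I_r | (ij.1 + ij.2 < r)%N] by rewrite inE.
pose p0 : pairs r := Sub (Ordinal ir, Ordinal jr) P.
exists (fun p : pairs r => (p == p0)%:R) => y.
rewrite (bigD1 p0)//= eqxx mul1r big1 ?addr0// => p /negbTE ->.
by rewrite mul0r.
Qed.

(** By [RT_kernel] the square matrix of the moments of the basis is injective. *)
Lemma RT_local_moments T r (L : bool -> pairs r -> R) (q : V * V -> 'I_r.+1 -> R) :
  nondegenerate_triangle T ->
  exists p, [/\ RT_local r p,
    forall k s, intR2 (hull T) (fun y => pmono s y * coord2 k (p y)) = L k s &
    forall e (j : 'I_r.+1), tri_edge T e -> \int[mu]_(t in `[0, 1])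
      (t ^+ j * dot (p (epoint e t)) (outer_normal T e)) = q e j].
Proof.
move=> ndT.
have [a [b [d [TE [ab bd ad] /andP[ab' bd']]]]] := card3_sorted (fun v => v : nat) ndT.1.
have {}ab' : (a < b)%N by rewrite ltn_neqAle ab' andbT; apply: contra_neq ab => /val_inj.
have {}bd' : (b < d)%N by rewrite ltn_neqAle bd' andbT; apply: contra_neq bd => /val_inj.
pose E (i : 'I_3) : V * V := nth (a, b) [:: (a, b); (b, d); (a, d)] i.
have EP e : tri_edge T e -> exists i, e = E i.
  move=> /(tri_edge_cases TE ab' bd')[->|[->|->]]; [exists (inord 0)|exists (inord 1)|exists (inord 2)];
  by rewrite /E inordK.
pose A (n k : RT_index r) : R := match k with
  | inl (k, s) => intR2 (hull T) (fun y => pmono s y * coord2 k (RT_basis n y))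
  | inr (i, j) => \int[mu]_(t in `[0, 1]) (t ^+ j * dot (RT_basis n (epoint (E i) t)) (outer_normal T (E i)))
  end.
have cb := @continuous_RT_basis r.
have ce (n : RT_index r) i : continuous (fun t => dot (RT_basis n (epoint (E i) t)) (outer_normal T (E i))).
  move=> t; rewrite /dot; apply: cvgD; apply: cvgM; try exact: cvg_cst.
    exact: (@continuous_segment _ _ (x (E i).1) (x (E i).2) (cb false n)).
  exact: (@continuous_segment _ _ (x (E i).1) (x (E i).2) (cb true n)).
pose P (c : RT_index r -> R) y := (\sum_n c n * (RT_basis n y).1, \sum_n c n * (RT_basis n y).2).
have AI c k s : intR2 (hull T) (fun y => pmono s y * coord2 k (P c y)) = \sum_n c n * A n (inl (k, s)).
  rewrite /A -(intR2_hull_sum c (f := fun (n : RT_index r) y => pmono s y * coord2 k (RT_basis n y)) ndT); last first.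
    by move=> n y; apply: cvgM; [exact: continuous_mono|exact: cb].
  rewrite /intR2; apply: eq_Rintegral => y _.
  by rewrite (_ : coord2 k (P c y) = \sum_n c n * coord2 k (RT_basis n y)) ?mulr_sumr;
    [apply: eq_bigr => n _; rewrite mulrCA|case: k].
have AE c i (j : 'I_r.+1) : \int[mu]_(t in `[0, 1]) (t ^+ j * dot (P c (epoint (E i) t)) (outer_normal T (E i))) =
    \sum_n c n * A n (inr (i, j)).
  rewrite /A -(@integral01_sum _ _ c (fun (n : RT_index r) t => t ^+ j * dot (RT_basis n (epoint (E i) t)) (outer_normal T (E i)))).
    apply: eq_integral01 => t; rewrite /P /dot /= !mulr_suml -big_split/= mulr_sumr.
    by apply: eq_bigr => n _; rewrite -mulrA -mulrA -mulrDr mulrCA.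
  by move=> n t; apply: cvgM; [exact: exprn_continuous|exact: ce].
have [|c cE] := injective_square_solvable (A := A) _ (fun k => match k with inl (k, s) => L k s | inr (i, j) => q (E i) j end).
  move=> c c0; have [F1 [F2 [k1 k2 PE ci]]] := RT_basis_comb c.
  pose g y := \sum_j c (inr (inord 2, j)) * hmono j y.
  have kg : poly_deglt r.+1 g.
    by apply: poly_deglt_sum => j _; apply: poly_degltZ; exact: poly_deglt_hmono.
  have PE' y : P c y = (F1 y + y.1 * g y, F2 y + y.2 * g y) := PE y.
  have RTP : RT_local r (P c) by exists F1, F2, g; split.
  have [cP1 cP2] := RT_local_comp RTP.
  have mom k (f : R * R -> R) : poly_deglt r f -> intR2 (hull T) (fun y => f y * coord2 k (P c y)) = 0.
    move=> /poly_deglt_pmonoP[dd fE].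
    have cs (s : pairs r) : continuous (fun y => pmono s y * coord2 k (P c y)).
      move=> y; apply: cvgM; first exact: continuous_mono.
      by case: k; [exact: (poly_deglt_continuous cP2)|exact: (poly_deglt_continuous cP1)].
    transitivity (intR2 (hull T) (fun y => \sum_s dd s * (pmono s y * coord2 k (P c y)))).
      rewrite /intR2; apply: eq_Rintegral => y _; rewrite fE mulr_suml.
      by apply: eq_bigr => s _; rewrite mulrA.
    by rewrite (intR2_hull_sum dd ndT cs) big1// => s _; rewrite AI c0 mulr0.
  have [] := @RT_kernel T r F1 F2 (fun j => c (inr (inord 2, j))) ndT k1 k2.
  - by move=> f kf; rewrite -[RHS](mom false f kf) /intR2; apply: eq_Rintegral => y _; rewrite /coord2 PE'.
  - by move=> f kf; rewrite -[RHS](mom true f kf) /intR2; apply: eq_Rintegral => y _; rewrite /coord2 PE'.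
  - move=> e eT t; rewrite (_ : (_, _) = P c (epoint e t)); last by rewrite PE'.
    have nt : dot (outer_normal T e) (tangent e) = 0.
      have [i eE] := EP e eT.
      have TE2 : T = [set b; d; a]%SET by rewrite TE; apply/setP => v; rewrite !inE; case: (v == a); case: (v == b); case: (v == d).
      have TE3 : T = [set a; d; b]%SET by rewrite TE; apply/setP => v; rewrite !inE; case: (v == a); case: (v == b); case: (v == d).
      have [->|[->|->]] := tri_edge_cases TE ab' bd' eT.
      + by have [[_ +] _] := outer_normalP ndT TE.
      + by have [[_ +] _] := outer_normalP ndT TE2.
      + by have [[_ +] _] := outer_normalP ndT TE3.
    have [qq qs qE] := RT_local_trace RTP nt; rewrite qE.
    suff -> : qq = 0 by rewrite horner0.
    apply: (moments01_eq0 qs) => j jr; have [i eE] := EP e eT.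
    rewrite -[RHS](c0 (inr (i, Ordinal jr))) -AE; apply: eq_integral01 => t'.
    by rewrite -eE qE.
  by move=> z1 z2 z3; exact: ci.
exists (P c); split.
- have [F1 [F2 [k1 k2 PE _]]] := RT_basis_comb c.
  exists F1, F2; eexists; split; [exact: k1|exact: k2| |exact: PE].
  by apply: poly_deglt_sum => j _; apply: poly_degltZ; exact: poly_deglt_hmono.
- by move=> k s; rewrite AI cE.
- by move=> e j /EP[i ->]; rewrite AE cE.
Qed.

(** Moments against the monomials and against the nodal bases determine each
    other, by interpolation and by expansion in monomials. *)
Lemma RT_local_dofs T r (s : bool -> {ffun V -> 'I_r} -> R) (s' : V * V -> 'I_r.+1 -> R) :
  nondegenerate_triangle T ->
  exists p, [/\ RT_local r p,
    forall k i, i \in lattice r T -> intR2 (hull T) (fun y => phiT T i y * coord2 k (p y)) = s k i &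
    forall e (j : 'I_r.+1), tri_edge T e -> \int[mu]_(t in `[0, 1])
      ((phiE j).[t] * dot (p (epoint e t)) (outer_normal T e)) = s' e j].
Proof.
move=> ndT.
have [p [pRT pM pE]] := RT_local_moments
  (fun k q => \sum_(i in lattice r T) pmono q (nodeT T i) * s k i)
  (fun e (j : 'I_r.+1) => \sum_l nodeE l ^+ j * s' e l) ndT.
have [cp1 cp2] := RT_local_comp pRT.
have cc k : continuous (fun y => coord2 k (p y)).
  by case: k; [exact: (poly_deglt_continuous cp2)|exact: (poly_deglt_continuous cp1)].
exists p; split=> // [k i iL|e j eT].
  have kphi := poly_deglt_phiT ndT iL; have [d dE] := poly_deglt_pmonoP kphi.
  have cq (q : pairs r) : continuous (fun y => pmono q y * coord2 k (p y)).
    by move=> y; apply: cvgM; [exact: continuous_mono|exact: cc].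
  transitivity (intR2 (hull T) (fun y => \sum_q d q * (pmono q y * coord2 k (p y)))).
    rewrite /intR2; apply: eq_Rintegral => y _; rewrite dE mulr_suml.
    by apply: eq_bigr => q _; rewrite mulrA.
  rewrite (intR2_hull_sum d ndT cq); under eq_bigr do rewrite pM mulr_sumr.
  rewrite exchange_big/= (bigD1 i)//= [X in _ + X]big1 ?addr0 => [|i' /andP[iL' ii']].
    under eq_bigr do rewrite mulrA; rewrite -mulr_suml -dE.
    by rewrite phiTE// lattice_poly_node// eqxx mul1r.
  under eq_bigr do rewrite mulrA; rewrite -mulr_suml -dE.
  by rewrite phiTE// lattice_poly_node// eq_sym (negbTE ii') mul0r.
have ct : continuous (fun t : R => dot (p (epoint e t)) (outer_normal T e)).
  move=> t; rewrite /dot; apply: cvgD; apply: cvgM; try exact: cvg_cst.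
    exact: (@continuous_segment _ _ (x e.1) (x e.2) (cc false)).
  exact: (@continuous_segment _ _ (x e.1) (x e.2) (cc true)).
have cq (l : 'I_r.+1) : continuous (fun t : R => t ^+ l * dot (p (epoint e t)) (outer_normal T e)).
  by move=> t; apply: cvgM; [exact: exprn_continuous|exact: ct].
transitivity (\int[mu]_(t in `[0, 1]) (\sum_(l < r.+1) (phiE j)`_l * (t ^+ l * dot (p (epoint e t)) (outer_normal T e)))).
  apply: eq_integral01 => t; rewrite (horner_coef_wide _ (phiEP j).1) mulr_suml.
  by apply: eq_bigr => l _; rewrite mulrA.
rewrite (integral01_sum (fun l : 'I_r.+1 => (phiE j)`_l) cq); under eq_bigr do rewrite pE// mulr_sumr.
rewrite exchange_big/= (bigD1 j)//= [X in _ + X]big1 ?addr0 => [|j' jj'].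
  under eq_bigr do rewrite mulrA; rewrite -mulr_suml -(horner_coef_wide _ (phiEP j).1) (phiEP j).2.
  by rewrite eqxx mul1r.
under eq_bigr do rewrite mulrA; rewrite -mulr_suml -(horner_coef_wide _ (phiEP j).1) (phiEP j).2.
by rewrite eq_sym (negbTE jj') mul0r.
Qed.

End Unisolvence.

(** * Smooth bump functions *)

Section Flat.
Context {R : realType}.
Implicit Types (q : {poly R}) (t : R) (f g : R * R -> R).

Lemma chain_rule (f g : R -> R) t (df dg : R) :
  is_derive t (1 : R) f df -> is_derive (f t) (1 : R) g dg -> is_derive t (1 : R) (g \o f) (dg * df).
Proof.
move=> Df Dg; have [f1 f2] := Df; have [g1 g2] := Dg; split.
  by apply/derivable1_diffP/differentiable_comp; exact/derivable1_diffP.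
by rewrite -derive1E derive1_comp// !derive1E f2 g2.
Qed.

Definition flat q t : R := if 0 < t then q.[t^-1] * expR (- t^-1) else 0.

Lemma powM_expRN_le (t : R) n : 0 <= t -> t ^+ n * expR (- t) <= n`!%:R.
Proof.
move=> t0; rewrite expRN ler_pdivrMr ?expR_gt0//; case: n => [|n].
  by rewrite expr0 fact0 mul1r; apply: le_trans (expR_ge1Dx _); rewrite lerDl.
have := expR_ge1Dxn n t0; rewrite -ler_pdivrMl ?ltr0n ?fact_gt0// mulrC.
by apply: le_trans; rewrite lerDr.
Qed.

Lemma poly_expRN_bounded q : exists C : R, forall t, 0 <= t -> `|q.[t] * expR (- t)| <= C.
Proof.
exists (\sum_(i < size q) `|q`_i| * i`!%:R) => t t0.
rewrite horner_coef mulr_suml; apply: le_trans (ler_norm_sum _ _ _) _.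
apply: ler_sum => i _; rewrite -mulrA normrM ler_wpM2l//.
by rewrite ger0_norm ?powM_expRN_le// mulr_ge0 ?expR_ge0// exprn_ge0.
Qed.

Lemma flat_le_sqr q : exists2 C : R, 0 < C & forall t, `|flat q t| <= C * t ^+ 2.
Proof.
have [C HC] := poly_expRN_bounded ('X^2 * q); exists (`|C| + 1) => [|t]; first by rewrite ltr_wpDl.
rewrite /flat; case: ifP => [t0|_]; last by rewrite normr0 mulr_ge0 ?sqr_ge0// addr_ge0.
have := HC t^-1; rewrite invr_ge0 ltW// => /(_ isT); rewrite hornerM hornerXn -mulrA normrM => H.
rewrite -ler_pdivrMr ?exprn_gt0// mulrC -exprVn.
rewrite [X in X <= _](_ : _ = `|t^-1 ^+ 2| * `|q.[t^-1] * expR (- t^-1)|).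
  by apply: le_trans H _; rewrite (le_trans (ler_norm _))// lerDl.
by rewrite [`|_ ^+ 2|]ger0_norm// sqr_ge0.
Qed.

(** The derivative stays in the family, and the quadratic bound makes it vanish at 0. *)
Lemma is_derive_flat q t : is_derive t (1 : R) (flat q) (flat ('X^2 * (q - q^`())) t).
Proof.
have [t0|t0|->] := ltgtP t 0.
- rewrite [X in is_derive _ _ _ X](_ : _ = 0); last by rewrite /flat ltNge ltW.
  apply: (near_eq_is_derive _ (is_derive_cst (0 : R) t (1 : R))).
  near=> s; rewrite /flat ltNge ltW//; near: s; exact: lt_nbhsl.
- have Dinv : is_derive t (1 : R) (fun s => s^-1) (- t ^- 2).
    have D := is_derive_id t (1 : R); split.
      by apply: derivableV; [exact: lt0r_neq0|exact: derivable_id].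
    by rewrite deriveV ?lt0r_neq0// derive_id /GRing.scale/= mulr1.
  have Dg : is_derive t^-1 (1 : R) (fun s => q.[s] * expR (- s)) ((q^`() - q).[t^-1] * expR (- t^-1)).
    have DN : is_derive t^-1 (1 : R) (fun s => expR (- s)) (- expR (- t^-1)).
      have := chain_rule (is_deriveN (is_derive_id (t^-1) (1 : R))) (is_derive_expR _).
      by move=> H; apply: (is_derive_eq H); rewrite mulrN1.
    have := is_deriveM (is_derive_poly q t^-1) DN.
    move=> H; apply: (is_derive_eq H); rewrite /GRing.scale/= hornerD hornerN.
    by move: (expR _) (q^`().[_]) (q.[_]) => a b c; ring.
  apply: (near_eq_is_derive _ (is_derive_eq (chain_rule Dinv Dg) _)).
    near=> s; rewrite /flat ifT//; near: s; exact: lt_nbhsr.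
  rewrite /flat t0 hornerM hornerXn !hornerD !hornerN -exprVn.
  by move: (expR _) (q^`().[_]) (q.[_]) (t^-1 ^+ 2) => a b c d; ring.
- have [C C0 HC] := flat_le_sqr q.
  rewrite [X in is_derive _ _ _ X](_ : _ = 0); last by rewrite /flat ltxx.
  have H : (fun h : R => h^-1 *: ((flat q \o shift 0) (h *: (1 : R)) - flat q 0)) @ 0^' --> (0 : R).
    apply/cvgrPdist_le => e e0.
    have eC : 0 < e / C by rewrite divr_gt0.
    near=> h; have h0 : h != 0 by near: h; exact: nbhs_dnbhs_neq.
    rewrite /= addr0 sub0r normrN {2}/flat ltxx subr0 normrM normfV.
    rewrite /GRing.scale/= mulr1 ler_pdivrMl ?normr_gt0//.
    apply: le_trans (HC h) _; rewrite -normr_id -real_normK ?num_real// expr2 mulrA mulrC.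
    rewrite normr_id ler_wpM2l// -ler_pdivlMl// mulrC.
    near: h; apply: dnbhs0_le => //.
  by split; [apply/cvg_ex; exists 0|exact: (cvg_lim _ H)].
Unshelve. all: by end_near. Qed.

(** Partial derivatives only see the restriction to a coordinate line. *)
Lemma is_derive_restrict f (y v : R * R) (df : R) :
  is_derive (0 : R) (1 : R) (fun h => f (y + h *: v)) df -> is_derive y v f df.
Proof.
have E : (fun h : R => h^-1 *: (((fun h => f (y + h *: v)) \o shift 0) (h *: (1 : R)) - f (y + 0 *: v))) =
    (fun h => h^-1 *: ((f \o shift y) (h *: v) - f y)).
  apply/funext => h /=; congr (_ *: (f _ - f _)); last by rewrite scale0r addr0.
  by rewrite addr0 addrC [h *: _]mulr1.
by move=> [D1 D2]; split; [move: D1|move: D2]; rewrite /derivable /derive E.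
Qed.

(** A class of smooth functions that contains the polynomials and enough
    functions of bounded support. *)
Inductive elementary : (R * R -> R) -> Prop :=
| elementary_affine (c p q : R) : elementary (affine c p q)
| elementary_flat q (a b c : R) : elementary (flat q \o affine a b c)
| elementaryD f g : elementary f -> elementary g -> elementary (f \+ g)
| elementaryM f g : elementary f -> elementary g -> elementary (f \* g).

Lemma is_derive_flat_affine q a b c (y v : R * R) : is_derive y v (flat q \o affine a b c)
  (flat ('X^2 * (q - q^`())) (affine a b c y) * (b * v.1 + c * v.2)).
Proof.
apply: is_derive_restrict.
have E : (fun h : R => affine a b c (y + h *: v)) = fun h => affine a b c y + h * (b * v.1 + c * v.2).
  by apply/funext => h; rewrite /affine /= /GRing.scale/=; ring.
have D : is_derive (0 : R) (1 : R) (fun h : R => affine a b c (y + h *: v)) (b * v.1 + c * v.2).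
  rewrite E; have := is_deriveD (is_derive_cst (affine a b c y) (0 : R) (1 : R))
    (is_deriveM (is_derive_id (0 : R) (1 : R)) (is_derive_cst (b * v.1 + c * v.2) (0 : R) (1 : R))).
  by move=> H; apply: (is_derive_eq H); rewrite scaler0 !add0r /GRing.scale/= mulr1.
have := chain_rule D (is_derive_flat q _).
by move=> H; apply: (is_derive_eq H); rewrite scale0r addr0.
Qed.

Lemma continuous_flat_affine q a b c : continuous (flat q \o affine a b c).
Proof.
move=> y; apply: continuous_comp; first exact: continuous_affine.
by apply/differentiable_continuous; apply/derivable1_diffP; have [] := is_derive_flat q (affine a b c y).
Qed.

Lemma elementary_cst c : elementary (cst c).
Proof.
rewrite (_ : cst c = affine c 0 0); first exact: elementary_affine.
by apply/funext => y; rewrite /affine !mul0r !addr0.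
Qed.

Lemma elementary_partial f : elementary f -> C1 f /\ forall k, elementary (partial k f).
Proof.
elim=> {f} [c p q|q a b c|f g _ [Cf If] _ [Cg Ig]|f g sf [Cf If] sg [Cg Ig]].
- split=> [|k]; first exact: C1_affine.
  by rewrite partial_affine; exact: elementary_cst.
- have pE k : partial k (flat q \o affine a b c) =
      (flat ('X^2 * (q - q^`())) \o affine a b c) \* cst (if k then c else b).
    apply/funext => y; rewrite /partial (@derive_val _ _ _ _ _ _ _ (is_derive_flat_affine q a b c y (dir k))).
    by case: k => /=; rewrite mulr0 mulr1 ?addr0 ?add0r.
  split=> [|k]; last by rewrite pE; apply: elementaryM; [exact: elementary_flat|exact: elementary_cst].
  split=> [|k]; first exact: continuous_flat_affine.
  split=> y; last by have [] := is_derive_flat_affine q a b c y (dir k).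
  by rewrite pE; apply: cvgM; [exact: continuous_flat_affine|exact: cvg_cst].
- split=> [|k]; first exact: C1D.
  rewrite (_ : partial k _ = partial k f \+ partial k g); first exact: elementaryD.
  by apply/funext => y; exact: partialD.
- split=> [|k]; first exact: C1M.
  rewrite (_ : partial k _ = (f \* partial k g) \+ (g \* partial k f)).
    by apply: elementaryD; exact: elementaryM.
  by apply/funext => y; exact: partialM.
Qed.

Lemma elementary_smooth f : elementary f -> smooth f.
Proof.
move=> ef ks; have H : elementary (foldr partial f ks).
  by elim: ks => //= k ks IH; exact: (elementary_partial IH).2.
by have [[Cf Df] _] := elementary_partial H; split=> // k y; exact: (Df k).2.
Qed.

Lemma elementary_prod (I : Type) (s : seq I) (P : pred I) (F : I -> R * R -> R) :
  (forall i, elementary (F i)) -> elementary (fun y => \prod_(i <- s | P i) F i y).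
Proof.
move=> H; elim: s => [|i s IH].
  by rewrite (_ : (fun y => _) = cst 1); [exact: elementary_cst|apply/funext => y; rewrite big_nil].
case Pi: (P i).
  rewrite (_ : (fun y => _) = F i \* (fun y => \prod_(i <- s | P i) F i y)); first exact: elementaryM.
  by apply/funext => y; rewrite big_cons Pi.
by rewrite (_ : (fun y => _) = (fun y => \prod_(i <- s | P i) F i y))//; apply/funext => y; rewrite big_cons Pi.
Qed.

Lemma elementary_poly k f : poly_deglt k f -> elementary f.
Proof.
move: f; apply: poly_deglt_ind => [|f1 f2 h1 h2|c f1 h|i j _].
- exact: (elementary_cst 0).
- exact: elementaryD.
- exact: (elementaryM (elementary_cst c)).
- rewrite (_ : mono i j = (fun y => \prod_(l < i) affine 0 1 0 y) \* (fun y => \prod_(l < j) affine 0 0 1 y)).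
    by apply: elementaryM; apply: elementary_prod => l; exact: elementary_affine.
  apply/funext => y; rewrite /= !prodr_const !card_ord /affine.
  by rewrite !mul0r !mul1r !add0r addr0.
Qed.

(** The classical step [exp(-1/t)], extended by 0. *)
Definition step : R -> R := flat 1.

Lemma stepE t : step t = if 0 < t then expR (- t^-1) else 0.
Proof. by rewrite /step /flat hornerC mul1r. Qed.

Lemma step_ge0 t : 0 <= step t. Proof. by rewrite stepE; case: ifP => // _; exact: expR_ge0. Qed.

Lemma step_le1 t : step t <= 1.
Proof. by rewrite stepE; case: ifP => // t0; rewrite expR_le1 oppr_le0 invr_ge0 ltW. Qed.

Lemma step_gt0 t : (0 < step t) = (0 < t).
Proof. by rewrite stepE; case: ifP => _; rewrite ?expR_gt0 ?ltxx. Qed.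

Lemma step_eq0 t : (step t == 0) = (t <= 0).
Proof. by rewrite [RHS]leNgt -step_gt0 lt0r step_ge0 andbT negbK. Qed.

Lemma elementary_step a b c : elementary (step \o affine a b c).
Proof. exact: elementary_flat. Qed.

Lemma step_cvg1 (b : R) : 0 < b -> step (n.+1%:R * b - 1) @[n --> \oo] --> (1 : R).
Proof.
move=> b0.
have H : expR (- (n.+1%:R * b - 1)^-1) @[n --> \oo] --> expR (- 0 : R).
  apply: (@cvg_comp _ _ _ (fun n => - (n.+1%:R * b - 1)^-1) _ _ (nbhs (- 0 : R))); last exact: continuous_expR.
  apply: cvgN; apply/cvgrPdist_le => e e0.
  near=> n; have n1 : n.+1%:R * b >= 1 + e^-1.
    rewrite -ler_pdivrMr//; near: n.
    exists (Num.truncn ((1 + e^-1) / b)) => // n /= hn.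
    by apply: ltW; apply: lt_le_trans (truncnS_gt _) _; rewrite ler_nat ltnS.
  have p : 0 < n.+1%:R * b - 1 by rewrite subr_gt0 (lt_le_trans _ n1)// ltrDl invr_gt0.
  rewrite sub0r normrN normfV gtr0_norm// -[leRHS]invrK lef_pV2 ?posrE ?invr_gt0//.
  by rewrite lerBrDl.
move: H; rewrite oppr0 expR0; apply: cvg_trans; apply: near_eq_cvg.
near=> n; rewrite stepE ifT//.
rewrite subr_gt0 -ltr_pdivrMr// div1r; near: n.
exists (Num.truncn b^-1) => // n /= hn.
by apply: lt_le_trans (truncnS_gt _) _; rewrite ler_nat ltnS.
Unshelve. all: by end_near. Qed.

End Flat.

(** * Triangulations *)

Section Triangulation.
Context {R : realType} (m : mesh R) (Omega : set (R * R)).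
Notation MR := (measurableTypeR R).
Notation MP := (measurableTypeR R * measurableTypeR R)%type.
Local Notation V := 'I_(nvtx m).
Local Notation x := (@vtx R m).
Local Notation mu := (@lebesgue_measure R).
Local Notation incident := (@incident R m).
Implicit Types (T S : {set V}) (e : V * V) (u v w : V) (y z : R * R).
Context (trO : triangulation m Omega).

Lemma mesh_nondegenerate T : T \in triangles m -> nondegenerate_triangle T.
Proof. by case: trO => + _ _; exact. Qed.

Lemma common_face T S y v : T \in triangles m -> S \in triangles m -> hull T y -> hull S y ->
  v \notin S -> bary T v y = 0.
Proof.
case: trO => nd conf _ TT SS hT hS vS; have : hull (T :&: S)%SET y by rewrite -conf.
move=> /(hullP y (nd _ TT) (finset.subsetIl T S))[_]; apply.
by rewrite inE (negbTE vS) andbF.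
Qed.

Lemma otri_disjoint T S y : T \in triangles m -> S \in triangles m -> otri T y -> otri S y -> T = S.
Proof.
move=> TT SS yT yS; have ndT := mesh_nondegenerate TT; have ndS := mesh_nondegenerate SS.
have hT := otri_hull ndT yT; have hS := otri_hull ndS yS.
apply/eqP; rewrite eqEcard ndT.1 ndS.1 andbT; apply/fintype.subsetP => v vT.
by apply: contraT => vS; have := yT v vT; rewrite (common_face TT SS hT hS vS) ltxx.
Qed.

Lemma otri_Omega T : T \in triangles m -> otri T `<=` Omega.
Proof.
move=> TT; have ndT := mesh_nondegenerate TT; case: trO => _ _ ->.
rewrite -open_subsetE; last exact: open_otri.
by move=> y /(otri_hull ndT) ?; exists T.
Qed.

Lemma Omega_covered y : Omega y -> exists2 T, T \in triangles m & hull T y.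
Proof. by case: trO => _ _ ->; exact: interior_subset. Qed.

Lemma open_Omega : open Omega.
Proof. by case: trO => _ _ ->; exact: open_interior. Qed.

Lemma measurable_Omega : measurable (Omega : set MP).
Proof. by apply: open_measurable2; exact: open_Omega. Qed.

Lemma measurable_otri T : T \in triangles m -> measurable (otri T : set MP).
Proof. by move=> /mesh_nondegenerate ndT; apply: open_measurable2; exact: open_otri. Qed.

Lemma negligible_finite (I : finType) (P : pred I) (N : I -> set MP) :
  (forall i, P i -> leb2.-negligible (N i)) -> leb2.-negligible [set y | exists2 i, P i & N i y].
Proof.
move=> H; apply: (@negligibleS _ _ _ _ [set y | exists2 i, i \in index_enum I & P i /\ N i y]).
  by move=> y [i Pi Ny]; exists i; rewrite ?mem_index_enum.
elim: (index_enum I) => [|i s IH].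
  by apply: negligibleS (negligible_set0 _) => y [].
have [Pi|Pi] := boolP (P i).
  apply: negligibleS (negligibleU (H _ Pi) IH) => y [j]; rewrite inE => /orP[/eqP -> [_ ?]|js ?]; [by left|].
  by right; exists j.
apply: negligibleS IH => y [j]; rewrite inE => /orP[/eqP -> [/(negP Pi)]//|js ?].
by exists j.
Qed.

Lemma Omega_otri_null : leb2.-negligible (Omega `\` [set y | exists2 T, T \in triangles m & otri T y] : set MP).
Proof.
apply: negligibleS (negligible_finite (P := mem (triangles m)) (N := fun T => hull T `\` otri T) _).
  by move=> y [/Omega_covered[T TT hT] H]; exists T => //; split=> // oT; apply: H; exists T.
by move=> T TT; apply: hull_otri_null; exact: mesh_nondegenerate.
Qed.

Lemma intR2_otri T (f : R * R -> R) : T \in triangles m -> intR2 (otri T) f = intR2 (hull T) f.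
Proof.
move=> /mesh_nondegenerate ndT; apply: (intR2_off_null (hull_otri_null ndT)) => y Ny.
rewrite !patchE; have [hT|hT] := boolP (y \in hull T).
  by rewrite ifT// inE; apply: contra_notP Ny => ?; split=> //; rewrite inE in hT.
by rewrite ifF//; apply: contraNF hT; rewrite !inE; exact: otri_hull.
Qed.

Lemma intR2_agree T (f g : R * R -> R) : agree_on T f g -> intR2 (hull T) f = intR2 (hull T) g.
Proof.
move=> fg; apply: (intR2_off_null (N := ~` [set y | hull T y -> f y = g y])); first exact: fg.
move=> y /contrapT /= H; rewrite !patchE; case: ifP => //; rewrite inE; exact: H.
Qed.

Definition piecewise (q : {set V} -> R * R -> R) : R * R -> R :=
  fun y => \sum_(T in triangles m) (q T \_ (otri T)) y.

Lemma piecewise_on (q : {set V} -> R * R -> R) T y : T \in triangles m -> otri T y -> piecewise q y = q T y.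
Proof.
move=> TT oT; rewrite /piecewise (bigD1 T)//= big1 ?addr0 => [|S /andP[SS ST]].
  by rewrite patchE ifT// inE.
rewrite patchE ifF//; apply: contraNF ST; rewrite inE => oS.
by rewrite (otri_disjoint SS TT oS oT).
Qed.

Lemma piecewise_off (q : {set V} -> R * R -> R) y :
  (forall T, T \in triangles m -> ~ otri T y) -> piecewise q y = 0.
Proof. by move=> H; rewrite /piecewise big1// => T TT; rewrite patchE ifF//; apply/negP; rewrite inE => /H; exact. Qed.

Lemma agree_piecewise (q : {set V} -> R * R -> R) T : T \in triangles m -> agree_on T (piecewise q) (q T).
Proof.
move=> TT; rewrite /agree_on; apply: negligibleS (hull_otri_null (mesh_nondegenerate TT)) => y /=.
by apply: contra_notP => /not_andP H hT; apply: piecewise_on => //; apply: contrapT => oT; case: H.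
Qed.

Lemma integrable_otri_patch (f : R * R -> R) T : T \in triangles m ->
  leb2.-integrable (otri T : set MP) (EFin \o f) -> leb2.-integrable (setT : set MP) (EFin \o (f \_ (otri T))).
Proof.
move=> TT If; rewrite -restrict_EFin; apply/integrable_restrict; rewrite ?setTI//.
exact: measurable_otri.
Qed.

Lemma integrable_piecewise (q : {set V} -> R * R -> R) :
  (forall T, T \in triangles m -> leb2.-integrable (otri T : set MP) (EFin \o q T)) ->
  leb2.-integrable (setT : set MP) (EFin \o piecewise q) /\
  intR2 setT (piecewise q) = \sum_(T in triangles m) intR2 (hull T) (q T).
Proof.
move=> iq; have E T : T \in triangles m -> intR2 (hull T) (q T) = intR2 setT (q T \_ (otri T)).
  by move=> TT; rewrite -intR2_otri// /intR2 Rintegral_mkcond.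
rewrite (eq_bigr _ E) /intR2 /piecewise; elim: (index_enum _) => [|T s [IHi IHe]].
  rewrite big_nil; under [_ \o _]funext do rewrite /= big_nil.
  by split; [exact: integrable0|rewrite /Rintegral; under eq_integral do rewrite big_nil; rewrite integral0].
rewrite big_cons (_ : (fun y => _) = fun y => if T \in triangles m then (q T \_ (otri T)) y +
    \sum_(T <- s | T \in triangles m) (q T \_ (otri T)) y else
    \sum_(T <- s | T \in triangles m) (q T \_ (otri T)) y); last by apply/funext => y; rewrite big_cons.
case: ifP => // TT; have iT := integrable_otri_patch TT (iq T TT).
by split; [exact: (integrableD measurableT iT IHi)|rewrite RintegralD ?IHe].
Qed.

(** The open triangles are disjoint and exhaust the domain up to a null set. *)
Lemma intR2_Omega_pieces (f : R * R -> R) (q : {set V} -> R * R -> R) :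
  (forall T, T \in triangles m -> leb2.-integrable (otri T : set MP) (EFin \o q T)) ->
  (forall T, T \in triangles m -> agree_on T f (q T)) ->
  intR2 Omega f = \sum_(T in triangles m) intR2 (hull T) (q T).
Proof.
move=> iq fq; rewrite -(integrable_piecewise iq).2.
pose N := [set y | exists2 T, T \in triangles m & ~ (hull T y -> f y = q T y)] `|`
  (Omega `\` [set y | exists2 T, T \in triangles m & otri T y]).
apply: (intR2_off_null (N := N)).
  by apply: negligibleU Omega_otri_null; apply: negligible_finite => T; exact: fq.
move=> y /not_orP[N1 N2]; rewrite patch_setT patchE.
have [yO|yO] := boolP (y \in Omega); last first.
  rewrite piecewise_off// => T TT oT; move/negP: yO; apply; rewrite inE; exact: (otri_Omega TT).
have [T TT oT] : exists2 T, T \in triangles m & otri T y.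
  by apply: contra_notP N2 => ?; split=> //; rewrite inE in yO.
rewrite (piecewise_on _ TT oT); apply: contra_notP N1 => E; exists T => //= H; apply: E; apply: H.
exact: (otri_hull (mesh_nondegenerate TT)).
Qed.

Lemma incidentE T e : incident T e -> T \in triangles m /\ (e.1 \in T /\ e.2 \in T).
Proof.
rewrite /incident /Defs.incident => /andP[-> /fintype.subsetP h]; do ?split=> //; apply: h.
all: by rewrite /eset !inE eqxx ?orbT.
Qed.

Lemma incident_third T e : (e.1 < e.2)%N -> incident T e -> exists c, T = [set e.1; e.2; c]%SET.
Proof.
move=> e12 /incidentE[/mesh_nondegenerate[T3 _] [e1 e2]].
have : #|(T :\ e.1 :\ e.2)%SET| == 1%N.
  have ne : e.2 != e.1 by apply: contraTneq e12 => ->; rewrite ltnn.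
  move: T3; rewrite (cardsD1 e.1) e1 (cardsD1 e.2) finset.in_setD1 ne e2 /= => /eqP.
  by rewrite !add1n !eqSS.
move=> /cards1P[c cE]; exists c; apply/setP => v; have := congr1 (fun A : {set V} => v \in A) cE.
rewrite !inE; have [->|] := eqVneq v e.1; first by rewrite e1.
by have [->|] := eqVneq v e.2; rewrite ?e2.
Qed.

Lemma bary_epoint T e (t : R) v : nondegenerate_triangle T -> e.1 \in T -> e.2 \in T ->
  bary T v (epoint e t) = (1 - t) * (v == e.1)%:R + t * (v == e.2)%:R.
Proof.
move=> ndT e1 e2; rewrite -(bary_vertex v ndT e1) -(bary_vertex v ndT e2).
by have [c [p [q ->]]] := bary_affine v ndT; rewrite /affine /epoint /= /GRing.scale/=; ring.
Qed.

Definition midpoint e : R * R := epoint e 2^-1.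

Lemma bary_midpoint T e v : nondegenerate_triangle T -> e.1 \in T -> e.2 \in T ->
  bary T v (midpoint e) = 2^-1 * (v == e.1)%:R + 2^-1 * (v == e.2)%:R.
Proof.
by move=> ndT e1 e2; rewrite bary_epoint// (_ : 1 - 2^-1 = 2^-1)//; field.
Qed.

Lemma bary_near_midpoint T e : nondegenerate_triangle T -> e.1 != e.2 -> e.1 \in T -> e.2 \in T ->
  \forall y \near midpoint e, 0 < bary T e.1 y /\ 0 < bary T e.2 y.
Proof.
move=> ndT ne e1 e2; have h v : v \in [:: e.1; e.2] -> \forall y \near midpoint e, 0 < bary T v y.
  move=> ve; have p : 0 < bary T v (midpoint e).
    rewrite bary_midpoint//; move: ve; rewrite !inE => /orP[] /eqP ->; rewrite eqxx.
      by rewrite (negbTE ne) mulr0 addr0 mulr1 invr_gt0.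
    by rewrite eq_sym (negbTE ne) mulr0 add0r mulr1 invr_gt0.
  exact: (continuous_bary ndT (x := midpoint e) (lt_nbhsr p)).
by apply: filterS2 (h e.1 _) (h e.2 _); rewrite ?inE ?eqxx ?orbT.
Qed.

(** Two triangles on the same side of a common edge would overlap near its
    midpoint. *)
Lemma opposite_sides T S (a b c d : V) : (a < b)%N -> T \in triangles m -> S \in triangles m -> T != S ->
  T = [set a; b; c]%SET -> S = [set a; b; d]%SET ->
  Num.sg (cross (x b - x a) (x c - x a)) = - Num.sg (cross (x b - x a) (x d - x a)).
Proof.
move=> ab TT SS TS TE SE; have ndT := mesh_nondegenerate TT; have ndS := mesh_nondegenerate SS.
have ne : a != b by apply: contraTneq ab => ->; rewrite ltnn.
have [JT [_ bc ac]] := nondegenerate_triple ndT TE; have [JS [_ bd ad]] := nondegenerate_triple ndS SE.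
have cS : c \notin S.
  rewrite SE !inE ![c == _]eq_sym (negbTE ac) (negbTE bc)/=; apply: contraNN TS => /eqP dc.
  by rewrite TE SE dc.
have [aT bT] : a \in T /\ b \in T by rewrite TE !inE !eqxx orbT.
have [aS bS] : a \in S /\ b \in S by rewrite SE !inE !eqxx orbT.
pose z (h : R) := midpoint (a, b) + h *: (x c - x a).
have zc : z h @[h --> (0 : R)] --> midpoint (a, b).
  rewrite -[X in _ --> X](_ : z 0 = _); last by rewrite /z scale0r addr0.
  by apply: cvgD; [exact: cvg_cst|apply: cvgZ; [exact: cvg_id|exact: cvg_cst]].
have [h [h0 [Ta Tb] [Sa Sb]]] : exists h, [/\ 0 < h, 0 < bary T a (z h) /\ 0 < bary T b (z h) &
    0 < bary S a (z h) /\ 0 < bary S b (z h)].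
  have n1 : \forall h \near (0 : R), 0 < bary T a (z h) /\ 0 < bary T b (z h) := zc _ (bary_near_midpoint (e := (a, b)) ndT ne aT bT).
  have n2 : \forall h \near (0 : R), 0 < bary S a (z h) /\ 0 < bary S b (z h) := zc _ (bary_near_midpoint (e := (a, b)) ndS ne aS bS).
  have n3 : \forall h \near (0 : R)^'+, 0 < h by exact: nbhs_right_gt.
  have n12 : \forall h \near (0 : R)^'+, (0 < bary T a (z h) /\ 0 < bary T b (z h)) /\
      (0 < bary S a (z h) /\ 0 < bary S b (z h)).
    by apply: cvg_within; exact: (filterI n1 n2).
  have [h [h0 [h1 h2]]] := filter_ex (filterI n3 n12).
  by exists h.
have cE (X : {set V}) d' : nondegenerate_triangle X -> X = [set a; b; d']%SET ->
    bary X d' (z h) = h * cross (x b - x a) (x c - x a) / cross (x b - x a) (x d' - x a).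
  move=> ndX XE; have [_ _ ->] := bary_bcoord (z h) ndX XE; have [JX _] := nondegenerate_triple ndX XE.
  rewrite /bcoord crossC [cross (x d' - x a) _]crossC invrN mulrNN; congr (_ / _).
  rewrite /z /midpoint /epoint /cross /= /GRing.scale/=.
  by move: (x a) (x b) (x c) => [a1 a2] [b1 b2] [c1 c2] /=; field.
have Tc : 0 < bary T c (z h) by rewrite (cE T c)// mulfK.
have hT : hull T (z h).
  apply/(hull_triP _ ndT) => v; have [|vT] := boolP (v \in T); last by rewrite bary_off.
  by move=> /(in_triple TE)[->|[->|->]]; exact: ltW.
have [sT|sT|/eqP] := ltgtP (cross (x b - x a) (x c - x a)) 0; last by rewrite (negbTE JT).
all: have [sS|sS|/eqP] := ltgtP (cross (x b - x a) (x d - x a)) 0; last by rewrite (negbTE JS).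
2,3: by rewrite ?(gtr0_sg sT) ?(ltr0_sg sT) ?(gtr0_sg sS) ?(ltr0_sg sS) ?opprK.
all: suff hS : hull S (z h) by have := Tc; rewrite (common_face TT SS hT hS cS) ltxx.
all: apply/(hull_triP _ ndS) => v; have [|vS] := boolP (v \in S); last by rewrite bary_off.
all: move=> /(in_triple SE)[->|[->|->]]; try exact: ltW.
all: rewrite (cE S d)// -mulrA mulr_ge0 ?(ltW h0)//.
  by rewrite ltW// nmulr_rgt0// invr_lt0.
by rewrite ltW// divr_gt0.
Unshelve. all: by end_near. Qed.

Lemma bary_third T (a b c : V) y : nondegenerate_triangle T -> T = [set a; b; c]%SET ->
  bary T c y = cross (x b - x a) (y - x a) / cross (x b - x a) (x c - x a).
Proof.
move=> ndT TE; have [_ _ ->] := bary_bcoord y ndT TE.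
by rewrite /bcoord crossC [cross (x c - x a) _]crossC invrN mulrNN.
Qed.

Lemma edge_neq e : (e.1 < e.2)%N -> e.1 != e.2.
Proof. by move=> e12; apply: contraTneq e12 => ->; rewrite ltnn. Qed.

Lemma edge_length_gt0 T e : (e.1 < e.2)%N -> incident T e -> 0 < elength e.
Proof.
case: e => a b e12 iT; have [c TE] := incident_third e12 iT.
exact: (elength_gt0 (mesh_nondegenerate (incidentE iT).1) TE).
Qed.

Lemma outer_normal_opp T S e (f : R * R) : (e.1 < e.2)%N -> incident T e -> incident S e -> T != S ->
  dot f (outer_normal S e) = - dot f (outer_normal T e).
Proof.
move=> e12 iT iS TS; have L := edge_length_gt0 e12 iT.
have [TT _] := incidentE iT; have [SS _] := incidentE iS.
have [c TE] := incident_third e12 iT; have [d SE] := incident_third e12 iS.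
case: e => a b /= in e12 iT iS L TE SE *.
have [_ nT] := outer_normalP (mesh_nondegenerate TT) TE.
have [_ nS] := outer_normalP (mesh_nondegenerate SS) SE.
by apply: (mulIf (lt0r_neq0 L)); rewrite nS mulNr nT (opposite_sides e12 TT SS TS TE SE) mulNr opprK.
Qed.

(** Three pairwise opposite outer normals would vanish. *)
Lemma incident_le2 e : (e.1 < e.2)%N -> (#|[set T | incident T e]%SET| <= 2)%N.
Proof.
move=> e12; rewrite leqNgt; apply/negP => /card_gt2P[T1 [T2 [T3 [[]]]]].
rewrite !inE => i1 i2 i3 [n12 n23 n31].
have [f f0] : exists f, dot f (outer_normal T1 e) != 0.
  exists (outer_normal T1 e); have [c TE] := incident_third e12 i1.
  case: e {n12 n23 n31} => a b /= in e12 i1 i2 i3 TE *.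
  have [[n1 _] _] := outer_normalP (mesh_nondegenerate (incidentE i1).1) TE.
  by rewrite -enorm_sqr n1 expr1n oner_eq0.
move: f0; have h12 := outer_normal_opp f e12 i1 i2 n12; have h23 := outer_normal_opp f e12 i2 i3 n23.
have h31 := outer_normal_opp f e12 i3 i1 n31.
rewrite (_ : dot _ _ = 0) ?eqxx//; lra.
Qed.

Lemma sum_mesh_edges (F : {set V} -> V * V -> R) :
  \sum_(T in triangles m) \sum_(e | tri_edge T e) F T e =
  \sum_(e in interior_edges m) \sum_(T | incident T e) F T e +
  \sum_(e in boundary_edges m) \sum_(T | incident T e) F T e.
Proof.
rewrite (exchange_big_dep (fun e : V * V => (e.1 < e.2)%N))/=; last by move=> T e _ /andP[].
rewrite (bigID (mem (interior_edges m)))/=; congr (_ + _).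
  apply: eq_big => [e|e /andP[e12 _]]; first by rewrite inE andbA andbb.
  by apply: eq_bigl => T; rewrite /tri_edge e12.
rewrite (bigID (mem (boundary_edges m)))/= [X in _ + X]big1 ?addr0.
  apply: eq_big => [e|e /andP[/andP[e12 _] _]]; last first.
    by apply: eq_bigl => T; rewrite /tri_edge e12.
  rewrite !inE; case: ltnP => //= e12; case: eqP => [->|] //=.
move=> e /andP[/andP[e12]]; rewrite !inE e12/= => n2 n1.
have : #|[set T | incident T e]%SET| == 0%N.
  by move: n1 n2 (incident_le2 e12); case: #|_| => [|[|[|]]].
rewrite cards_eq0 => /eqP E0; rewrite big_pred0// => T.
have : T \in [set T | incident T e]%SET = false by rewrite E0 inE.
by rewrite inE /tri_edge e12/=.
Qed.

Lemma interior_edgeP e : e \in interior_edges m -> (e.1 < e.2)%N /\ exists T S,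
  [/\ T != S, incident T e, incident S e, forall X, incident X e -> X = T \/ X = S &
     forall F : {set V} -> R, \sum_(X | incident X e) F X = F T + F S].
Proof.
rewrite inE => /andP[e12 /cards2P[T [S [TS E]]]]; split=> //; exists T, S.
have iE X : incident X e = (X == T) || (X == S).
  have : (X \in [set T | incident T e]%SET) = (X \in [set T; S]%SET) by rewrite E.
  by rewrite !inE.
split=> //; rewrite ?iE ?eqxx ?orbT//.
  by move=> X; rewrite iE => /orP[] /eqP ->; [left|right].
move=> F; rewrite (bigD1 T)/=; last by rewrite iE eqxx.
rewrite (bigD1 S)/=; last by rewrite iE eqxx orbT eq_sym.
by rewrite big1 ?addr0// => X; rewrite iE => /andP[/andP[/orP[] /eqP ->]]; rewrite eqxx.
Qed.

(** The two incident triangles cover a neighbourhood of the midpoint. *)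
Lemma midpoint_Omega e : e \in interior_edges m -> Omega (midpoint e).
Proof.
move=> /interior_edgeP[e12 [T [S [TS iT iS _ _]]]].
have [TT [T1 T2]] := incidentE iT; have [SS [S1 S2]] := incidentE iS.
have ndT := mesh_nondegenerate TT; have ndS := mesh_nondegenerate SS.
have [c TE] := incident_third e12 iT; have [d SE] := incident_third e12 iS.
have [JT _] := nondegenerate_triple ndT TE.
have opp := opposite_sides e12 TT SS TS TE SE.
case: trO => _ _ ->.
apply: filterS2 (bary_near_midpoint ndT (edge_neq e12) T1 T2) (bary_near_midpoint ndS (edge_neq e12) S1 S2).
move=> y [Ta Tb] [Sa Sb].
have cov X c' : nondegenerate_triangle X -> X = [set e.1; e.2; c']%SET -> 0 < bary X e.1 y ->
    0 < bary X e.2 y -> 0 <= bary X c' y -> hull X y.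
  move=> ndX XE Xa Xb Xc; apply/(hull_triP _ ndX) => v.
  have [|vX] := boolP (v \in X); last by rewrite bary_off.
  by move=> /(in_triple XE)[->|[->|->]] //; exact: ltW.
have [Tc|Tc] := leP 0 (bary T c y); first by exists T => //; exact: (cov _ c).
have sgn (J J' k : R) : Num.sg J = - Num.sg J' -> J != 0 -> k / J < 0 -> 0 <= k / J'.
  have [J0|J0|J0] := ltgtP J 0; last by [].
    rewrite (ltr0_sg J0) => /eqP; rewrite eqr_opp eq_sym sgr_cp0 => J'0 _.
    by rewrite nmulr_llt0 ?invr_lt0// => k0; rewrite divr_ge0 ?ltW.
  rewrite (gtr0_sg J0) => /eqP; rewrite eq_sym eqr_oppLR sgr_cp0 => J'0 _.
  by rewrite pmulr_llt0 ?invr_gt0// => k0; rewrite ltW// nmulr_rgt0// invr_lt0.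
exists S => //; apply: (cov _ d) => //; move: opp JT Tc.
rewrite (bary_third y ndT TE) (bary_third y ndS SE); exact: sgn.
Qed.

(** By conformity, a triangle that contains the midpoint has both end points
    among its vertices, and the midpoint lies on no other edge of it. *)
Lemma midpoint_other_edge T S e e' : (e.1 < e.2)%N -> incident T e -> S \in triangles m -> tri_edge S e' ->
  hull (eset e') (midpoint e) -> e' = e.
Proof.
move=> e12 iT SS /andP[e'12 eS'] h; have [TT [T1 T2]] := incidentE iT.
have ndT := mesh_nondegenerate TT; have ndS := mesh_nondegenerate SS.
have mid (X : {set V}) v : nondegenerate_triangle X -> e.1 \in X -> e.2 \in X -> v \in [:: e.1; e.2] ->
    bary X v (midpoint e) = 2^-1.
  move=> ndX X1 X2; rewrite !inE bary_midpoint// => /orP[] /eqP ->; rewrite eqxx.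
    by rewrite (negbTE (edge_neq e12)) mulr0 addr0 mulr1.
  by rewrite eq_sym (negbTE (edge_neq e12)) mulr0 add0r mulr1.
have hS : hull S (midpoint e) by exact: hull_sub h.
have hT : hull T (midpoint e).
  by apply/(hull_triP _ ndT) => v; rewrite bary_midpoint.
have half0 : (2^-1 : R) != 0 by rewrite invr_eq0 pnatr_eq0.
have inS v : v \in [:: e.1; e.2] -> v \in S.
  move=> ve; apply: contraT => vS; have := common_face TT SS hT hS vS.
  by rewrite mid// => /eqP; rewrite (negbTE half0).
have inE' v : v \in [:: e.1; e.2] -> v \in eset e'.
  move=> ve; apply: contraT => ve'; move/(hullP _ ndS eS'): h => [_ /(_ v ve')].
  by rewrite (mid S v ndS _ _ ve) ?inS ?inE ?eqxx ?orbT// => /eqP; rewrite (negbTE half0).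
have := inE' e.1; have := inE' e.2; rewrite /eset !inE !eqxx ?orbT => /(_ isT) h2 /(_ isT) h1.
move: e12 e'12; case: e h1 h2 {iT T1 T2 mid h hS hT inS inE'} => a b; case: e' {eS'} => c d /=.
move=> /orP[] /eqP -> /orP[] /eqP -> //; rewrite ?ltnn// => h1 h2.
by have := ltn_trans h1 h2; rewrite ltnn.
Qed.

Lemma hull_epoint e (t : R) : e.1 != e.2 -> 0 <= t <= 1 -> @hull R m (eset e) (epoint e t).
Proof.
move=> ne /andP[t0 t1]; exists (fun v => (1 - t) * (v == e.1)%:R + t * (v == e.2)%:R); split.
- by move=> v; rewrite addr_ge0// mulr_ge0// subr_ge0.
- by move=> v; rewrite /eset !inE negb_or => /andP[/negbTE -> /negbTE ->]; rewrite !mulr0 addr0.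
- rewrite big_split/= -!mulr_sumr (bigD1 e.1)//= eqxx big1 ?addr0 => [|v /negbTE -> //].
  by rewrite (bigD1 e.2)//= eqxx big1 ?addr0 => [|v /negbTE -> //]; rewrite !mulr1 subrK.
- rewrite /epoint (bigD1 e.1)//= (bigD1 e.2) 1?eq_sym//= big1 ?addr0.
    by rewrite [e.2 == e.1]eq_sym (negbTE ne) !eqxx !mulr0 !mulr1 addr0 add0r.
  by move=> v /andP[/negbTE -> /negbTE ->]; rewrite !mulr0 addr0 scale0r.
Qed.

(** Both are unit vectors orthogonal to the edge. *)
Lemma outer_normal_sign T e n : (e.1 < e.2)%N -> incident T e -> unit_normal (m := m) e n ->
  dot (outer_normal T e) n ^+ 2 = 1 /\
  forall f, dot f (outer_normal T e) = dot (outer_normal T e) n * dot f n.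
Proof.
move=> e12 iT un; have L := edge_length_gt0 e12 iT; have [c TE] := incident_third e12 iT.
have [uo _] : unit_normal (m := m) e (outer_normal T e) /\ True.
  by split=> //; case: e {un L} => a b in e12 iT TE *;
    have [] := outer_normalP (mesh_nondegenerate (incidentE iT).1) TE.
have [k2 kE] := unit_normal_coord L un; have [k2' kE'] := unit_normal_coord L uo.
have L2 : elength e ^+ 2 != 0 :> R by rewrite expf_neq0// lt0r_neq0.
have fE f : dot f (outer_normal T e) = dot (outer_normal T e) n * dot f n.
  apply: (mulIf L2); apply: (mulIf L2); rewrite kE'.
  rewrite (_ : dot (outer_normal T e) n * dot f n * _ * _ = (dot (outer_normal T e) n * elength e ^+ 2) *
    (dot f n * elength e ^+ 2)); last by ring.
  rewrite !kE -{1}k2.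
  by rewrite /cross; ring.
split=> //; have := fE (outer_normal T e); rewrite -enorm_sqr uo.1 expr1n expr2 => <- //.
Qed.

End Triangulation.

(** * Testing the weak divergence on a triangle *)

Section Testing.
Context {R : realType} (m : mesh R) (Omega : set (R * R)).
Notation MR := (measurableTypeR R).
Notation MP := (measurableTypeR R * measurableTypeR R)%type.
Local Notation V := 'I_(nvtx m).
Local Notation x := (@vtx R m).
Local Notation mu := (@lebesgue_measure R).
Local Notation incident := (@incident R m).
Implicit Types (T S : {set V}) (e : V * V) (u v : V) (y z : R * R) (w f : R * R -> R).
Context (trO : triangulation m Omega).

(** On a bounded set, [|f| <= 1 + f^2] is integrable. *)
Lemma L2_integrable (A : set MP) M f : L2 Omega f -> measurable A -> A `<=` Omega -> A `<=` in_box M ->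
  leb2.-integrable A (EFin \o f).
Proof.
move=> [mf f2] mA AO AM.
have mO := measurable_Omega trO.
have mfA : measurable_fun A (f : MP -> MR) by exact: measurable_funS mf.
have i1 : leb2.-integrable A (EFin \o (cst 1 : R * R -> R)).
  by apply: (continuous_integrable2 _ AM mA) => ?; exact: cvg_cst.
have mf2 : measurable_fun (Omega : set MP) (fun y : MP => ((f y) ^+ 2)%:E).
  apply/measurable_EFinP; rewrite (_ : (fun y => _) = (fun y : MP => f y * f y)); last first.
    by apply/funext => y; rewrite expr2.
  exact: measurable_funM.
have i2 : leb2.-integrable A (EFin \o (fun y => f y ^+ 2)).
  apply: (integrableS mO mA AO); apply/integrableP; split=> //.
  by under eq_integral do rewrite /= ger0_norm ?sqr_ge0//.
apply: (le_integrable mA _ _ (integrableD mA i1 i2)); first exact/measurable_EFinP.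
move=> y _; rewrite /= lee_fin [leRHS]ger0_norm ?addr_ge0 ?sqr_ge0//.
rewrite -real_normK ?num_real//; move: `|f y| (normr_ge0 (f y)) => t t0.
have := sqr_ge0 (t - 1); rewrite sqrrB1 => h.
by rewrite (le_trans (y := t *+ 2)) ?mulr2n ?lerDl// -subr_ge0 (le_trans h)// !expr2 mulr2n; lra.
Qed.

Lemma integrableM_continuous (A : set MP) M f w : leb2.-integrable A (EFin \o f) -> continuous w ->
  measurable A -> A `<=` in_box M -> leb2.-integrable A (EFin \o (fun y => f y * w y)).
Proof.
move=> intf cw mA AM; have [B B0 wB] := continuous_bounded_on M cw.
apply: (le_integrable mA _ _ (integrableZl mA B intf)).
  have /integrableP[/measurable_EFinP mf _] := intf.
  by apply/measurable_EFinP; apply: measurable_funM => //; exact: continuous_measurable2.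
move=> y Ay /=; rewrite lee_fin !normrM mulrC (ger0_norm B0) ler_wpM2r// wB//; exact: AM.
Qed.

Lemma otri_box T : T \in triangles m -> exists M, otri T `<=` in_box M.
Proof.
move=> /(mesh_nondegenerate trO) ndT; have [M hM] := hull_box ndT; exists M => y.
by move=> /(otri_hull ndT); exact: hM.
Qed.

Lemma integrable_otri T w : T \in triangles m -> continuous w ->
  leb2.-integrable (otri T : set MP) (EFin \o w).
Proof.
move=> TT cw; have [M hM] := otri_box TT.
by apply: (continuous_integrable2 cw hM); exact: (measurable_otri trO TT).
Qed.

Lemma elementary_test w (K : set (R * R)) M : elementary w -> closed K -> K `<=` in_box M -> K `<=` Omega ->
  (forall y, w y != 0 -> K y) -> test_function Omega w.
Proof.
move=> ew cK KM KO wK; have sK : closure [set y | w y != 0] `<=` K.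
  by move/closure_id: cK => ->; exact: closure_subset.
split; first exact: elementary_smooth.
  apply: (@subclosed_compact _ _ (in_box M)).
  - exact: closed_closure.
  - exact: compact_in_box.
  - exact: subset_trans sK KM.
exact: subset_trans KO.
Qed.

Lemma partial_off k w (K : set (R * R)) y : closed K -> (forall z, w z != 0 -> K z) -> ~ K y ->
  partial k w y = 0.
Proof.
move=> cK wK Ky; rewrite /partial -[RHS](derive_cst (0 : R) y (dir k)).
apply: near_eq_derive; have : nbhs y (~` K) by apply: open_nbhs_nbhs; split=> //; exact: closed_openC.
by apply: filterS => z Kz; apply/eqP; apply: contraT => /wK.
Qed.

(** Smooth cutoffs that exhaust the open triangle. *)
Definition cutoff T (n : nat) y : R := \prod_(v in T) step (n.+1%:R * bary T v y - 1).

Lemma cutoff_ge0_le1 T n y : 0 <= cutoff T n y <= 1.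
Proof. by rewrite prodr_ge0 ?Num.Theory.prodr_ile1// => v _; rewrite step_ge0 ?step_le1. Qed.

Lemma elementary_cutoff T n : nondegenerate_triangle T -> elementary (cutoff T n).
Proof.
move=> ndT; apply: elementary_prod => v; have [c [p [q ->]]] := bary_affine v ndT.
rewrite (_ : (fun y => _) = step \o affine (n.+1%:R * c - 1) (n.+1%:R * p) (n.+1%:R * q)).
  exact: elementary_step.
by apply/funext => y; rewrite /= /affine; congr step; ring.
Qed.

Definition shrunk T (n : nat) : set (R * R) := [set y | forall v, v \in T -> n.+1%:R^-1 <= bary T v y].

Lemma cutoff_shrunk T n y : cutoff T n y != 0 -> shrunk T n y.
Proof.
move=> c0 v vT; have : step (n.+1%:R * bary T v y - 1) != 0.
  by apply: contra_neq c0 => s0; rewrite /cutoff (bigD1 v)//= s0 mul0r.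
by rewrite step_eq0 -ltNge subr_gt0 => h; rewrite -[leLHS]mulr1 ler_pdivrMl ?ltr0n// ltW.
Qed.

Lemma closed_shrunk T n : nondegenerate_triangle T -> closed (shrunk T n).
Proof.
move=> ndT; rewrite (_ : shrunk T n = \bigcap_(v in [set v | v \in T]) (bary T v @^-1` [set t | n.+1%:R^-1 <= t])).
  apply: closed_bigI => v _; apply: preimage_closed; last exact: closed_ge.
  by move=> ? _; exact: continuous_bary.
by apply/seteqP; split=> y h v; exact: h.
Qed.

Lemma shrunk_otri T n : shrunk T n `<=` otri T.
Proof. by move=> y h v vT; apply: lt_le_trans (h v vT); rewrite invr_gt0 ltr0n. Qed.

Lemma cutoff_cvg1 T y : otri T y -> cutoff T n y @[n --> \oo] --> (1 : R).
Proof.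
move=> oT; rewrite /cutoff; elim: (index_enum _) => [|v s IH].
  by under eq_fun do rewrite big_nil; exact: cvg_cst.
have [vT|vT] := boolP (v \in T); last by under eq_fun do rewrite big_cons (negbTE vT).
under eq_fun do rewrite big_cons vT; have H : step (n.+1%:R * bary T v y - 1) *
    \prod_(j <- s | j \in T) step (n.+1%:R * bary T j y - 1) @[n --> \oo] --> (1 * 1 : R).
  by apply: cvgM => //; apply: step_cvg1; exact: oT.
by rewrite mulr1 in H.
Qed.

Lemma test_cutoff T n w : T \in triangles m -> elementary w ->
  test_function Omega (w \* cutoff T n).
Proof.
move=> TT ew; have ndT := mesh_nondegenerate trO TT; have [M hM] := otri_box TT.
apply: (@elementary_test _ (shrunk T n) M).
- by apply: elementaryM => //; exact: elementary_cutoff.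
- exact: closed_shrunk.
- by apply: subset_trans hM; exact: shrunk_otri.
- by apply: (subset_trans (shrunk_otri (n := n))); exact: (otri_Omega trO TT).
- by move=> y /=; rewrite mulf_eq0 negb_or => /andP[_]; exact: cutoff_shrunk.
Qed.

Lemma otri_off_edge T e t : nondegenerate_triangle T -> tri_edge T e -> 0 <= t <= 1 -> ~ otri T (epoint e t).
Proof.
move=> ndT /andP[e12 eT] t01 oT; have /fintype.subsetPn[v vT ve] : ~~ (T \subset eset e).
  by apply/negP => /subset_leq_card; rewrite ndT.1 /eset cards2; case: (_ != _).
have [_ /(_ v ve)] := (hullP _ ndT eT).1 (hull_epoint (edge_neq e12) t01).
by have := oT v vT => /[swap] ->; rewrite ltxx.
Qed.

Lemma int_edge_eq e (f g : R -> R) : (forall t, 0 <= t <= 1 -> f t = g t) ->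
  @int_edge R m e f = int_edge e g.
Proof.
move=> fg; rewrite /int_edge; congr (_ * _); apply: eq_Rintegral => t.
by rewrite inE /= in_itv/=; exact: fg.
Qed.

Lemma int_edge0 e : @int_edge R m e (fun=> 0) = 0.
Proof. by rewrite /int_edge /Rintegral integral0 mulr0. Qed.

Definition div2 (p : R * R -> R * R) y : R :=
  partial false (fun y => (p y).1) y + partial true (fun y => (p y).2) y.

Lemma RT_local_C1 r p : RT_local r p -> [/\ C1 (fun y => (p y).1), C1 (fun y => (p y).2) & continuous (div2 p)].
Proof.
move=> /RT_local_comp[/poly_deglt_C1[c1 _] /poly_deglt_C1[c2 _]]; split=> // y.
by apply: cvgD; [exact: (c1.2 false).1|exact: (c2.2 true).1].
Qed.

Lemma continuous_dot_grad (f1 f2 w : R * R -> R) : continuous f1 -> continuous f2 -> C1 w ->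
  continuous (fun y => dot (f1 y, f2 y) (grad w y)).
Proof.
move=> c1 c2 [_ cw] y; rewrite /dot /=.
by apply: cvgD; apply: cvgM; [exact: c1|exact: (cw false).1|exact: c2|exact: (cw true).1].
Qed.

Section Field.
Context (r : nat) (p : R * R -> R * R) (d : R * R -> R).
Context (pRT : RT m r Omega p) (pd : weak_div Omega p d).

Lemma pieceRTP T : T \in triangles m -> RT_local r (pieceRT r T p) /\ agree_on T p (pieceRT r T p).
Proof.
move=> TT; have [_ /(_ T TT) ex] := pRT.
exact: (@xgetPex _ (cst 0) [set q | RT_local r q /\ agree_on T p q] ex).
Qed.

(** The cutoff vanishes on the boundary of the triangle, so Green's formula has
    no boundary terms. *)
Lemma weak_div_cutoff T n w : T \in triangles m -> elementary w ->
  intR2 (hull T) (fun y => d y * (w y * cutoff T n y)) =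
  intR2 (hull T) (fun y => div2 (pieceRT r T p) y * (w y * cutoff T n y)).
Proof.
move=> TT ew; have ndT := mesh_nondegenerate trO TT.
have [PRT pP] := pieceRTP TT; set P := pieceRT r T p in PRT pP *.
have [c1 c2 _] := RT_local_C1 PRT.
set h := w \* cutoff T n; have th : test_function Omega h := test_cutoff n TT ew.
have eh : elementary h by apply: elementaryM => //; exact: elementary_cutoff.
have [Ch _] := elementary_partial eh.
have hK y : h y != 0 -> shrunk T n y.
  by rewrite mulf_eq0 negb_or => /andP[_]; exact: cutoff_shrunk.
have h0 y : ~ otri T y -> h y = 0.
  by move=> oT; apply/eqP; apply: contra_notT oT => /hK; exact: shrunk_otri.
have grad0 y : ~ otri T y -> grad h y = 0.
  move=> oT; have Ky : ~ shrunk T n y by move=> /shrunk_otri.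
  by rewrite /grad !(partial_off _ (closed_shrunk ndT) hK Ky).
have in_sets y : otri T y -> (y \in Omega) && (y \in hull T).
  by move=> oT; apply/andP; split; apply: mem_set; [exact: (otri_Omega trO TT)|exact: otri_hull].
have := pd.2 h th.
rewrite (_ : intR2 Omega (fun y => d y * h y) = intR2 (hull T) (fun y => d y * h y)); last first.
  apply: (intR2_off_null (negligible_set0 _)) => y _; rewrite !patchE.
  have [/in_sets/andP[-> ->]//|/h0 ->] := pselect (otri T y).
  by rewrite mulr0 !if_same.
rewrite (_ : intR2 Omega _ = intR2 (hull T) (fun y => dot ((P y).1, (P y).2) (grad h y))); last first.
  apply: (intR2_off_null (N := ~` [set y | hull T y -> p y = P y])); first exact: pP.
  move=> y /contrapT /= pPy; rewrite !patchE.
  have [oT|/grad0 ->] := pselect (otri T y); last by rewrite /dot !mulr0 addr0 !if_same.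
  by have /andP[-> ->] := in_sets y oT; rewrite -surjective_pairing pPy//; exact: otri_hull.
rewrite (green_hull ndT Ch c1 c2) big1 ?add0r => [/oppr_inj <-|e eT]; first by [].
rewrite -[RHS](int_edge0 e); apply: int_edge_eq => t t01.
by rewrite h0 ?mul0r//; exact: otri_off_edge.
Qed.

(** The weak divergence is tested against the cutoffs of [w], and the cutoffs
    are then removed by dominated convergence. *)
Lemma weak_div_hull T w : T \in triangles m -> elementary w ->
  intR2 (hull T) (fun y => d y * w y) = intR2 (hull T) (fun y => div2 (pieceRT r T p) y * w y).
Proof.
move=> TT ew; have ndT := mesh_nondegenerate trO TT.
have [PRT _] := pieceRTP TT; have [_ _ cD] := RT_local_C1 PRT.
have [M hM] := otri_box TT; have mT := measurable_otri trO TT.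
have cw : continuous w by exact: C1_continuous (elementary_partial ew).1.
have id : leb2.-integrable (otri T : set MP) (EFin \o d).
  by apply: (L2_integrable pd.1 mT _ hM); exact: otri_Omega.
have iD := integrable_otri TT cD.
have cc n : continuous (cutoff T n).
  exact: C1_continuous (elementary_partial (elementary_cutoff n ndT)).1.
have cwc n : continuous (fun y => w y * cutoff T n y).
  by move=> y; apply: cvgM; [exact: cw|exact: cc].
set D := div2 _ in cD iD *.
have iM (g v : R * R -> R) : leb2.-integrable (otri T : set MP) (EFin \o g) -> continuous v ->
    leb2.-integrable (otri T : set MP) (EFin \o (fun y => g y * v y)).
  by move=> ig cv; exact: integrableM_continuous ig cv mT hM.
have split (v : R * R -> R) : continuous v -> intR2 (otri T) (fun y => (d y - D y) * v y) =
    intR2 (hull T) (fun y => d y * v y) - intR2 (hull T) (fun y => D y * v y).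
  move=> cv; rewrite -!(intR2_otri trO)// /intR2 -RintegralB//; [|exact: iM|exact: iM].
  by apply: eq_Rintegral => y _; rewrite mulrBl.
have ih : leb2.-integrable (otri T : set MP) (EFin \o (fun y => d y - D y)).
  by apply: eq_integrable (integrableB mT id iD).
apply/eqP; rewrite -subr_eq0 -split//; apply/eqP.
have mf g : leb2.-integrable (otri T : set MP) (EFin \o g) -> measurable_fun (otri T : set MP) (EFin \o g).
  by move=> /integrableP[].
pose f_ n : MP -> \bar R := EFin \o (fun y => (d y - D y) * (w y * cutoff T n y)).
pose f : MP -> \bar R := EFin \o (fun y => (d y - D y) * w y).
have lim_f : {ae leb2, forall y, otri T y -> f_ ^~ y @ \oo --> f y}.
  apply: aeW => y oT /=; apply: cvg_EFin; first by near=> n.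
  have H : (d y - D y) * w y * cutoff T n y @[n --> \oo] --> ((d y - D y) * w y * 1 : R).
    by apply: cvgM; [exact: cvg_cst|exact: cutoff_cvg1].
  rewrite mulr1 in H; apply: cvg_trans H; apply: near_eq_cvg; near=> n.
  by rewrite /f_ /= mulrA.
have dom_f : {ae leb2, forall y n, otri T y -> (`|f_ n y| <= `|f y|)%E}.
  apply: aeW => y n _ /=; rewrite lee_fin mulrA normrM ler_piMr//.
  by have /andP[c0 c1] := cutoff_ge0_le1 T n y; rewrite ger0_norm.
have [_ _] := dominated_convergence mT (fun n => mf _ (iM _ _ ih (cwc n))) (mf _ (iM _ _ ih cw)) lim_f
  (integrable_abse (iM _ _ ih cw)) dom_f.
rewrite (_ : [sequence _]_n = cst 0%E); last first.
  apply/funext => n /=; have := split _ (cwc n); rewrite weak_div_cutoff// subrr.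
  rewrite /intR2 /Rintegral => H; rewrite -[LHS]fineK; first by rewrite H.
  exact: (integrable_fin_num mT (iM _ _ ih (cwc n))).
move=> H; rewrite /intR2 /Rintegral.
suff -> : (\int[leb2]_(y in otri T) ((d y - D y) * w y)%:E = 0)%E by [].
apply: (cvg_unique _ H (cvg_cst (0%E : \bar R))); exact: ereal_hausdorff.
Unshelve. all: by end_near. Qed.

End Field.
End Testing.

(** * Continuity of normal traces *)

Section Traces.
Context {R : realType} (m : mesh R) (Omega : set (R * R)).
Notation MR := (measurableTypeR R).
Notation MP := (measurableTypeR R * measurableTypeR R)%type.
Local Notation V := 'I_(nvtx m).
Local Notation x := (@vtx R m).
Local Notation mu := (@lebesgue_measure R).
Local Notation incident := (@incident R m).
Implicit Types (T S : {set V}) (e : V * V) (u v : V) (y z : R * R) (w f : R * R -> R).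
Context (trO : triangulation m Omega).

Lemma horner_eq0_near (q : {poly R}) (t0 : R) : (\forall t \near t0, q.[t] = 0) -> q = 0.
Proof.
move=> /nbhs_ballP[del /= d0 H]; apply/eqP; apply: contraT => qn0.
pose rt k : R := t0 + del / k.+2%:R.
have := max_poly_roots (rs := [seq rt k | k <- iota 0 (size q)]) qn0.
rewrite size_map size_iota ltnn => -> //.
  apply/allP => t /mapP[k _ ->]; rewrite rootE H// /ball/= /rt opprD addrA subrr sub0r normrN.
  rewrite gtr0_norm ?divr_gt0 ?ltr0n// ltr_pdivrMr ?ltr0n// ltr_pMr// ltr1n//.
rewrite map_inj_uniq ?iota_uniq// => k l /addrI /(mulfI (lt0r_neq0 d0)) /invr_inj /eqP.
by rewrite eqr_nat => /eqP[].
Qed.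

(** A bump of small support around a point. *)
Lemma bump_near z (P : set (R * R)) : (\forall y \near z, P y) -> exists b : R * R -> R,
  [/\ elementary b, forall y, 0 <= b y, 0 < b z & exists K M,
    [/\ closed K, K `<=` in_box M, K `<=` P & forall y, b y != 0 -> K y]].
Proof.
move=> /nbhs_ballP[del /= d0 H]; pose h : R := del / 2; have h0 : 0 < h by rewrite divr_gt0.
pose A : seq (R * R -> R) := [:: affine (h - z.1) 1 0; affine (h + z.1) (-1) 0;
   affine (h - z.2) 0 1; affine (h + z.2) 0 (-1)].
pose b y := \prod_(a <- A) step (a y).
have bE y : b y = step (affine (h - z.1) 1 0 y) * step (affine (h + z.1) (-1) 0 y) *
    step (affine (h - z.2) 0 1 y) * step (affine (h + z.2) 0 (-1) y).
  by rewrite /b /A !big_cons big_nil mulr1 !mulrA.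
pose K : set (R * R) := [set y | [/\ 0 <= affine (h - z.1) 1 0 y, 0 <= affine (h + z.1) (-1) 0 y,
  0 <= affine (h - z.2) 0 1 y & 0 <= affine (h + z.2) 0 (-1) y]].
have KE y : K y <-> `|y.1 - z.1| <= h /\ `|y.2 - z.2| <= h.
  rewrite /K /affine /= !ler_norml; split; first by move=> [? ? ? ?]; split; apply/andP; split; lra.
  by move=> [/andP[? ?] /andP[? ?]]; split; lra.
exists b; split.
- rewrite (_ : b = (step \o affine (h - z.1) 1 0) \* (step \o affine (h + z.1) (-1) 0) \*
    (step \o affine (h - z.2) 0 1) \* (step \o affine (h + z.2) 0 (-1))); last by apply/funext => y; rewrite bE.
  by do 3 (apply: elementaryM; last exact: elementary_step); exact: elementary_step.
- by move=> y; apply: prodr_ge0 => a _; exact: step_ge0.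
- by rewrite bE /affine !mulr_gt0// step_gt0; lra.
- exists K, (`|z.1| + `|z.2| + h); split.
  + rewrite (_ : K = ([set y | 0 <= affine (h - z.1) 1 0 y] `&` [set y | 0 <= affine (h + z.1) (-1) 0 y]) `&`
      ([set y | 0 <= affine (h - z.2) 0 1 y] `&` [set y | 0 <= affine (h + z.2) 0 (-1) y])).
      by apply: closedI; apply: closedI; exact: closed_affine.
    by apply/seteqP; split=> y /=; [move=> []|move=> [[? ?] [? ?]]].
  + move=> y /KE[k1 k2]; split.
      rewrite -(subrK z.1 y.1) (le_trans (ler_normD _ _))// addrC -addrA lerD// ler_wpDl//.
    rewrite -(subrK z.2 y.2) (le_trans (ler_normD _ _))// addrC [leRHS]addrAC [leRHS]addrC.
    by rewrite lerD// ler_wpDl.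
  + move=> y /KE[k1 k2]; apply: H; split; rewrite /ball/= distrC; [apply: le_lt_trans k1 _|apply: le_lt_trans k2 _].
      by rewrite /h; lra.
    by rewrite /h; lra.
  + move=> y; rewrite bE !mulf_eq0 !negb_or !step_eq0 -!ltNge => /andP[/andP[/andP[? ?] ?] ?].
    by split; exact: ltW.
Qed.

Lemma closed_face T S : nondegenerate_triangle T -> S \subset T -> closed (hull S).
Proof.
move=> ndT ST; rewrite (_ : hull S = hull T `&` \bigcap_(v in [set v | v \notin S]) (bary T v @^-1` [set 0])).
  apply: closedI; first exact: closed_hull.
  apply: closed_bigI => v _; apply: preimage_closed; last exact: closed_eq.
  by move=> ? _; exact: continuous_bary.
apply/seteqP; split=> y; first by move=> /(hullP y ndT ST)[b0 bS]; split; [apply/(hull_triP y ndT)|exact: bS].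
by move=> [/(hull_triP y ndT) b0 bS]; apply/(hullP y ndT ST); split=> // v vS; exact: bS.
Qed.

(** The other edges are finitely many closed sets that avoid the midpoint. *)
Lemma near_midpoint_edge e : e \in interior_edges m -> \forall y \near midpoint e, Omega y /\
  forall S e', S \in triangles m -> tri_edge S e' -> hull (eset e') y -> e' = e.
Proof.
move=> eI; have [e12 [T [_ [_ iT _ _ _]]]] := interior_edgeP eI.
have nO : \forall y \near midpoint e, Omega y.
  by apply: open_nbhs_nbhs; split; [exact: open_Omega trO|exact: midpoint_Omega].
have nE (i : {set V} * (V * V)) : \forall y \near midpoint e, i.1 \in triangles m -> tri_edge i.1 i.2 ->
    hull (eset i.2) y -> i.2 = e.
  case: i => S e' /=.
  have [SS|SS] := boolP (S \in triangles m); last by apply: filterE => y.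
  have [eS|eS] := boolP (tri_edge S e'); last by apply: filterE => y.
  have [->|e'e] := eqVneq e' e; first by apply: filterE.
  have : nbhs (midpoint e) (~` hull (eset e')).
    apply: open_nbhs_nbhs; split.
      by apply: closed_openC; have /andP[_ ?] := eS; apply: (closed_face (mesh_nondegenerate trO SS)).
    by move=> /(midpoint_other_edge trO e12 iT SS eS)/eqP; rewrite (negbTE e'e).
  by apply: filterS => y hy _ _ /hy.
have nE' := @filter_forall _ _ _ (nbhs (midpoint e)) (nbhs_filter _) nE.
by apply: filterS2 nO nE' => y Oy H; split=> // S e' SS eS; exact: (H (S, e')).
Qed.

Section Field.
Context (r : nat) (p : R * R -> R * R).
Context (pRT : RT m r Omega p).
Local Notation P := (fun T => pieceRT r T p).
Local Notation d := (divergence Omega p).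

Lemma divergenceP : weak_div Omega p d.
Proof.
have [[_ _ ex] _] := pRT.
exact: (@xgetPex _ (cst 0) [set d | weak_div Omega p d] ex).
Qed.

(** Summing Green's formula over the triangles, the volume terms cancel by the
    definition of the weak divergence and [weak_div_hull]. *)
Lemma flux_cancel w : test_function Omega w -> elementary w ->
  \sum_(T in triangles m) \sum_(e | tri_edge T e)
    int_edge e (fun t => w (epoint e t) * dot (P T (epoint e t)) (outer_normal T e)) = 0.
Proof.
move=> tw ew; have [Cw _] := elementary_partial ew; have cw := C1_continuous Cw.
have := (divergenceP).2 w tw.
rewrite (intR2_Omega_pieces trO (q := fun T y => dot ((P T y).1, (P T y).2) (grad w y))); first last.
- move=> T TT; have [_ pP] := pieceRTP pRT TT; move: pP; rewrite /agree_on.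
  by apply: negligibleS => y /=; apply: contra_not => pPy hy; rewrite pPy// -surjective_pairing.
- move=> T TT; have [PRT _] := pieceRTP pRT TT; have [c1 c2 _] := RT_local_C1 PRT.
  by apply: (integrable_otri trO TT); apply: continuous_dot_grad => //; exact: C1_continuous.
rewrite (intR2_Omega_pieces trO (q := fun T y => d y * w y)); first last.
- by move=> T TT; apply: aeW.
- move=> T TT; have [M hM] := otri_box trO TT; have mT := measurable_otri trO TT.
  apply: (integrableM_continuous _ cw mT hM).
  by apply: (L2_integrable trO (divergenceP).1 mT _ hM); exact: (otri_Omega trO TT).
move/eqP; rewrite -subr_eq0 opprK -big_split/= => /eqP H; rewrite -[RHS]H; apply: eq_bigr => T TT.
have [PRT _] := pieceRTP pRT TT; have [c1 c2 _] := RT_local_C1 PRT.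
rewrite (weak_div_hull trO pRT divergenceP TT ew).
rewrite (green_hull (mesh_nondegenerate trO TT) Cw c1 c2) subrK.
by apply: eq_bigr => e _; apply: int_edge_eq => t _; rewrite -surjective_pairing.
Qed.

(** Testing with the jump of the normal traces itself, localized at the
    midpoint, shows that this jump vanishes. *)
Lemma normal_traces_opp e T S (t : R) : e \in interior_edges m -> T != S -> incident T e -> incident S e ->
  dot (P T (epoint e t)) (outer_normal T e) = - dot (P S (epoint e t)) (outer_normal S e).
Proof.
move=> eI TS iT iS; have [e12 [T' [S' [TS' iT' iS' only sumE]]]] := interior_edgeP eI.
have sumTS (F : {set V} -> R) : \sum_(X | incident X e) F X = F T + F S.
  rewrite sumE; move: TS.
  by case: (only T iT) => ->; case: (only S iS) => ->; rewrite ?eqxx// addrC.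
have [TT _] := incidentE iT; have [SS _] := incidentE iS.
pose G y := dot (P T y) (outer_normal T e) + dot (P S y) (outer_normal S e).
have kG : poly_deglt r.+2 G.
  have [/RT_local_comp[k1 k2] _] := pieceRTP pRT TT; have [/RT_local_comp[k3 k4] _] := pieceRTP pRT SS.
  rewrite (_ : G = fun y => ((outer_normal T e).1 * (P T y).1 + (outer_normal T e).2 * (P T y).2) +
    ((outer_normal S e).1 * (P S y).1 + (outer_normal S e).2 * (P S y).2)).
    by apply: poly_degltD; apply: poly_degltD; exact: poly_degltZ.
  by apply/funext => y; rewrite /G /dot; ring.
have cG := poly_deglt_continuous kG.
have [b [eb b0 bm [K [M [cK KM KP bK]]]]] := bump_near (near_midpoint_edge eI).
have cb := C1_continuous (elementary_partial eb).1.
pose w := b \* G; have ew : elementary w by apply: elementaryM => //; exact: elementary_poly kG.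
have tw : test_function Omega w.
  apply: (elementary_test (M := M) ew cK KM) => [y /KP[]//|y].
  by rewrite mulf_eq0 negb_or => /andP[/bK].
have cbe : continuous (fun s : R => b (epoint e s)) by exact: (@continuous_segment _ _ (x e.1) (x e.2) cb).
have cGe : continuous (fun s : R => G (epoint e s)) by exact: (@continuous_segment _ _ (x e.1) (x e.2) cG).
have cN X : X \in triangles m -> continuous (fun s : R => dot (P X (epoint e s)) (outer_normal X e)).
  move=> XX; have [/RT_local_C1[c1 c2 _] _] := pieceRTP pRT XX.
  move=> s; rewrite /dot; apply: cvgD; apply: cvgM; try exact: cvg_cst.
    exact: (@continuous_segment _ _ (x e.1) (x e.2) (C1_continuous c1)).
  exact: (@continuous_segment _ _ (x e.1) (x e.2) (C1_continuous c2)).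
have Int0 : \int[mu]_(s in `[0, 1]) (b (epoint e s) * G (epoint e s) ^+ 2) = 0.
  have := flux_cancel tw ew.
  have E X : X \in triangles m -> \sum_(e' | tri_edge X e')
      int_edge e' (fun t => w (epoint e' t) * dot (P X (epoint e' t)) (outer_normal X e')) =
      if incident X e then int_edge e (fun t => w (epoint e t) * dot (P X (epoint e t)) (outer_normal X e)) else 0.
    move=> XX; have z e' : tri_edge X e' -> e' != e ->
       int_edge e' (fun t => w (epoint e' t) * dot (P X (epoint e' t)) (outer_normal X e')) = 0.
      move=> eX e'e; rewrite -[RHS](int_edge0 e'); apply: int_edge_eq => s s01.
      rewrite (_ : w _ = 0) ?mul0r//; apply/eqP; apply: contraNT e'e.
      rewrite mulf_eq0 negb_or => /andP[/bK/KP[_ /(_ X e' XX eX) H] _]; apply/eqP; apply: H.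
      by apply: hull_epoint => //; apply: edge_neq; have /andP[] := eX.
    case: ifP => iX; last first.
      by apply: big1 => e' eX; apply: z => //; apply: contraFneq iX => <-; rewrite /Defs.incident XX; have /andP[] := eX.
    rewrite (bigD1 e)/=; last by rewrite /tri_edge e12; have /andP[] := iX.
    by rewrite big1 ?addr0// => e' /andP[eX e'e]; exact: z.
  rewrite (eq_bigr _ E) -big_mkcondr /= (eq_bigl (fun X => incident X e)); last first.
    by move=> X; rewrite /Defs.incident; case: (X \in triangles m).
  rewrite sumTS /int_edge -mulrDr => /eqP; rewrite mulf_eq0 (gt_eqF (edge_length_gt0 trO e12 iT))/=.
  have cwe : continuous (fun s : R => w (epoint e s)).
    by move=> s; apply: cvgM; [exact: cbe|exact: cGe].
  rewrite -integral01D; first last.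
  - by move=> s; apply: cvgM; [exact: cwe|exact: cN].
  - by move=> s; apply: cvgM; [exact: cwe|exact: cN].
  move=> /eqP H; rewrite -[RHS]H; apply: eq_integral01 => s; rewrite -mulrDr -/(G (epoint e s)) /w/= -mulrA expr2.
  by [].
have zero : forall s : R, 0 < s < 1 -> b (epoint e s) * G (epoint e s) ^+ 2 = 0.
  apply: continuous_integral01_eq0 Int0.
    by move=> s; apply: cvgM; [exact: cbe|under eq_fun do rewrite expr2; apply: cvgM; exact: cGe].
  by move=> s; rewrite mulr_ge0 ?sqr_ge0.
have [q _ qE] := poly_epoint e kG.
have q0 : q = 0.
  apply: (horner_eq0_near (t0 := 2^-1)).
  have n1 : \forall s \near (2^-1 : R), 0 < b (epoint e s) := cbe 2^-1 _ (lt_nbhsr bm).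
  have n2 : \forall s \near (2^-1 : R), 0 < s by apply: lt_nbhsr; rewrite invr_gt0.
  have n3 : \forall s \near (2^-1 : R), s < 1 by apply: lt_nbhsl; rewrite invf_lt1// ltr1n.
  apply: filterS3 n1 n2 n3 => s b1 s0 s1; have := zero s; rewrite s0 s1 => /(_ isT)/eqP.
  by rewrite mulf_eq0 (gt_eqF b1)/= sqrf_eq0 qE => /eqP.
by apply/eqP; rewrite -addr_eq0 -/(G (epoint e t)) qE q0 horner0.
Qed.

End Field.
End Traces.

(** * The duality identity *)

Section Duality.
Context {R : realType} (m : mesh R) (Omega : set (R * R)).
Notation MR := (measurableTypeR R).
Notation MP := (measurableTypeR R * measurableTypeR R)%type.
Local Notation V := 'I_(nvtx m).
Local Notation x := (@vtx R m).
Local Notation mu := (@lebesgue_measure R).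
Local Notation incident := (@incident R m).
Implicit Types (T S : {set V}) (e : V * V) (u v : V) (y z : R * R) (w f : R * R -> R).
Context (trO : triangulation m Omega).

Lemma dotC (a b : R * R) : dot a b = dot b a.
Proof. by rewrite /dot [a.1 * _]mulrC [a.2 * _]mulrC. Qed.

Lemma intR2_hull_sum_in T (I : finType) (Q : pred I) (c : I -> R) (f : I -> R * R -> R) :
  nondegenerate_triangle T -> (forall i, Q i -> continuous (f i)) ->
  intR2 (hull T) (fun y => \sum_(i | Q i) c i * f i y) = \sum_(i | Q i) c i * intR2 (hull T) (f i).
Proof.
move=> ndT cf; have cf' i : continuous (if Q i then f i else cst 0).
  by case: ifP => [/cf//|_ y]; exact: cvg_cst.
transitivity (\sum_i (if Q i then c i else 0) * intR2 (hull T) (if Q i then f i else cst 0)).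
  rewrite -intR2_hull_sum//; congr intR2; apply/funext => y; rewrite big_mkcond/=.
  by apply: eq_bigr => i _; case: ifP; rewrite ?mul0r.
by rewrite [RHS]big_mkcond/=; apply: eq_bigr => i _; case: ifP; rewrite ?mul0r.
Qed.

Lemma int_edge_sum e (I : finType) (c : I -> R) (f : I -> R -> R) : (forall i, continuous (f i)) ->
  @int_edge R m e (fun t => \sum_i c i * f i t) = \sum_i c i * int_edge e (f i).
Proof.
move=> cf; rewrite /int_edge integral01_sum// mulr_sumr.
by apply: eq_bigr => i _; rewrite mulrCA.
Qed.

Lemma continuous_dot_trace r (p : R * R -> R * R) e n : RT_local r p ->
  continuous (fun t => dot (p (@epoint R m e t)) n).
Proof.
move=> /RT_local_C1[c1 c2 _] t; rewrite /dot; apply: cvgD; apply: cvgM; try exact: cvg_cst.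
  exact: (@continuous_segment _ _ (x e.1) (x e.2) (C1_continuous c1)).
exact: (@continuous_segment _ _ (x e.1) (x e.2) (C1_continuous c2)).
Qed.

Section Fixed.
Context (r : nat) (p : R * R -> R * R) (pRT : RT m r Omega p).
Local Notation P := (fun T => pieceRT r T p).

(** The trace is well defined: the fluxes out of the two triangles cancel, and
    so do their outer normals. *)
Lemma normal_traceP e n T (t : R) : e \in interior_edges m -> unit_normal (m := m) e n -> incident T e ->
  0 <= t <= 1 -> normal_trace r p e n t = dot (P T (epoint e t)) n.
Proof.
move=> eI un; have [e12 [A [B [AB iA iB only _]]]] := interior_edgeP eI.
have E s : dot (P B (epoint e s)) n = dot (P A (epoint e s)) n.
  have [kA fA] := outer_normal_sign trO e12 iA un; have [kB fB] := outer_normal_sign trO e12 iB un.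
  have := normal_traces_opp trO pRT s eI AB iA iB; rewrite fA fB.
  have -> : dot (outer_normal B e) n = - dot (outer_normal A e) n.
    by rewrite !(dotC _ n) (outer_normal_opp trO n e12 iA iB AB).
  move=> /eqP; rewrite mulNr opprK -subr_eq0 -mulrBr mulf_eq0 -sqrf_eq0 kA oner_eq0/= subr_eq0.
  by move=> /eqP.
have ex : [set g : R -> R | forall T, incident T e ->
    forall t, 0 <= t <= 1 -> g t = dot (P T (epoint e t)) n] !=set0.
  by exists (fun t => dot (P A (epoint e t)) n) => X /only[->|->] s _ //; rewrite E.
move=> iT t01; have := @xgetPex _ (cst 0) _ ex; rewrite -/(normal_trace r p e n) /=.
by apply.
Qed.

Lemma sigmaT_piece T (i : {ffun V -> 'I_r}) : T \in triangles m ->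
  sigmaT p T i = (intR2 (hull T) (fun y => phiT T i y * (P T y).1), intR2 (hull T) (fun y => phiT T i y * (P T y).2)).
Proof.
move=> TT; have [_ pP] := pieceRTP pRT TT; congr pair; apply: intR2_agree => //;
  by move: pP; apply: negligibleS => y /=; apply: contra_not => pPy hy; rewrite pPy.
Qed.

Section Scalar.
Context (u : R * R -> R) (uDG : DG m r Omega u).
Local Notation U := (fun T => pieceDG r T u).

Lemma pieceDGP T : T \in triangles m -> poly_deglt r.+1 (U T) /\ agree_on T u (U T).
Proof.
move=> TT; have [_ /(_ T TT) ex] := uDG.
exact: (@xgetPex _ (cst 0) [set q | poly_deglt r.+1 q /\ agree_on T u q] ex).
Qed.

Lemma jump_poly e n : exists2 q : {poly R}, (size q <= r.+1)%N & forall t, jump r u e n t = q.[t].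
Proof.
rewrite /jump; elim: (index_enum _) => [|T s [q qs qE]].
  by exists 0; rewrite ?size_poly0// => t; rewrite big_nil horner0.
case iT: (incident T e); last by exists q => // t; rewrite big_cons iT qE.
have [k _] := pieceDGP (incidentE iT).1; have [q' qs' qE'] := poly_epoint e k.
exists (dot (outer_normal T e) n *: q' + q) => [|t].
  by rewrite (leq_trans (size_polyD _ _))// geq_max qs (leq_trans (size_scale_leq _ _)).
by rewrite big_cons iT qE hornerD hornerZ -qE' mulrC.
Qed.

(** The jump has degree at most [r], so it equals its interpolant. *)
Lemma edge_duality e n : e \in interior_edges m -> unit_normal (m := m) e n ->
  \sum_(T | incident T e) int_edge e (fun t => U T (epoint e t) * dot (P T (epoint e t)) (outer_normal T e)) =
  \sum_(j < r.+1) jump r u e n (nodeE j) * sigmaE p e n j.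
Proof.
move=> eI un; have [e12 [A [B [AB iA iB only sumE]]]] := interior_edgeP eI.
have [PA _] := pieceRTP pRT (incidentE iA).1.
pose g t := dot (P A (epoint e t)) n; have cg : continuous g by exact: continuous_dot_trace PA.
have [q qs qE] := jump_poly e n.
have F T : incident T e -> int_edge e (fun t => U T (epoint e t) * dot (P T (epoint e t)) (outer_normal T e)) =
    int_edge e (fun t => (U T (epoint e t) * dot (outer_normal T e) n) * g t).
  move=> iT; have [_ fT] := outer_normal_sign trO e12 iT un; apply: int_edge_eq => t t01.
  by rewrite fT mulrA -normal_traceP// /g -(normal_traceP eI un iA).
have cU T : incident T e -> continuous (fun t : R => (U T (epoint e t) * dot (outer_normal T e) n) * g t).
  move=> iT t; apply: cvgM; last exact: cg.
  apply: cvgM; last exact: cvg_cst.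
  have [kU _] := pieceDGP (incidentE iT).1.
  exact: (@continuous_segment _ _ (x e.1) (x e.2) (poly_deglt_continuous kU)).
transitivity (int_edge e (fun t => jump r u e n t * g t)).
  rewrite sumE !F// /int_edge -mulrDr -integral01D; [|exact: cU|exact: cU].
  by congr (_ * _); apply: eq_integral01 => t; rewrite /jump sumE mulrDl.
have -> : (fun t => jump r u e n t * g t) = fun t => \sum_(j < r.+1) jump r u e n (nodeE j) * ((phiE j).[t] * g t).
  apply/funext => t; rewrite qE (phiE_interp _ qs) mulr_suml; apply: eq_bigr => j _.
  by rewrite qE mulrA.
rewrite int_edge_sum => [|j t]; last by apply: cvgM; [exact: continuous_horner|exact: cg].
apply: eq_bigr => j _; congr (_ * _); apply: int_edge_eq => t t01.
by rewrite (normal_traceP eI un iA).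
Qed.

(** The partial derivatives of a piece have degree less than [r], so they equal
    their interpolants. *)
Lemma triangle_duality T : T \in triangles m ->
  intR2 (hull T) (fun y => dot ((P T y).1, (P T y).2) (grad (U T) y)) =
  \sum_(i in lattice r T) dot (grad (U T) (nodeT T i)) (sigmaT p T i).
Proof.
move=> TT; have ndT := mesh_nondegenerate trO TT.
have [kU _] := pieceDGP TT; have [_ kd] := poly_deglt_C1 kU.
have [/RT_local_comp[/poly_deglt_continuous c1 /poly_deglt_continuous c2] _] := pieceRTP pRT TT.
have cphi i : i \in lattice r T -> continuous (phiT T i).
  by move=> iL; apply: poly_deglt_continuous; exact: (poly_deglt_phiT ndT iL).
have ck (k : bool) (i : {ffun V -> 'I_r}) : i \in lattice r T ->
    continuous (fun y => phiT T i y * (if k then (P T y).2 else (P T y).1)).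
  by move=> iL y; apply: cvgM; [exact: cphi|case: k; [exact: c2|exact: c1]].
have E k : intR2 (hull T) (fun y => (if k then (P T y).2 else (P T y).1) * partial k (U T) y) =
    \sum_(i in lattice r T) partial k (U T) (nodeT T i) *
      intR2 (hull T) (fun y => phiT T i y * (if k then (P T y).2 else (P T y).1)).
  rewrite -(intR2_hull_sum_in (fun i => partial k (U T) (nodeT T i)) ndT (fun i => @ck k i)).
  congr intR2; apply/funext => y; rewrite {1}(phiT_interp y ndT (kd k)) mulr_sumr.
  by apply: eq_bigr => i _; ring.
rewrite (_ : intR2 _ _ = intR2 (hull T) (fun y => (P T y).1 * partial false (U T) y) +
    intR2 (hull T) (fun y => (P T y).2 * partial true (U T) y)).
  rewrite (E false) (E true) -big_split/=; apply: eq_bigr => i _.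
  by rewrite sigmaT_piece.
have cd k := poly_deglt_continuous (kd k).
rewrite /intR2 -RintegralD//; first exact: measurable_hull.
  by apply: (integrable_hull ndT) => y; apply: cvgM; [exact: c1|exact: cd].
by apply: (integrable_hull ndT) => y; apply: cvgM; [exact: c2|exact: cd].
Qed.

End Scalar.
End Fixed.

(** Integration by parts on every triangle; the integrands are polynomials of
    the degree that the interpolation operators reproduce, so both kinds of
    terms are exactly expressed by the degrees of freedom. *)
Lemma duality_identity r (p : R * R -> R * R) (u : R * R -> R) (nE : V * V -> R * R) :
  RT0 m r Omega p -> DG m r Omega u -> (forall e, e \in interior_edges m -> unit_normal e (nE e)) ->
  intR2 Omega (fun y => u y * divergence Omega p y) =
  \sum_(e in interior_edges m) \sum_(j < r.+1) jump r u e (nE e) (nodeE j) * sigmaE p e (nE e) j -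
  \sum_(T in triangles m) \sum_(i in lattice r T) dot (grad (pieceDG r T u) (nodeT T i)) (sigmaT p T i).
Proof.
move=> [pRT pbd] uDG un; set d := divergence Omega p; have pd : weak_div Omega p d := divergenceP pRT.
pose P T := pieceRT r T p; pose U T := pieceDG r T u.
rewrite (intR2_Omega_pieces trO (q := fun T y => d y * U T y)); first last.
- move=> T TT; have [_ uU] := pieceDGP uDG TT.
  by move: uU; apply: negligibleS => y /=; apply: contra_not => uUy hy; rewrite uUy// mulrC.
- move=> T TT; have [M hM] := otri_box trO TT; have mT := measurable_otri trO TT.
  have [/poly_deglt_continuous cU _] := pieceDGP uDG TT.
  apply: (integrableM_continuous _ cU mT hM).
  by apply: (L2_integrable trO pd.1 mT _ hM); exact: (otri_Omega trO TT).
transitivity (\sum_(T in triangles m) (\sum_(e | tri_edge T e)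
    int_edge e (fun t => U T (epoint e t) * dot (P T (epoint e t)) (outer_normal T e)) -
    \sum_(i in lattice r T) dot (grad (U T) (nodeT T i)) (sigmaT p T i))).
  apply: eq_bigr => T TT; have [kU _] := pieceDGP uDG TT; have [CU _] := poly_deglt_C1 kU.
  have [PRT _] := pieceRTP pRT TT; have [c1 c2 _] := RT_local_C1 PRT.
  rewrite (weak_div_hull trO pRT pd TT (elementary_poly kU)).
  rewrite -(triangle_duality pRT uDG TT) (green_hull (mesh_nondegenerate trO TT) CU c1 c2).
  rewrite (eq_bigr (fun e => int_edge e (fun t => U T (epoint e t) *
    dot ((P T (epoint e t)).1, (P T (epoint e t)).2) (outer_normal T e)))) => [|e _].
    by rewrite opprB addrC subrK.
  by apply: int_edge_eq => t _; rewrite -surjective_pairing.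
rewrite sumrB; congr (_ - _); rewrite (sum_mesh_edges trO) [X in _ + X]big1 ?addr0 => [|e eB].
  by apply: eq_bigr => e eI; rewrite (edge_duality pRT uDG eI (un e eI)).
apply: big1 => T iT; rewrite -[RHS](int_edge0 e); apply: int_edge_eq => t t01.
by rewrite (pbd e T eB iT t t01) mulr0.
Qed.

End Duality.

(** * Prescribing the degrees of freedom *)

Section Prescribed.
Context {R : realType} (m : mesh R) (Omega : set (R * R)).
Notation MR := (measurableTypeR R).
Notation MP := (measurableTypeR R * measurableTypeR R)%type.
Local Notation V := 'I_(nvtx m).
Local Notation x := (@vtx R m).
Local Notation mu := (@lebesgue_measure R).
Local Notation incident := (@incident R m).
Implicit Types (T S : {set V}) (e : V * V) (u v : V) (y z : R * R) (w f : R * R -> R).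
Context (trO : triangulation m Omega).

Lemma L2_piecewise (q : {set V} -> R * R -> R) : (forall T, T \in triangles m -> continuous (q T)) ->
  L2 Omega (piecewise (m := m) q).
Proof.
move=> cq; have [iq _] := integrable_piecewise trO (fun T TT => integrable_otri trO TT (cq T TT)).
have cq2 T : T \in triangles m -> continuous (fun y => q T y * q T y).
  by move=> TT y; apply: cvgM; exact: cq.
have [iq2 _] := integrable_piecewise trO (fun T TT => integrable_otri trO TT (cq2 T TT)).
have mO := measurable_Omega trO.
split; first by move/integrableP: iq => [/measurable_EFinP + _]; exact: measurable_funTS.
have E y : piecewise (m := m) q y ^+ 2 = piecewise (m := m) (fun T y => q T y * q T y) y.
  have [[T TT oT]|H] := pselect (exists2 T, T \in triangles m & otri T y).
    by rewrite !(piecewise_on trO _ TT oT) expr2.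
  rewrite !(piecewise_off (m := m)) ?expr0n// => T TT oT; apply: H; exists T => //.
have /integrableP[_] := integrableS measurableT mO (@subsetT _ _) iq2.
apply: le_lt_trans; rewrite le_eqVlt; apply/orP; left; apply/eqP.
by apply: eq_integral => y _; rewrite /= -E ger0_norm ?sqr_ge0.
Qed.

Lemma pieceRT_unique r T (p q : R * R -> R * R) : T \in triangles m -> RT_local r q -> agree_on T p q ->
  pieceRT r T p = q.
Proof.
move=> TT qRT pq; have ndT := mesh_nondegenerate trO TT.
have [PRT pP] := @xgetPex _ (cst 0) [set q | RT_local r q /\ agree_on T p q] (ex_intro _ q (conj qRT pq)).
rewrite -/(pieceRT r T p) in PRT pP; set P := pieceRT r T p in PRT pP *.
have [k1 k2] := RT_local_comp PRT; have [l1 l2] := RT_local_comp qRT.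
have z (f g : R * R -> R) : poly_deglt r.+2 f -> poly_deglt r.+2 g ->
    (forall y, P y = q y -> f y = g y) -> forall y, f y = g y.
  move=> kf kg H y; apply/eqP; rewrite -subr_eq0; apply/eqP; move: y.
  have kfg : poly_deglt r.+2 (fun y => f y - g y).
    rewrite (_ : (fun y => _) = fun y => f y + (-1) * g y); first by apply: poly_degltD => //; exact: poly_degltZ.
    by apply/funext => y; rewrite mulN1r.
  apply: (poly_deglt_otri_eq0 ndT kfg); apply: (continuous_ae_eq0 ndT (poly_deglt_continuous kfg)).
  apply: negligibleS (negligibleU pP pq) => y [hy]; apply: contraNP => /not_orP[/contrapT /= h1 /contrapT /= h2].
  by rewrite subr_eq0; apply/eqP/H; rewrite -h1// -h2.
apply/funext => y; rewrite [LHS]surjective_pairing [RHS]surjective_pairing.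
by congr pair; [apply: (z _ _ k1 l1)|apply: (z _ _ k2 l2)] => z' ->.
Qed.

Lemma phiE_moments_eq0 r (q : {poly R}) : (size q <= r.+1)%N ->
  (forall j : 'I_r.+1, \int[mu]_(t in `[0, 1]) ((phiE j).[t] * q.[t]) = 0) -> q = 0.
Proof.
move=> qs q0; apply: (moments01_eq0 qs) => l lr.
have Xs : (size ('X^l : {poly R}) <= r.+1)%N by rewrite size_polyXn.
transitivity (\int[mu]_(t in `[0, 1]) (\sum_(j < r.+1) ('X^l : {poly R}).[nodeE j] * ((phiE j).[t] * q.[t]))).
  apply: eq_integral01 => t; rewrite -[t ^+ l]hornerXn (phiE_interp t Xs) mulr_suml.
  by apply: eq_bigr => j _; rewrite mulrA.
rewrite integral01_sum => [|j t]; last by apply: cvgM; exact: continuous_horner.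
by rewrite big1// => j _; rewrite q0 mulr0.
Qed.

Lemma tri_edge_tangent T e : T \in triangles m -> tri_edge T e -> dot (outer_normal T e) (tangent e) = 0.
Proof.
move=> TT /andP[e12 eT]; have iT : incident T e by rewrite /Defs.incident TT.
have [c TE] := incident_third trO e12 iT; case: e {e12 eT iT} TE => a b TE.
by have [[_ +] _] := outer_normalP (mesh_nondegenerate trO TT) TE.
Qed.

(** In Green's formula on the triangles, the edge terms cancel, so the piecewise
    divergence of the glued field is its weak divergence. *)
Lemma RT0_glue r (P : {set V} -> R * R -> R * R) :
  (forall T, T \in triangles m -> RT_local r (P T)) ->
  (forall e, e \in interior_edges m -> forall t,
     \sum_(T | incident T e) dot (P T (epoint e t)) (outer_normal T e) = 0) ->
  (forall e T, e \in boundary_edges m -> incident T e -> forall t, dot (P T (epoint e t)) (outer_normal T e) = 0) ->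
  exists p, RT0 m r Omega p /\ forall T, T \in triangles m -> pieceRT r T p = P T.
Proof.
move=> PRT Pint Pbd.
pose p y := (piecewise (m := m) (fun T y => (P T y).1) y, piecewise (m := m) (fun T y => (P T y).2) y).
pose d := piecewise (m := m) (fun T => div2 (P T)).
have pP T : T \in triangles m -> agree_on T p (P T).
  move=> TT; apply: negligibleS (negligibleU (agree_piecewise trO (fun T y => (P T y).1) TT)
    (agree_piecewise trO (fun T y => (P T y).2) TT)) => y /=.
  apply: contra_notP => /not_orP[/contrapT /= h1 /contrapT /= h2] hy.
  by rewrite /p h1// h2// -surjective_pairing.
have cc T : T \in triangles m -> [/\ continuous (fun y => (P T y).1), continuous (fun y => (P T y).2) & continuous (div2 (P T))].
  by move=> TT; have [c1 c2 c3] := RT_local_C1 (PRT T TT); split=> //; exact: C1_continuous.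
have pd : weak_div Omega p d.
  split; first by apply: L2_piecewise => T /cc[].
  move=> w [sw _ _]; have Cw := smooth_C1 sw; have cw := C1_continuous Cw.
  rewrite (intR2_Omega_pieces trO (q := fun T y => dot ((P T y).1, (P T y).2) (grad w y))); first last.
  - move=> T TT; move: (pP T TT); apply: negligibleS => y /=; apply: contra_not => pPy hy.
    by rewrite pPy// -surjective_pairing.
  - by move=> T TT; have [c1 c2 _] := cc T TT; apply: (integrable_otri trO TT); exact: continuous_dot_grad.
  rewrite (intR2_Omega_pieces trO (q := fun T y => div2 (P T) y * w y)); first last.
  - move=> T TT; move: (agree_piecewise trO (fun T => div2 (P T)) TT).
    by apply: negligibleS => y /=; apply: contra_not => dP hy; rewrite /d dP.
  - move=> T TT; have [_ _ c3] := cc T TT; apply: (integrable_otri trO TT) => y.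
    by apply: cvgM; [exact: c3|exact: cw].
  transitivity (\sum_(T in triangles m) (\sum_(e | tri_edge T e)
      int_edge e (fun t => w (epoint e t) * dot (P T (epoint e t)) (outer_normal T e)) -
      intR2 (hull T) (fun y => div2 (P T) y * w y))).
    apply: eq_bigr => T TT; have [c1 c2 _] := RT_local_C1 (PRT T TT).
    rewrite (green_hull (mesh_nondegenerate trO TT) Cw c1 c2); congr (_ - _).
  rewrite sumrB (sum_mesh_edges trO) [X in (_ + X) - _]big1 => [|e eB]; last first.
    apply: big1 => T iT; rewrite -[RHS](int_edge0 e); apply: int_edge_eq => t _.
    by rewrite (Pbd e T eB iT) mulr0.
  rewrite big1 ?addr0 ?sub0r// => e eI; have [e12 [A [B [AB iA iB _ sumE]]]] := interior_edgeP eI.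
  have cwP X : incident X e -> continuous (fun t : R => w (epoint e t) * dot (P X (epoint e t)) (outer_normal X e)).
    move=> iX t; apply: cvgM; first exact: (@continuous_segment _ _ (x e.1) (x e.2) cw).
    by apply: continuous_dot_trace; exact: PRT (incidentE iX).1.
  rewrite sumE /int_edge -mulrDr -integral01D; [|exact: cwP|exact: cwP].
  rewrite -[RHS](int_edge0 e); congr (_ * _); apply: eq_integral01 => t.
  by rewrite -mulrDr -(sumE (fun X => dot (P X (epoint e t)) (outer_normal X e))) Pint// mulr0.
have E T : T \in triangles m -> pieceRT r T p = P T by move=> TT; apply: pieceRT_unique => //; [exact: PRT|exact: pP].
exists p; split=> //; split; last by move=> e T eB iT t _; rewrite E ?Pbd//; have [] := incidentE iT.
split; last by move=> T TT; exists (P T); split; [exact: PRT|exact: pP].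
by split; [apply: L2_piecewise => T /cc[]|apply: L2_piecewise => T /cc[]|exists d].
Qed.

(** The prescribed moment of an interior edge is given to both triangles, with
    the sign that relates the outer normal to the fixed one. The moments of the
    two outward traces are then opposite, hence so are the traces themselves. *)
Lemma RT0_dofs r (nE : V * V -> R * R) (sT : forall T : {set V}, {ffun V -> 'I_r} -> R * R)
    (sE : V * V -> 'I_r.+1 -> R) :
  (forall e, e \in interior_edges m -> unit_normal e (nE e)) ->
  exists p, [/\ RT0 m r Omega p,
    forall T (i : {ffun V -> 'I_r}), T \in triangles m -> i \in lattice r T -> sigmaT p T i = sT T i &
    forall e j, e \in interior_edges m -> sigmaE p e (nE e) j = sE e j].
Proof.
move=> un; pose k T e : R := dot (outer_normal T e) (nE e).
have /choice[P PP] T : exists q : R * R -> R * R, T \in triangles m -> [/\ RT_local r q,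
    forall (c : bool) i, i \in lattice r T -> intR2 (hull T) (fun y => phiT T i y * coord2 c (q y)) = coord2 c (sT T i) &
    forall e (j : 'I_r.+1), tri_edge T e -> \int[mu]_(t in `[0, 1])
      ((phiE j).[t] * dot (q (epoint e t)) (outer_normal T e)) =
      if e \in interior_edges m then k T e * sE e j / elength e else 0].
  have [TT|TT] := boolP (T \in triangles m); last by exists (cst 0).
  have [q Hq] := RT_local_dofs (fun c i => coord2 c (sT T i))
    (fun e j => if e \in interior_edges m then k T e * sE e j / elength e else 0) (mesh_nondegenerate trO TT).
  by exists q.
have PRT T : T \in triangles m -> RT_local r (P T) by move=> /PP[].
have trace T e : T \in triangles m -> tri_edge T e -> exists2 q : {poly R}, (size q <= r.+1)%N &
    (forall t, dot (P T (epoint e t)) (outer_normal T e) = q.[t]) /\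
    forall j : 'I_r.+1, \int[mu]_(t in `[0, 1]) ((phiE j).[t] * q.[t]) =
      if e \in interior_edges m then k T e * sE e j / elength e else 0.
  move=> TT eT; have [q qs qE] := RT_local_trace (PRT T TT) (tri_edge_tangent TT eT).
  exists q => //; split=> // j; have [_ _ H] := PP T TT; rewrite -(H e j eT).
  by apply: eq_integral01 => t; rewrite qE.
have iedge T e : (e.1 < e.2)%N -> incident T e -> T \in triangles m /\ tri_edge T e.
  by move=> e12 /andP[TT eT]; rewrite /tri_edge e12.
have [p [pRT pP]] : exists p, RT0 m r Omega p /\ forall T, T \in triangles m -> pieceRT r T p = P T.
  apply: RT0_glue => // [e eI t|e T eB iT t].
    have [e12 [A [B [AB iA iB _ sumE]]]] := interior_edgeP eI; rewrite sumE.
    have [TA eA] := iedge A e e12 iA; have [TB eB] := iedge B e e12 iB.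
    have [qA sA [fA mA]] := trace A e TA eA; have [qB sB [fB mB]] := trace B e TB eB.
    rewrite fA fB -hornerD (_ : qA + qB = 0) ?horner0//; apply: (@phiE_moments_eq0 r) => [|j].
      by rewrite (leq_trans (size_polyD _ _))// geq_max sA sB.
    rewrite -[RHS](_ : \int[mu]_(t in `[0, 1]) ((phiE j).[t] * qA.[t]) + \int[mu]_(t in `[0, 1]) ((phiE j).[t] * qB.[t]) = 0).
      rewrite -integral01D; first by apply: eq_integral01 => s; rewrite hornerD mulrDr.
        by move=> s; apply: cvgM; exact: continuous_horner.
      by move=> s; apply: cvgM; exact: continuous_horner.
    rewrite mA mB eI (_ : k B e = - k A e) ?mulNr ?subrr//.
    by rewrite /k !(dotC _ (nE e)) (outer_normal_opp trO _ e12 iA iB AB).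
  have e12 : (e.1 < e.2)%N by move: eB; rewrite inE => /andP[].
  have [TT eT] := iedge T e e12 iT; have [q qs [qE mq]] := trace T e TT eT.
  rewrite qE (_ : q = 0) ?horner0//; apply: (phiE_moments_eq0 qs) => j; rewrite mq ifF//.
  by apply/negP; move: eB; rewrite !inE => /andP[_ /eqP ->]; rewrite andbF.
exists p; split=> // [T i TT iL|e j eI].
  have [_ H _] := PP T TT; rewrite (sigmaT_piece pRT.1)// pP//.
  by rewrite [RHS]surjective_pairing; congr pair; [exact: (H false)|exact: (H true)].
have [e12 [A [B [AB iA _ _ _]]]] := interior_edgeP eI; have [TA eA] := iedge A e e12 iA.
have [k2 fA] := outer_normal_sign trO e12 iA (un e eI); rewrite -/(k A e) in k2 fA.
have [q qs [qE mq]] := trace A e TA eA.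
have L := edge_length_gt0 trO e12 iA.
transitivity (int_edge e (fun t => k A e * ((phiE j).[t] * q.[t]))).
  apply: int_edge_eq => t t01; rewrite (normal_traceP trO pRT.1 eI (un e eI) iA t01) pP//.
  rewrite -qE fA; move: (dot _ (nE e)) (phiE j).[t] (k A e) k2 => a b c c2.
  have -> : c * (b * (c * a)) = c ^+ 2 * (b * a) by ring.
  by rewrite c2 mul1r.
rewrite /int_edge integral01Z => [|t]; last by apply: cvgM; exact: continuous_horner.
rewrite mq eI !mulrA mulrC !mulrA mulVf ?lt0r_neq0// mul1r.
by rewrite -expr2 k2 mul1r.
Qed.

End Prescribed.

(** * Dual norms in the plane *)

Section DualNorm.
Context {R : realType}.
Implicit Types (a b : R * R) (s : \bar R).
Local Notation conj := (@hoelder_conjugate R).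

Lemma lnorm_cases s : (1 <= s)%E -> [\/ s = +oo%E /\ conj s = 1%:E, s = 1%:E /\ conj s = +oo%E |
  exists p q : R, [/\ s = p%:E, conj s = q%:E, 1 < p, 0 < q & p^-1 + q^-1 = 1]].
Proof.
case: s => [p| |] // p1; last by apply: Or31; rewrite hoelder_conjugatey.
have [->|pn1] := eqVneq p 1; first by apply: Or32; rewrite hoelder_conjugate1.
have {p1} p1 : 1 < p by rewrite lt_neqAle eq_sym pn1.
have p0 : p != 0 by rewrite gt_eqF// (lt_trans ltr01).
have p10 : p - 1 != 0 by rewrite subr_eq0.
apply: Or33; exists p, (p / (p - 1)); split=> //.
- by rewrite /hoelder_conjugate/= eqe (negbTE p0) -EFinD inver (negbTE p10) EFinM.
- by rewrite divr_gt0 ?subr_gt0// (lt_trans ltr01).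
- by field; rewrite p0 p10.
Qed.

Lemma lnorm_ge0 s a : (1 <= s)%E -> 0 <= lnorm s a.
Proof. by case: s => [p| |] //= _; rewrite ?powR_ge0 ?le_max ?normr_ge0. Qed.

Lemma lnorm1 a : lnorm 1%:E a = `|a.1| + `|a.2|.
Proof. by rewrite /= invr1 !powRr1 ?addr_ge0. Qed.

Lemma powR_root (t p : R) : 0 < p -> 0 <= t -> (t `^ p) `^ p^-1 = t.
Proof. by move=> p0 t0; rewrite -powRrM mulfV ?gt_eqF// powRr1. Qed.

Lemma lnormZ s (c : R) b : (1 <= s)%E -> 0 <= c -> lnorm s (c *: b) = c * lnorm s b /\
  lnorm (conj s) (c *: b) = c * lnorm (conj s) b.
Proof.
move=> s1 c0; have H (p : R) : 0 < p -> lnorm p%:E (c *: b) = c * lnorm p%:E b.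
  move=> p0; rewrite /= !normrM (ger0_norm c0) !powRM ?normr_ge0//= -mulrDr.
  by rewrite powRM ?addr_ge0 ?powR_ge0// powR_root.
have Hy : lnorm +oo%E (c *: b) = c * lnorm +oo%E b by rewrite /= !normrM (ger0_norm c0) maxr_pMr.
by have [[-> ->]|[-> ->]|[p [q [-> -> p1 q0 _]]]] := lnorm_cases s1; split=> //; apply: H => //;
  exact: lt_trans p1.
Qed.

Lemma lnormN s b : lnorm s (- b) = lnorm s b.
Proof.
have e1 : `|(- b).1| = `|b.1| := normrN _; have e2 : `|(- b).2| = `|b.2| := normrN _.
by rewrite /lnorm e1 e2.
Qed.

Lemma lnorm_hoelder s a b : (1 <= s)%E -> `|dot a b| <= lnorm s a * lnorm (conj s) b.
Proof.
move=> s1; rewrite /dot; apply: le_trans (ler_normD _ _) _; rewrite !normrM.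
have mx (c d e f : R) : 0 <= e -> 0 <= f -> c * e + d * f <= Num.max c d * (e + f).
  by move=> e0 f0; rewrite mulrDr lerD// ler_wpM2r// le_max lexx ?orbT.
have [[-> ->]|[-> ->]|[p [q [-> -> p1 q0 pq]]]] := lnorm_cases s1.
- by rewrite lnorm1; exact: mx.
- by rewrite lnorm1 [leRHS]mulrC [`|a.1| * _]mulrC [`|a.2| * _]mulrC; exact: mx.
- by apply: hoelder2 => //; exact: lt_trans p1.
Qed.

Lemma sg_dual (t : R) : t * Num.sg t = `|t|.
Proof. by rewrite mulrC -normrEsg. Qed.

Lemma norm_sg_le1 (t : R) : `|Num.sg t| <= 1.
Proof. by rewrite normr_sg; case: (t != 0). Qed.

(** Signs suffice at the two end points of the scale; in between, equality in
    the Hoelder inequality needs [|b|^q] proportional to [|a|^p]. *)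
Lemma lnorm_dual s a : (1 <= s)%E -> exists2 b, lnorm (conj s) b <= 1 & dot a b = lnorm s a.
Proof.
move=> s1; have [[-> ->]|[-> ->]|[p [q [-> -> p1 q0 pq]]]] := lnorm_cases s1.
- have [h|h] := leP `|a.1| `|a.2|.
    by exists (0, Num.sg a.2); rewrite ?lnorm1 /dot /= ?normr0 ?add0r ?norm_sg_le1// mulr0 add0r sg_dual max_r.
  by exists (Num.sg a.1, 0); rewrite ?lnorm1 /dot /= ?normr0 ?addr0 ?norm_sg_le1// mulr0 addr0 sg_dual max_l// ltW.
- exists (Num.sg a.1, Num.sg a.2); first by rewrite /= ge_max !norm_sg_le1.
  by rewrite lnorm1 /dot /= !sg_dual.
have p0 : 0 < p by exact: lt_trans p1.
have qp : (p - 1) * q = p.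
  have -> : q = p / (p - 1).
    rewrite -[q]invrK (_ : q^-1 = 1 - p^-1); last by rewrite -pq addrC addKr.
    by field; rewrite subr_eq0 !gt_eqF.
  by rewrite mulrC divfK// subr_eq0 gt_eqF.
set N := lnorm p%:E a; have N0 : 0 <= N by exact: powR_ge0.
have NE : N `^ p = `|a.1| `^ p + `|a.2| `^ p.
  by rewrite /N /= -powRrM mulVf ?gt_eqF// powRr1// addr_ge0 ?powR_ge0.
have [N00|Np] := eqVneq N 0.
  exists 0; last by rewrite /dot !mulr0 addr0 N00.
  by rewrite /= !normr0 powR0 ?gt_eqF// addr0 powR0 ?invr_eq0 ?gt_eqF.
have {}Np : 0 < N by rewrite lt_neqAle eq_sym Np.
have M0 : 0 < N `^ (p - 1) by exact: powR_gt0.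
pose f (t : R) := Num.sg t * `|t| `^ (p - 1) / N `^ (p - 1).
have fq t : `|f t| `^ q = `|t| `^ p / N `^ p.
  rewrite /f !normrM normfV normr_sg !(ger0_norm (powR_ge0 _ _)).
  have [->|t0] := eqVneq t 0.
    by rewrite !mul0r normr0 !powR0 ?gt_eqF// mul0r.
  by rewrite mul1r powRM ?invr_ge0 ?powR_ge0// -!powRN -!powRrM mulNr qp.
have ft t : t * f t = `|t| `^ p / N `^ (p - 1).
  by rewrite /f !mulrA sg_dual mulr_powRB1.
exists (f a.1, f a.2).
  by rewrite /= !fq -mulrDl -NE divff ?powR1 ?lexx// lt0r_neq0// powR_gt0.
rewrite /dot /= !ft -mulrDl -NE -(mulr_powRB1 (ltW Np) p0) mulfK//.
exact: lt0r_neq0.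
Qed.

End DualNorm.

(** * The discrete total variation *)

Section TotalVariation.
Context {R : realType} (m : mesh R) (Omega : set (R * R)).
Local Notation V := 'I_(nvtx m).
Implicit Types (T S : {set V}) (e : V * V).
Context (trO : triangulation m Omega).

Lemma weightE_ge0 r e (j : 'I_r.+1) : (r <= 4)%N -> 0 <= weightE (m := m) e j.
Proof. by move=> r4; rewrite mulr_ge0 ?sqrtr_ge0// integral_phiE_ge0. Qed.

(** The interpolatory integrals are quadrature rules with the weights of the
    constraint set. *)
Lemma DTV_quadrature r s (nE : V * V -> R * R) (u : R * R -> R) :
  DTV r s nE u =
  \sum_(T in triangles m) \sum_(i in lattice r T)
    lnorm s (grad (pieceDG r T u) (nodeT T i)) * weightT T i +
  \sum_(e in interior_edges m) \sum_(j < r.+1)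
    `|jump r u e (nE e) (nodeE j)| * lnorm s (nE e) * weightE e j.
Proof.
rewrite /DTV; congr (_ + _); apply: eq_bigr.
  move=> T TT; have ndT := mesh_nondegenerate trO TT; rewrite /interpT.
  rewrite (intR2_hull_sum_in (fun i => lnorm s (grad (pieceDG r T u) (nodeT T i))) ndT)// => i iL.
  exact: poly_deglt_continuous (poly_deglt_phiT ndT iL).
move=> e _; rewrite /interpE.
rewrite (int_edge_sum e (fun j : 'I_r.+1 => `|jump r u e (nE e) (nodeE j)| * lnorm s (nE e)))// => j t.
exact: continuous_horner.
Qed.

End TotalVariation.

Theorem theorem3p2 (R : realType) (Omega : set (R * R)) (m : mesh R)
    (nE : 'I_(nvtx m) * 'I_(nvtx m) -> R * R) (r : nat) (s : \bar R)
    (u : R * R -> R) :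
  bounded_domain Omega ->
  triangulation m Omega ->
  (forall e, e \in interior_edges m -> unit_normal e (nE e)) ->
  (r <= 4)%N ->
  (1 <= s)%E ->
  DG m r Omega u ->
  (DTV r s nE u)%:E =
   ereal_sup
     [set (intR2 Omega (fun y => u y * divergence Omega p y))%:E
       | p in [set p : R * R -> R * R |
           [/\ RT0 m r Omega p,
               forall (T : {set 'I_(nvtx m)}) (i : {ffun 'I_(nvtx m) -> 'I_r}),
                 T \in triangles m -> i \in lattice r T ->
                 lnorm (hoelder_conjugate s) (sigmaT p T i) <= weightT T i &
               forall (e : 'I_(nvtx m) * 'I_(nvtx m)) (j : 'I_r.+1),
                 e \in interior_edges m ->
                 `|sigmaE p e (nE e) j| <= lnorm s (nE e) * weightE e j]]].
Proof.
move=> _ trO un r4 s1 uDG; rewrite (DTV_quadrature trO).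
apply/eqP; rewrite eq_le; apply/andP; split; last first.
  apply: ge_ereal_sup => _ [p [pRT pT pE] <-]; rewrite lee_fin.
  rewrite (duality_identity trO pRT uDG un) addrC lerD//.
    rewrite -sumrN ler_sum// => T TT; rewrite -sumrN ler_sum// => i iL.
    apply: le_trans (ler_norm _) _; rewrite normrN; apply: le_trans (lnorm_hoelder _ _ s1) _.
    by rewrite ler_wpM2l ?lnorm_ge0// pT.
  rewrite ler_sum// => e eI; rewrite ler_sum// => j _.
  by apply: le_trans (ler_norm _) _; rewrite normrM -mulrA ler_wpM2l// pE.
(* the maximizer: extremal vectors for the dual norm on the triangles, signs
   of the jumps on the edges, both scaled by the weights *)
pose G (T : {set 'I_(nvtx m)}) (i : {ffun 'I_(nvtx m) -> 'I_r}) := grad (pieceDG r T u) (nodeT T i).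
have [nu nu1 nuE] : exists2 nu : R * R -> R * R, forall a, lnorm (hoelder_conjugate s) (nu a) <= 1 &
    forall a, dot a (nu a) = lnorm s a.
  have /choice[nu H] a : exists b, lnorm (hoelder_conjugate s) b <= 1 /\ dot a b = lnorm s a.
    by have [b ? ?] := lnorm_dual a s1; exists b.
  by exists nu => a; have [] := H a.
have [p [pRT pT pE]] := RT0_dofs trO (fun T i => - (weightT T i *: nu (G T i)))
  (fun e j => Num.sg (jump r u e (nE e) (nodeE j)) * (lnorm s (nE e) * weightE e j)) un.
apply: ereal_sup_ubound; exists p.
  split=> // [T i TT iL|e j eI].
    have w0 := weightT_ge0 (mesh_nondegenerate trO TT) r4 iL.
    by rewrite pT// lnormN (lnormZ _ s1 w0).2 ler_piMr.
  rewrite pE// normrM [X in _ * X]ger0_norm; last by rewrite mulr_ge0 ?lnorm_ge0 ?weightE_ge0.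
  by rewrite ler_piMl ?norm_sg_le1// mulr_ge0 ?lnorm_ge0 ?weightE_ge0.
congr EFin; rewrite (duality_identity trO pRT uDG un) addrC; congr (_ + _).
  rewrite -sumrN; apply: eq_bigr => T TT; rewrite -sumrN; apply: eq_bigr => i iL.
  have E (g n : R * R) (w : R) : - dot g (- (w *: n)) = dot g n * w.
    by rewrite /dot /= /GRing.scale/=; ring.
  by rewrite pT// E nuE.
apply: eq_bigr => e eI; apply: eq_bigr => j _; rewrite pE//.
by rewrite mulrA sg_dual mulrA.
Qed.
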